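(* Let $f\colon\mathbb{R}^d\to\mathbb{R}\cup\{\infty\}$ be a closed and $\rho$-weakly convex function and let $\bar x$ be any critical point of $f$. Suppose that $f$ admits a $C^2$ active manifold $\mathcal{M}$ at $\bar x$. Then for any $\mu\in(0,\rho^{-1})$, the Moreau envelope $f_\mu$ is $C^2$-smooth around $\bar x$ and its Hessian satisfies $$\min_{h\in\mathbb{S}^{d-1}\cap T_{\mathcal{M}}(\bar x)}\langle\nabla^2f_\mu(\bar x)h,h\rangle\le\min_{h\in\mathbb{S}^{d-1}\cap T_{\mathcal{M}}(\bar x)}d^2f_{\mathcal{M}}(\bar x)(h).$$ Consequently, if $\bar x$ is a strict saddle point of $f$, then $\bar x$ is both a strict saddle point of $f_\mu$ and an unstable fixed point of the proximal map $\mathrm{prox}_{\mu f}$. Moreover, in this case the Jacobian $\nabla\mathrm{prox}_{\mu f}(\bar x)$ has a real eigenvalue that is strictly greater than one.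
   Context: A function $f\colon\mathbb{R}^d\to\mathbb{R}\cup\{\infty\}$ is closed if its epigraph is closed; it is $\rho$-weakly convex ($\rho>0$) if $x\mapsto f(x)+\frac{\rho}{2}\|x\|^2$ is convex, and weakly convex if it is $\rho$-weakly convex for some $\rho>0$. $\mathbb{S}^{d-1}$ is the unit sphere of $\mathbb{R}^d$. For $0<\mu<\rho^{-1}$: $f_\mu(x)=\inf_y\{f(y)+\frac1{2\mu}\|y-x\|^2\}$ (Moreau envelope) and $\mathrm{prox}_{\mu f}(x)=\mathrm{argmin}_y\{f(y)+\frac1{2\mu}\|y-x\|^2\}$ (proximal map). Subdifferential: if $f(\bar x)$ is finite, $\partial f(\bar x)$ is the set of $v$ with $f(x)\ge f(\bar x)+\langle v,x-\bar x\rangle+o(\|x-\bar x\|)$ as $x\to\bar x$; $\partial f(\bar x)=\emptyset$ if $f(\bar x)=\infty$. A point $\bar x$ is critical for $f$ if $0\in\partial f(\bar x)$. Manifolds: $\mathcal{M}\subset\mathbb{R}^d$ is a $C^p$ manifold of dimension $r$ around $\bar x\in\mathcal{M}$ if there are an open neighborhood $U$ of $\bar x$ and a $C^p$ map $G\colon\mathbb{R}^d\to\mathbb{R}^{d-r}$ with $\nabla G(\bar x)$ of full rank and $\mathcal{M}\cap U=\{x\in U:G(x)=0\}$. The tangent space is $T_{\mathcal{M}}(\bar x)=\ker\nabla G(\bar x)$. Active manifold: for a closed weakly convex $f$ with critical point $\bar x$, a set $\mathcal{M}\ni\bar x$ is an active $C^p$ manifold around (at) $\bar x$ if there is a neighborhood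 $U$ of $\bar x$ such that (smoothness) $\mathcal{M}\cap U$ is a $C^p$-smooth manifold and the restriction of $f$ to $\mathcal{M}\cap U$ is $C^p$-smooth; (sharpness) $\inf\{\|v\|:v\in\partial f(x),\ x\in U\setminus\mathcal{M}\}>0$ (with $\inf\emptyset=+\infty$; so all of $\mathbb{R}^d$, or a neighborhood of $\bar x$, is active when $f$ is $C^p$ there). Second-order variation: $f_{\mathcal{M}}:=f+\delta_{\mathcal{M}}$, where $\delta_{\mathcal M}$ is $0$ on $\mathcal M$ and $+\infty$ off it. If $\mathcal{M}$ is an active $C^2$ manifold at the critical point $\bar x$ and $u\in T_{\mathcal{M}}(\bar x)$, then $d^2f_{\mathcal{M}}(\bar x)(u)$ denotes the parabolic subderivative $\liminf_{t\searrow0,\,w'\to w}\frac{f_{\mathcal{M}}(\bar x+tu+\frac12t^2w')-f_{\mathcal{M}}(\bar x)}{\frac12t^2}$, whose value is the same for all $w$ for which it is finite. Equivalently, if $F$ is a $C^2$ function agreeing with $f$ on $\mathcal{M}$ near $\bar x$, $G=0$ are local defining equations of $\mathcal{M}$, and $\bar\lambda$ is the unique multiplier with $\nabla F(\bar x)+\sum_i\bar\lambda_i\nabla G_i(\bar x)=0$, then $d^2f_{\mathcal{M}}(\bar x)(u)=\langle(\nabla^2F(\bar x)+\sum_i\bar\lambda_i\nabla^2G_i(\bar x))u,u\rangle$. Strict saddle: a critical point $\bar x$ of a weakly convex $f$ is a strict saddle if there is a $C^2$ active manifold $\mathcal{M}$ of $f$ at $\bar x$ and $d^2f_{\mathcal{M}}(\bar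 x)(u)<0$ for some $u\in T_{\mathcal{M}}(\bar x)$. Unstable fixed point: a fixed point $\bar x$ of $T\colon\mathbb{R}^d\to\mathbb{R}^d$ is unstable if $T$ is $C^1$-smooth around $\bar x$ and $\nabla T(\bar x)$ has an eigenvalue of magnitude strictly greater than one. Minima over an empty set are $+\infty$. *)

(* Defs.v *)
From HB Require Import structures.
From mathcomp Require Import all_boot all_order all_algebra.
From mathcomp Require Import complex.
From mathcomp Require Import all_classical all_reals all_analysis.

Set Implicit Arguments.
Unset Strict Implicit.
Unset Printing Implicit Defensive.

Import Order.TTheory GRing.Theory Num.Theory.
Import numFieldNormedType.Exports.

Local Open Scope classical_set_scope.
Local Open Scope ring_scope.

(* Points of R^d are row vectors 'rV[R]_d.  The library norm `|x| on 'rV[R]_d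
   is the sup norm: it provides the topology and the differential calculus,
   while every metric quantity below uses the Euclidean norm enorm.
   The Jacobian 'J T x of the library acts on row vectors: the derivative of T
   at x in the direction v is v *m 'J T x.
   Functions R^d -> R \cup {oo} are maps f : 'rV[R]_d -> \bar R such that
   f x != -oo for all x. *)

Section Euclidean.
Context {R : realType} {d : nat}.
Implicit Types x y : 'rV[R]_d.

Definition dotv x y : R := (x *m y^T) 0 0.

Definition enorm x : R := Num.sqrt (dotv x x).

Definition esphere : set 'rV[R]_d := [set x | enorm x = 1].

End Euclidean.

(* [is_min A m]: m is the minimum of A (attained), and +oo if A is empty. *)
Definition is_min {R : realType} (A : set (\bar R)) (m : \bar R) : Prop :=
  (A = set0 /\ m = +oo%E) \/ (A m /\ lbound A m).

Section Smoothness.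
Context {R : realType} {d : nat}.

(* C^k smoothness on a set U, used only for open U. *)
Fixpoint Ck_on {W : normedModType R} (k : nat) (U : set 'rV[R]_d)
    (F : 'rV[R]_d -> W) {struct k} : Prop :=
  match k with
  | 0 => forall x, U x -> {for x, continuous F}
  | k'.+1 => (forall x, U x -> differentiable F x) /\
             (forall v : 'rV[R]_d, Ck_on k' U ('D_v F))
  end.

Definition smooth_around {W : normedModType R} (k : nat)
    (F : 'rV[R]_d -> W) (x : 'rV[R]_d) : Prop :=
  exists2 U : set 'rV[R]_d, open_nbhs x U & Ck_on k U F.

Definition esmooth_around (k : nat) (f : 'rV[R]_d -> \bar R) (x : 'rV[R]_d)
    : Prop :=
  (\forall y \near x, f y \is a fin_num) /\
  smooth_around k (fun y => fine (f y) : R^o) x.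

Definition hessian (F : 'rV[R]_d -> R) (x : 'rV[R]_d) : 'M[R]_d :=
  \matrix_(i, j) 'D_(delta_mx 0 i) ('D_(delta_mx 0 j) (F : _ -> R^o)) x.

End Smoothness.

Section WeaklyConvex.
Context {R : realType} {d : nat}.
Implicit Types (f g : 'rV[R]_d -> \bar R) (rho mu : R).

Local Open Scope ereal_scope.

Definition closed_fun f : Prop :=
  closed [set p : 'rV[R]_d * R | f p.1 <= p.2%:E].

(* At t = 0 or t = 1 the convention 0 * +oo = 0 makes the inequality trivial. *)
Definition econvex g : Prop :=
  forall (x y : 'rV[R]_d) (t : R), (0 <= t <= 1)%R ->
    g (t *: x + (1 - t) *: y)%R <= t%:E * g x + (1 - t)%:E * g y.

Definition weakly_convex_with rho f : Prop :=
  econvex (fun x => f x + (rho / 2 * enorm x ^+ 2)%:E).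

Definition weakly_convex f : Prop :=
  exists2 rho, (0 < rho)%R & weakly_convex_with rho f.

Definition prox_objective mu f (x y : 'rV[R]_d) : \bar R :=
  f y + ((2 * mu)^-1 * enorm (y - x) ^+ 2)%:E.

Definition moreau mu f (x : 'rV[R]_d) : \bar R :=
  ereal_inf (range (prox_objective mu f x)).

Definition prox_set mu f (x : 'rV[R]_d) : set 'rV[R]_d :=
  [set y | forall z, prox_objective mu f x y <= prox_objective mu f x z].

(* When f is closed, rho-weakly convex and not identically +oo and
   0 < mu < rho^-1, prox_set mu f x is a singleton, of which prox mu f x is the
   element; the default value 0 plays no role. *)
Definition prox mu f (x : 'rV[R]_d) : 'rV[R]_d := xget 0%R (prox_set mu f x).

Definition subdiff f (x : 'rV[R]_d) : set 'rV[R]_d :=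
  [set v | f x \is a fin_num /\
    exists2 r : 'rV[R]_d -> R^o,
      r =o_x (fun y => enorm (y - x)%R : R^o) &
      \forall y \near x, f x + (dotv v (y - x) + r y)%:E <= f y].

Definition critical f (x : 'rV[R]_d) : Prop := subdiff f x 0%R.

End WeaklyConvex.

Section Manifolds.
Context {R : realType} {d : nat}.
Implicit Types (M U : set 'rV[R]_d) (f : 'rV[R]_d -> \bar R) (x : 'rV[R]_d).

Definition defining_map (k r : nat) M x U (G : 'rV[R]_d -> 'rV[R]_(d - r))
    : Prop :=
  [/\ open_nbhs x U, Ck_on k setT G, \rank ('J G x) = (d - r)%N
    & M `&` U = [set y | U y /\ G y = 0]].

Definition manifold_around (k r : nat) M x : Prop :=
  [/\ (r <= d)%N, M x & exists U G, @defining_map k r M x U G].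

(* The kernel does not depend on the choice of the defining map, and C^1
   regularity is enough for this. *)
Definition tangent_space M x : set 'rV[R]_d :=
  [set u | exists r U (G : 'rV[R]_d -> 'rV[R]_(d - r)),
    [/\ (r <= d)%N, M x, defining_map 1 M x U G & u *m 'J G x = 0]].

(* Smoothness of the restriction of f to a submanifold S: f is locally the
   restriction of a C^k function of the ambient space. *)
Definition smooth_restriction (k : nat) f (S : set 'rV[R]_d) : Prop :=
  forall x, S x -> exists V (F : 'rV[R]_d -> R^o),
    [/\ open_nbhs x V, Ck_on k V F
      & forall y, S y -> V y -> f y = (F y)%:E].

Definition active_manifold (k : nat) f M x : Prop :=
  M x /\ exists U : set 'rV[R]_d,
    [/\ open_nbhs x U,
        exists r, forall y, (M `&` U) y -> manifold_around k r (M `&` U) y,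
        smooth_restriction k f (M `&` U)
      & (0 < ereal_inf [set e | exists y v,
           [/\ (U `\` M) y, subdiff f y v & e = (enorm v)%:E]])%E].

Local Open Scope ereal_scope.

Definition restrict_to f M (y : 'rV[R]_d) : \bar R :=
  f y + (if `[< M y >] then 0 else +oo).

Definition parabolic_subderivative (g : 'rV[R]_d -> \bar R)
    (x u w : 'rV[R]_d) : \bar R :=
  limf_einf
    (fun p : R * 'rV[R]_d =>
       (g (x + p.1 *: u + (2^-1 * p.1 ^+ 2) *: p.2)%R - g x)
         * ((2^-1 * p.1 ^+ 2)^-1)%:E)
    (filter_prod (0%R : R)^'+ (nbhs w)).

(* d^2 f_M(x)(u): if M is an active C^2 manifold at the critical point x and u
   is tangent, the parabolic subderivative is finite for some w and takes the
   same value for all such w. *)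
Definition second_variation f M (x u : 'rV[R]_d) : \bar R :=
  xget +oo [set c | c \is a fin_num /\
    exists w, parabolic_subderivative (restrict_to f M) x u w = c].

(* The first three conditions are the standing assumptions under which active
   manifolds and strict saddles are defined. *)
Definition strict_saddle f x : Prop :=
  [/\ forall y, f y != -oo, closed_fun f, weakly_convex f, critical f x
    & exists M u, [/\ active_manifold 2 f M x, tangent_space M x u
                    & second_variation f M x u < 0]].

End Manifolds.

(* Eigenvalues of the real matrix 'J T x are taken in the complex field R[i]. *)
Definition unstable_fixed_point {R : realType} {d : nat}
    (T : 'rV[R]_d -> 'rV[R]_d) (x : 'rV[R]_d) : Prop :=
  [/\ T x = x, smooth_around 1 T x
    & exists2 z : complex R,
        eigenvalue (map_mx (real_complex R) ('J T x)) z & 1 < `|z|].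

(* Main.v *)
(** Write P for the proximal map and m for the Moreau envelope.  Weak convexity
   makes P a single-valued Lipschitz map fixing xbar, and m differentiable with
   gradient (x - P x) / mu.  Since (x - P x) / mu is a subgradient of f at P x
   which tends to 0 as x tends to xbar, sharpness forces P x to lie on M for x
   near xbar.  There f is the restriction of a C^2 function F and M = {G = 0},
   so P x and its multiplier lambda solve the system
     grad F y + sum_j lambda_j grad G_j y + y / mu = x / mu,   G y = 0,
   whose Jacobian is invertible at xbar because the Hessian Q of the Lagrangian
   satisfies Q >= - rho > - 1 / mu on the tangent space.  Hence P is C^1, so m is
   C^2.  As m <= f, with equality and vanishing first-order terms at xbar,
   comparing second-order expansions along curves in M gives the inequality
   between the Hessian of m and Q, and Q computes the second variation.
   Finally the Hessian of m is the symmetric matrix (1 - P') / mu, so a negative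
   curvature direction yields an eigenvalue of P' larger than 1. *)

Require Import Defs.
From HB Require Import structures.
From mathcomp Require Import all_boot all_order all_algebra.
From mathcomp Require Import complex ring lra.
From mathcomp Require Import all_classical all_reals all_analysis.

Import Order.TTheory GRing.Theory Num.Theory.
Import numFieldNormedType.Exports.

Local Open Scope classical_set_scope.
Local Open Scope ring_scope.

Set Implicit Arguments.
Unset Strict Implicit.

(** * Euclidean structure and matrices *)

(** Existence and smoothness of [P] are settled separately. Compactness and weak convexity give [P]
    and its continuity; the multiplier is then an explicit matrix expression in [P x], built from
    one fixed right inverse [B] of the Jacobian at xbar. The stationarity system thus comes with a
    continuous solution, and the invertible derivative serves only to differentiate it. A curve in M
    is represented by a weaker datum: for each small t, some point of M at distance o(t) from x + t
    u, or o(t^2) from a parabola. This is exactly what metric regularity of G = 0 provides. It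
    suffices because second-order comparisons use the Lagrangian rather than F: the two agree on M,
    but the gradient of the Lagrangian vanishes at xbar, so that a displacement of order o(t)
    changes its value by o(t^2) only. The bound Q >= - rho is the same comparison, made with f +
    rho/2 |. - xbar|^2, which is minimal at xbar. Topology and derivatives live in the sup norm,
    convexity in the Euclidean one; passing between them costs factors of the dimension, often
    written with a successor so that dimension 0 is covered. *)

Section Dot.
Context {R : realType} {n : nat}.
Implicit Types (x y z : 'rV[R]_n) (a : R).

Lemma dotvE x y : dotv x y = \sum_i x 0 i * y 0 i.
Proof. by rewrite /dotv mxE; apply: eq_bigr => i _; rewrite mxE. Qed.

Lemma dotvC x y : dotv x y = dotv y x.
Proof. by rewrite !dotvE; apply: eq_bigr => i _; rewrite mulrC. Qed.

Lemma dotvDl x y z : dotv (x + y) z = dotv x z + dotv y z.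
Proof. by rewrite /dotv mulmxDl mxE. Qed.

Lemma dotvZl a x y : dotv (a *: x) y = a * dotv x y.
Proof. by rewrite /dotv -scalemxAl mxE. Qed.

Lemma dotvNl x y : dotv (- x) y = - dotv x y.
Proof. by rewrite /dotv mulNmx mxE. Qed.

Lemma dotvDr x y z : dotv z (x + y) = dotv z x + dotv z y.
Proof. by rewrite dotvC dotvDl !(dotvC z). Qed.

Lemma dotvZr a x y : dotv y (a *: x) = a * dotv y x.
Proof. by rewrite dotvC dotvZl (dotvC y). Qed.

Lemma dotvNr x y : dotv y (- x) = - dotv y x.
Proof. by rewrite dotvC dotvNl (dotvC y). Qed.

Definition dotv_lin := (dotvDl, dotvDr, dotvNl, dotvNr, dotvZl, dotvZr).

Lemma dot0v x : dotv 0 x = 0.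
Proof. by rewrite /dotv mul0mx mxE. Qed.

Lemma dotv0 x : dotv x 0 = 0.
Proof. by rewrite dotvC dot0v. Qed.

Lemma dotv_delta x i : dotv (delta_mx 0 i) x = x 0 i.
Proof.
rewrite dotvE (bigD1 i) //= !mxE !eqxx mul1r big1 ?addr0 // => j /negPf ji.
by rewrite !mxE ji andbF mul0r.
Qed.

Lemma dotvv_ge0 x : 0 <= dotv x x.
Proof. by rewrite dotvE sumr_ge0 // => i _; rewrite -expr2 sqr_ge0. Qed.

Lemma dotvv_eq0 x : (dotv x x == 0) = (x == 0).
Proof.
apply/eqP/eqP => [|->]; last exact: dot0v.
rewrite dotvE => /eqP; rewrite psumr_eq0 => [/allP x0|i _]; last first.
  by rewrite -expr2 sqr_ge0.
apply/rowP => i; rewrite !mxE; apply/eqP.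
by have := x0 i (mem_index_enum _); rewrite /= mulf_eq0 orbb.
Qed.

Lemma enorm_sqr x : enorm x ^+ 2 = dotv x x.
Proof. by rewrite sqr_sqrtr // dotvv_ge0. Qed.

Lemma enorm_ge0 x : 0 <= enorm x.
Proof. exact: sqrtr_ge0. Qed.

(** The squared length of [dotv y y *: x - dotv x y *: y] is [dotv y y] times the gap between the
    two sides. *)
Lemma cauchy_schwarz_sqr x y : dotv x y ^+ 2 <= dotv x x * dotv y y.
Proof.
have [->|y0] := eqVneq y 0; first by rewrite !dotv0 mulr0 expr0n.
have yy0 : 0 < dotv y y by rewrite lt_def dotvv_eq0 y0 dotvv_ge0.
have := dotvv_ge0 (dotv y y *: x - dotv x y *: y).
rewrite !dotv_lin (dotvC y x) => H.
rewrite -subr_ge0 -(pmulr_rge0 _ yy0).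
by apply: le_trans H _; rewrite le_eqVlt; apply/orP; left; apply/eqP; ring.
Qed.

Lemma cauchy_schwarz x y : `|dotv x y| <= enorm x * enorm y.
Proof.
rewrite -sqrtrM ?dotvv_ge0 // -sqrtr_sqr ler_wsqrtr //.
exact: cauchy_schwarz_sqr.
Qed.

End Dot.

(** * Comparison of the sup norm with the Euclidean norm *)

Section MatrixNorm.
Context {R : realType}.

Lemma coord_le_norm {m n : nat} (A : 'M[R]_(m, n)) i j : `|A i j| <= `|A|.
Proof.
rewrite [leRHS]/Num.Def.normr/= mx_normrE.
exact: (le_bigmax _ (fun k => `|A k.1 k.2|) (i, j)).
Qed.

Lemma norm_le_coord {m n : nat} (A : 'M[R]_(m, n)) e : 0 <= e ->
  (forall i j, `|A i j| <= e) -> `|A| <= e.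
Proof.
move=> e0 Ae; rewrite [leLHS]/Num.Def.normr/= mx_normrE.
by apply: bigmax_le => // -[i j] _; exact: Ae.
Qed.

Lemma sum_const_ord (n : nat) (a : R) : \sum_(i < n) a = n%:R * a.
Proof. by rewrite sumr_const card_ord mulr_natl. Qed.

Lemma norm_mulmx {m n p : nat} (A : 'M[R]_(m, n)) (B : 'M[R]_(n, p)) :
  `|A *m B| <= n%:R * `|A| * `|B|.
Proof.
apply: norm_le_coord => [|i j]; first by rewrite !mulr_ge0.
rewrite mxE (le_trans (ler_norm_sum _ _ _)) //.
rewrite -mulrA -sum_const_ord ler_sum // => k _.
by rewrite normrM ler_pM // coord_le_norm.
Qed.

Context {n : nat}.
Implicit Types x y : 'rV[R]_n.

Lemma norm_dotv x y : `|dotv x y| <= n%:R * `|x| * `|y|.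
Proof.
rewrite dotvE (le_trans (ler_norm_sum _ _ _)) //.
rewrite -mulrA -sum_const_ord ler_sum // => k _.
by rewrite normrM ler_pM // coord_le_norm.
Qed.

Lemma norm_le_enorm x : `|x| <= enorm x.
Proof.
apply: norm_le_coord => [|i j]; first exact: enorm_ge0.
rewrite -sqrtr_sqr ler_wsqrtr // dotvE ord1 expr2 (bigD1 j) //= lerDl.
by apply: sumr_ge0 => k _; rewrite -expr2 sqr_ge0.
Qed.

Lemma enorm_le_norm x : enorm x <= n%:R * `|x|.
Proof.
rewrite -[leRHS]ger0_norm ?mulr_ge0 // -sqrtr_sqr ler_wsqrtr //.
rewrite (le_trans (ler_norm _)) // (le_trans (norm_dotv _ _)) //.
rewrite exprMn expr2 -mulrA -expr2 ler_wpM2r ?sqr_ge0 //.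
by case: n => [|k]; rewrite ?mulr0 // ler_peMr // ler1n.
Qed.

End MatrixNorm.

(** * Limits of matrix-valued functions *)

Section MatrixCvg.
Context {R : realType} {T : Type} {F : set_system T} {FF : Filter F}.

Lemma cvg_mxP {m n : nat} (f : T -> 'M[R]_(m, n)) (A : 'M[R]_(m, n)) :
  (f @ F --> A) <-> forall i j, (f t i j : R^o) @[t --> F] --> (A i j : R^o).
Proof.
split=> [fA i j|fA].
  exact: (continuous_cvg _ (@coord_continuous _ _ _ i j A) fA).
apply/cvgrPdist_le => /= e e0.
have : \forall t \near F, forall ij : 'I_m * 'I_n, `|A ij.1 ij.2 - f t ij.1 ij.2| <= e.
  by apply: filter_forall => ij; move/cvgrPdist_le : (fA ij.1 ij.2); exact.
apply: filterS => t H; apply: norm_le_coord; rewrite ?ltW // => i j.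
by rewrite !mxE; exact: (H (i, j)).
Qed.

Lemma cvg_sumr {I : Type} (s : seq I) (f : I -> T -> R^o) (a : I -> R^o) :
  (forall i, f i @ F --> a i) ->
  \sum_(i <- s) f i t @[t --> F] --> (\sum_(i <- s) a i : R^o).
Proof.
move=> fa; elim: s => [|i s IH].
  by rewrite big_nil; under eq_fun do rewrite big_nil; exact: cvg_cst.
rewrite big_cons; under eq_fun do rewrite big_cons.
exact: cvgD (fa i) IH.
Qed.

Lemma cvg_prodr {I : Type} (s : seq I) (f : I -> T -> R^o) (a : I -> R^o) :
  (forall i, f i @ F --> a i) ->
  \prod_(i <- s) f i t @[t --> F] --> (\prod_(i <- s) a i : R^o).
Proof.
move=> fa; elim: s => [|i s IH].
  by rewrite big_nil; under eq_fun do rewrite big_nil; exact: cvg_cst.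
rewrite big_cons; under eq_fun do rewrite big_cons.
exact: cvgM (fa i) IH.
Qed.

Lemma cvg_mulmx {m n p : nat} (f : T -> 'M[R]_(m, n)) (g : T -> 'M[R]_(n, p))
    (A : 'M[R]_(m, n)) (B : 'M[R]_(n, p)) :
  f @ F --> A -> g @ F --> B -> f t *m g t @[t --> F] --> A *m B.
Proof.
move=> /cvg_mxP fA /cvg_mxP gB; apply/cvg_mxP => i j; rewrite mxE.
under eq_fun do rewrite mxE.
by apply: cvg_sumr => k; apply: cvgM; [exact: fA|exact: gB].
Qed.

Lemma cvg_trmx {m n : nat} (f : T -> 'M[R]_(m, n)) (A : 'M[R]_(m, n)) :
  f @ F --> A -> (f t)^T @[t --> F] --> A^T.
Proof.
move=> /cvg_mxP fA; apply/cvg_mxP => i j; rewrite mxE.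
by under eq_fun do rewrite mxE; exact: fA.
Qed.

Lemma cvg_dotv {n : nat} (f g : T -> 'rV[R]_n) (a b : 'rV[R]_n) :
  f @ F --> a -> g @ F --> b ->
  (dotv (f t) (g t) : R^o) @[t --> F] --> (dotv a b : R^o).
Proof.
by move=> fa gb; exact: ((cvg_mxP _ _).1 (cvg_mulmx fa (cvg_trmx gb)) 0 0).
Qed.

Lemma cvg_det {n : nat} (f : T -> 'M[R]_n) (A : 'M[R]_n) :
  f @ F --> A -> (\det (f t) : R^o) @[t --> F] --> (\det A : R^o).
Proof.
move=> /cvg_mxP fA; rewrite /determinant.
apply: cvg_sumr => s; apply: cvgM; first exact: cvg_cst.
by apply: cvg_prodr => i; exact: fA.
Qed.

Lemma cvg_unitmx {n : nat} (f : T -> 'M[R]_n) (A : 'M[R]_n) :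
  f @ F --> A -> A \in unitmx -> \forall t \near F, f t \in unitmx.
Proof.
move=> /cvg_det fA; rewrite unitmxE unitfE => A0.
have /cvgrPdist_lt /(_ `|\det A|) := fA; rewrite normr_gt0 => /(_ A0).
apply: filterS => t; rewrite unitmxE unitfE => /=.
by apply: contraTneq => ->; rewrite subr0 ltxx.
Qed.

(** Cramer's formula is polynomial in the entries apart from the division by the determinant.
    [invmx] agrees with it on units only, hence the passage through [near_eq_cvg]. *)
Lemma cvg_invmx {n : nat} (f : T -> 'M[R]_n) (A : 'M[R]_n) :
  f @ F --> A -> A \in unitmx -> invmx (f t) @[t --> F] --> invmx A.
Proof.
move=> fA Au.
have fu := cvg_unitmx fA Au.
have H : (\det (f t))^-1 *: \adj (f t) @[t --> F] --> (\det A)^-1 *: \adj A.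
  apply/cvg_mxP => i j; rewrite !mxE; under eq_fun do rewrite !mxE.
  apply: cvgM; first by apply: cvgV; [rewrite -unitfE -unitmxE|exact: cvg_det].
  apply: cvgM; first exact: cvg_cst.
  apply: cvg_det; apply/cvg_mxP => k l; rewrite !mxE.
  by under eq_fun do rewrite !mxE; exact: ((cvg_mxP _ _).1 fA).
rewrite {2}/invmx Au; apply: cvg_trans H.
apply: near_eq_cvg; apply: filterS fu => t tu.
by rewrite /= /invmx tu.
Qed.

End MatrixCvg.

Lemma continuous_mxP {R : realType} {T : topologicalType} {m n : nat}
    (f : T -> 'M[R]_(m, n)) (x : T) :
  {for x, continuous f} <->
  forall i j, (f t i j : R^o) @[t --> x] --> (f x i j : R^o).
Proof. exact: (@cvg_mxP R T (nbhs x) _ m n f (f x)). Qed.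

Lemma continuous_near_eq {T U : topologicalType} (f g : T -> U) (x : T) :
  (\forall y \near x, f y = g y) -> {for x, continuous f} ->
  {for x, continuous g}.
Proof.
move=> fg; rewrite /prop_for /continuous_at (nbhs_singleton fg) => fx.
exact: cvg_trans (near_eq_cvg fg) fx.
Qed.

Lemma near_open_nbhs {T : topologicalType} (P : set T) (x : T) :
  (\forall y \near x, P y) -> exists2 U, open_nbhs x U & U `<=` P.
Proof. by move=> xP; have : nbhs x P := xP; rewrite nbhsE. Qed.

(** * Gradients, Jacobians and second-order expansions *)

Section FrechetEpsilon.
Context {R : realType} {V W : normedModType R}.

(** The estimates below are all made in this epsilon form, with increment [y - x]; this lemma and
    the next translate from and to little-o at 0. *)
Lemma is_diff_near (f df : V -> W) x (e : R) : is_diff x f df -> 0 < e ->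
  \forall y \near x, `|f y - f x - df (y - x)| <= e * `|y - x|.
Proof.
move=> [fd <-] e0; have /diff_locally /eqaddoP /(_ e e0) := fd.
rewrite [\forall x \near _, _ <= _](near_shift x) /= => H; near=> y.
have : ((fun h => `|(f \o shift x - (cst (f x) + 'd f x)) h| <= e * `|h|)
         \o shift (0 - x)) y by near: y.
by rewrite /= sub0r !fctE /= subrK opprD addrA.
Unshelve. all: by end_near. Qed.

Lemma near_is_diff (f : V -> W) (df : {linear V -> W}) x : continuous df ->
  (forall e : R, 0 < e ->
    \forall y \near x, `|f y - f x - df (y - x)| <= e * `|y - x|) ->
  is_diff x f df.
Proof.
move=> dfc H.
have E : f \o shift x = cst (f x) + df +o_ 0 id.
  apply/eqaddoP => e /H.
  rewrite [\forall x \near _, _ <= _](near_shift 0) => He; near=> h.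
  have : ((fun y => `|f y - f x - df (y - x)| <= e * `|y - x|)
          \o shift (x - 0)) h by near: h.
  by rewrite /= subr0 !fctE /= addrK opprD addrA.
have dE := diff_unique dfc E; split=> //.
by apply/diff_locallyP; rewrite dE.
Unshelve. all: by end_near. Qed.

End FrechetEpsilon.

Section Gradient.
Context {R : realType} {n : nat}.
Implicit Types (phi psi : 'rV[R]_n -> R) (x y v g : 'rV[R]_n).

(** Being an instance of [is_diff], it records differentiability together with the value of the
    derivative, so calculus rules chain without naming ['d]. *)
Definition has_grad phi x g : Prop :=
  is_diff x (phi : 'rV[R]_n -> R^o) (fun v => dotv v g : R^o).

Definition has_jac {p : nat} (f : 'rV[R]_n -> 'rV[R]_p) x (A : 'M[R]_(n, p))
    : Prop :=
  is_diff x f (fun v => v *m A).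

Lemma continuous_mulmxr {p : nat} (A : 'M[R]_(n, p)) :
  continuous (fun v : 'rV[R]_n => v *m A).
Proof.
move=> v; apply: (@cvg_mulmx _ _ (nbhs v) _ _ _ _ id (cst A)).
  exact: cvg_id.
exact: cvg_cst.
Qed.

Lemma continuous_dotvr g : continuous (fun v : 'rV[R]_n => dotv v g : R^o).
Proof.
move=> v; apply: (@cvg_dotv _ _ (nbhs v) _ _ id (cst g)).
  exact: cvg_id.
exact: cvg_cst.
Qed.

Lemma has_gradP phi x g : has_grad phi x g <-> forall e, 0 < e ->
  \forall y \near x, `|phi y - phi x - dotv (y - x) g| <= e * `|y - x|.
Proof.
split=> [H e e0|H]; first exact: (is_diff_near H e0).
have glin : linear (fun v => dotv v g : R^o).
  by move=> a u v; rewrite dotvDl dotvZl.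
pose gM := GRing.isLinear.Build _ _ _ _ _ glin.
pose gL : {linear _ -> _} := HB.pack (fun v => dotv v g : R^o) gM.
apply: (@near_is_diff _ _ _ (phi : _ -> R^o) gL) => //.
exact: continuous_dotvr.
Qed.

Lemma has_jacP {p : nat} (f : 'rV[R]_n -> 'rV[R]_p) x A :
  has_jac f x A <-> forall e : R, 0 < e ->
  \forall y \near x, `|f y - f x - (y - x) *m A| <= e * `|y - x|.
Proof.
split=> [H e e0|H]; first exact: (is_diff_near H e0).
by apply: (@near_is_diff _ _ _ f (mulmxr A)) => //; exact: continuous_mulmxr.
Qed.

Lemma dotv_row {p : nat} (A : 'M[R]_(n, p)) v j :
  dotv v (row j A^T) = (v *m A) 0 j.
Proof. by rewrite dotvE mxE; apply: eq_bigr => i _; rewrite !mxE. Qed.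

(** [row j A^T] is column [j] of [A]: Jacobians act on the right of row vectors, so columns are the
    gradients of the coordinates. *)
Lemma has_jac_rowP {p : nat} (f : 'rV[R]_n -> 'rV[R]_p) x A :
  has_jac f x A <-> forall j, has_grad (fun y => f y 0 j) x (row j A^T).
Proof.
have E (a b c : 'rV[R]_p) i j : (a - b - c) i j = a i j - b i j - c i j.
  by rewrite !mxE.
split=> [/has_jacP H j|H].
  apply/has_gradP => e /H; apply: filterS => y; apply: le_trans.
  by rewrite dotv_row -E coord_le_norm.
apply/has_jacP => e e0.
have : \forall y \near x, forall j,
    `|f y 0 j - f x 0 j - dotv (y - x) (row j A^T)| <= e * `|y - x|.
  apply: (@filter_forall _ _ _ (nbhs x) (nbhs_filter x)) => j.
  by have /has_gradP /(_ e e0) := H j.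
apply: filterS => y Hy; apply: norm_le_coord => [|i j].
  by rewrite mulr_ge0 // ltW.
by rewrite ord1 E -dotv_row Hy.
Qed.

Lemma has_grad_eq phi x g g' : has_grad phi x g -> g = g' -> has_grad phi x g'.
Proof. by move=> + <-. Qed.

Lemma has_grad_cst c x : has_grad (fun=> c) x 0.
Proof.
apply/has_gradP => e e0; near=> y.
by rewrite subrr sub0r dotv0 oppr0 normr0 mulr_ge0 // ltW.
Unshelve. all: by end_near. Qed.

Lemma has_grad_dotv g x : has_grad (fun y => dotv y g) x g.
Proof.
apply/has_gradP => e e0; near=> y.
by rewrite !dotv_lin subrr normr0 mulr_ge0 // ltW.
Unshelve. all: by end_near. Qed.

Lemma has_gradD phi psi x g g' : has_grad phi x g -> has_grad psi x g' ->
  has_grad (fun y => phi y + psi y) x (g + g').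
Proof.
move=> H1 H2; rewrite /has_grad.
have := is_diffD H1 H2; congr (is_diff x _ _).
by apply/funext => v; rewrite dotvDr.
Qed.

Lemma has_gradM phi psi x g g' : has_grad phi x g -> has_grad psi x g' ->
  has_grad (fun y => phi y * psi y) x (phi x *: g' + psi x *: g).
Proof.
move=> H1 H2; rewrite /has_grad.
have := is_diffM H1 H2; congr (is_diff x _ _).
by apply/funext => v; rewrite dotvDr !dotvZr.
Qed.

Lemma has_gradZ c phi x g : has_grad phi x g ->
  has_grad (fun y => c * phi y) x (c *: g).
Proof.
move=> H; apply: has_grad_eq (has_gradM (has_grad_cst c x) H) _.
by rewrite scaler0 addr0.
Qed.

Lemma has_grad_coord i x : has_grad (fun y => y 0 i) x (delta_mx 0 i).
Proof.
have := has_grad_dotv (delta_mx 0 i) x.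
by under eq_fun do rewrite dotvC dotv_delta.
Qed.

Lemma has_grad_near_eq phi psi x g : (\forall y \near x, phi y = psi y) ->
  has_grad phi x g -> has_grad psi x g.
Proof.
move=> E /has_gradP H; apply/has_gradP => e /H.
have Ex := nbhs_singleton E.
by apply: filterS2 E => y ->; rewrite Ex.
Qed.

Lemma has_grad_derive phi x g v : has_grad phi x g ->
  'D_v (phi : _ -> R^o) x = dotv v g.
Proof. by move=> [H E]; rewrite deriveE // E. Qed.

Lemma has_jac_derive {p : nat} (f : 'rV[R]_n -> 'rV[R]_p) x A v :
  has_jac f x A -> 'D_v f x = v *m A.
Proof. by move=> [H E]; rewrite deriveE // E. Qed.

Lemma mulmx_inj {m p : nat} (A B : 'M[R]_(m, p)) :
  (forall v : 'rV[R]_m, v *m A = v *m B) -> A = B.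
Proof. by move=> AB; apply/row_matrixP => i; rewrite !rowE. Qed.

Lemma has_jac_jacobian {p : nat} (f : 'rV[R]_n -> 'rV[R]_p) x A :
  has_jac f x A -> 'J f x = A.
Proof.
move=> [H E]; apply: mulmx_inj => v.
by rewrite -deriveEjacobian // deriveE // E.
Qed.

Lemma differentiable_has_jac {p : nat} (f : 'rV[R]_n -> 'rV[R]_p) x :
  differentiable f x -> has_jac f x ('J f x).
Proof.
move=> H; split=> //; apply/funext => v.
by rewrite -deriveEjacobian // deriveE.
Qed.

Definition gradient (phi : 'rV[R]_n -> R^o) x : 'rV[R]_n :=
  \row_i 'D_(delta_mx 0 i) phi x.

Lemma differentiable_has_grad (phi : 'rV[R]_n -> R^o) x :
  differentiable phi x -> has_grad phi x (gradient phi x).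
Proof.
move=> H; split=> //; apply/funext => v.
rewrite [in LHS](row_sum_delta v) linear_sum dotvE; apply: eq_bigr => i _.
by rewrite linearZ /= mxE deriveE.
Qed.

Lemma has_grad_unique phi x g g' : has_grad phi x g -> has_grad phi x g' ->
  g = g'.
Proof.
move=> H H'; apply/rowP => i; rewrite -!dotv_delta.
by rewrite -(has_grad_derive _ H) -(has_grad_derive _ H').
Qed.

Lemma has_grad_continuous phi x g : has_grad phi x g ->
  {for x, continuous (phi : 'rV[R]_n -> R^o)}.
Proof. by move=> [H _]; exact: differentiable_continuous. Qed.

Lemma has_jac_continuous {p : nat} (f : 'rV[R]_n -> 'rV[R]_p) x A :
  has_jac f x A -> {for x, continuous f}.
Proof. by move=> [H _]; exact: differentiable_continuous. Qed.

Lemma has_grad_line phi x v (t : R) g : has_grad phi (x + t *: v) g ->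
  is_derive t 1 (fun s => phi (x + s *: v) : R^o) (dotv v g).
Proof.
move=> H.
have L : is_diff t (fun s : R => x + s *: v) (fun s => s *: v).
  by have := is_diffD (is_diff_cst x t) (is_diff_scalel t v); rewrite add0r.
have D := @is_diff_comp _ _ _ _ _ _ _ _ _ L H.
have Dd := @ex_diff _ _ _ _ _ _ _ D.
apply: DeriveDef; first exact: diff_derivable.
by rewrite deriveE // (@diff_val _ _ _ _ _ _ _ D) /= scale1r.
Qed.

End Gradient.

Section GradientComp.
Context {R : realType} {n p : nat}.

Lemma has_jac_mulmxr (B : 'M[R]_(n, p)) x : has_jac (fun v => v *m B) x B.
Proof.
apply/has_jacP => e e0; near=> y.
by rewrite mulmxBl subrr normr0 mulr_ge0 // ltW.
Unshelve. all: by end_near. Qed.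

Lemma has_grad_comp (phi : 'rV[R]_p -> R) (f : 'rV[R]_n -> 'rV[R]_p) x A g :
  has_jac f x A -> has_grad phi (f x) g ->
  has_grad (fun z => phi (f z)) x (g *m A^T).
Proof.
move=> L H; have := @is_diff_comp _ _ _ _ _ _ _ _ _ L H.
rewrite /has_grad; congr (is_diff x _ _); apply/funext => v /=.
by rewrite /dotv trmx_mul trmxK mulmxA.
Qed.

End GradientComp.

(** * Maps of class C^1 and C^2 with explicit derivatives *)

Section C2.
Context {R : realType} {n : nat}.
Implicit Types (x y v : 'rV[R]_n).

(** Working form of [Ck_on]: derivatives are given functions instead of iterated ['D_v]. They are
    asked for at every point near [x], so the property passes to nearby points such as the values of
    the proximal map. *)
Definition C1_near {p : nat} (f : 'rV[R]_n -> 'rV[R]_p)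
    (A : 'rV[R]_n -> 'M[R]_(n, p)) x : Prop :=
  \forall y \near x, has_jac f y (A y) /\ {for y, continuous A}.

Definition C2_near (phi : 'rV[R]_n -> R) (g : 'rV[R]_n -> 'rV[R]_n)
    (h : 'rV[R]_n -> 'M[R]_n) x : Prop :=
  \forall y \near x,
    [/\ has_grad phi y (g y), has_jac g y (h y) & {for y, continuous h}].

Definition hessian_fun (phi : 'rV[R]_n -> R^o) y : 'M[R]_n :=
  \matrix_(i, k) 'D_(delta_mx 0 i) ('D_(delta_mx 0 k) phi) y.

Lemma Ck_on2_C2_near (phi : 'rV[R]_n -> R^o) U x :
  open_nbhs x U -> Ck_on 2 U phi ->
  C2_near phi (gradient phi) (hessian_fun phi) x.
Proof.
move=> Ux [D1 D2]; apply: filterS (open_nbhs_nbhs Ux) => y Uy; split.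
- by apply: differentiable_has_grad; exact: D1.
- apply/has_jac_rowP => k.
  under eq_fun do rewrite mxE.
  apply: has_grad_eq (differentiable_has_grad ((D2 _).1 _ Uy)) _.
  by apply/rowP => i; rewrite !mxE.
- apply: (continuous_mxP (hessian_fun phi) y).2 => i k.
  have E : (fun t => hessian_fun phi t i k) =
      'D_(delta_mx 0 i) ('D_(delta_mx 0 k) phi).
    by apply/funext => t; rewrite mxE.
  have := (D2 (delta_mx 0 k)).2 (delta_mx 0 i) _ Uy.
  by rewrite -E.
Qed.

Lemma Ck_on_coord {p : nat} k (G : 'rV[R]_n -> 'rV[R]_p) j :
  Ck_on k setT G -> Ck_on k setT (fun y => G y 0 j : R^o).
Proof.
elim: k G => [|k IH] G /=.
  move=> H x _.
  exact: ((continuous_mxP G x).1 (H x I) 0 j).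
move=> [D1 D2]; have Gj y : has_grad (fun z => G z 0 j) y (row j ('J G y)^T).
  by have /has_jac_rowP /(_ j) := differentiable_has_jac (D1 y I).
split=> [x _|v]; first by have [] := Gj x.
have -> : 'D_v (fun y => G y 0 j : R^o) = fun y => 'D_v G y 0 j.
  apply/funext => y; rewrite (has_grad_derive _ (Gj y)) dotv_row.
  by rewrite -deriveEjacobian //; exact: D1.
exact: IH.
Qed.

Lemma Ck_on1_C1_near {p : nat} (G : 'rV[R]_n -> 'rV[R]_p) U x :
  open_nbhs x U -> Ck_on 1 U G -> C1_near G (jacobian G) x.
Proof.
move=> Ux [D1 D2]; apply: filterS (open_nbhs_nbhs Ux) => y Uy; split.
  exact/differentiable_has_jac/D1.
have E i j z : U z -> 'J G z i j = 'D_(delta_mx 0 i) G z 0 j.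
  move=> Uz; rewrite (deriveEjacobian _ (D1 _ Uz)).
  by rewrite -dotv_row dotv_delta !mxE.
apply: (continuous_mxP (jacobian G) y).2 => i j.
have := (continuous_mxP ('D_(delta_mx 0 i) G) y).1 (D2 (delta_mx 0 i) _ Uy) 0 j.
apply: (@continuous_near_eq _ _ (fun z => 'D_(delta_mx 0 i) G z 0 j)
  (fun z => 'J G z i j)).
have [Uo _] := Ux.
by apply: filterS (open_nbhs_nbhs (conj Uo Uy)) => z /E ->.
Qed.

Lemma Ck_on_le {W : normedModType R} k U (F : 'rV[R]_n -> W) :
  Ck_on k.+1 U F -> Ck_on k U F.
Proof.
elim: k F => [|k IH] F [D1 D2].
  by move=> x Ux; apply: differentiable_continuous; exact: D1.
by split=> // v; exact: IH.
Qed.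

Lemma C1_near_smooth {p : nat} (f : 'rV[R]_n -> 'rV[R]_p) A x :
  C1_near f A x -> smooth_around 1 f x.
Proof.
move=> /near_open_nbhs[U [Uo Ux] UP].
exists U => //; split=> [y /UP[[]]//|v y Uy].
have [HJ HA] := UP _ Uy.
have E z : U z -> v *m A z = 'D_v f z.
  by move=> /UP[HJz _]; rewrite (has_jac_derive _ HJz).
have C : {for y, continuous (fun z => v *m A z)}.
  by apply: (@cvg_mulmx _ _ (nbhs y) _ _ _ _ (cst v)) => //; exact: cvg_cst.
apply: continuous_near_eq C.
by apply: filterS (open_nbhs_nbhs (conj Uo Uy)) => z /E.
Qed.

Lemma has_grad_dotv_jac (g : 'rV[R]_n -> 'rV[R]_n) y A v :
  has_jac g y A -> has_grad (fun z => dotv v (g z)) y (v *m A^T).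
Proof.
move=> gA; apply: has_grad_comp gA _.
by have := has_grad_dotv v (g y); under eq_fun do rewrite dotvC.
Qed.

Lemma C2_near_smooth (phi : 'rV[R]_n -> R^o) g h x :
  C2_near phi g h x -> smooth_around 2 phi x.
Proof.
move=> /near_open_nbhs[U [Uo Ux] UP].
have E v z : U z -> dotv v (g z) = 'D_v phi z.
  by move=> /UP[Hz _]; rewrite (has_grad_derive _ Hz).
have N y : U y -> \forall z \near y, U z.
  by move=> Uy; exact: (open_nbhs_nbhs (conj Uo Uy)).
have G v y : U y -> has_grad ('D_v phi) y (v *m (h y)^T).
  move=> Uy; have [_ Hj _] := UP _ Uy.
  apply: has_grad_near_eq (has_grad_dotv_jac v Hj).
  by apply: filterS (N y Uy) => z /E.
exists U => //; split=> [y /UP[[]]//|v]; split=> [y /(G v)[]//|w y Uy].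
have E2 z : U z -> dotv w (v *m (h z)^T) = 'D_w ('D_v phi) z.
  by move=> /(G v) Hz; rewrite (has_grad_derive _ Hz).
have [_ _ hc] := UP _ Uy.
have C : {for y, continuous (fun z => dotv w (v *m (h z)^T) : R^o)}.
  apply: (@cvg_dotv _ _ (nbhs y) _ _ (cst w)); first exact: cvg_cst.
  apply: (@cvg_mulmx _ _ (nbhs y) _ _ _ _ (cst v)); first exact: cvg_cst.
  exact: cvg_trmx.
apply: continuous_near_eq C.
by apply: filterS (N y Uy) => z /E2.
Qed.

Lemma C2_near_hessian (phi : 'rV[R]_n -> R) g h x :
  C2_near phi g h x -> hessian phi x = h x.
Proof.
move=> H; apply/matrixP => i j; rewrite mxE.
have [_ Hj _] := nbhs_singleton H.
have Hg : has_grad ('D_(delta_mx 0 j) (phi : _ -> R^o)) x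
    (delta_mx 0 j *m (h x)^T).
  apply: has_grad_near_eq (has_grad_dotv_jac (delta_mx 0 j) Hj).
  by apply: filterS H => z [Hz _ _]; rewrite (has_grad_derive _ Hz).
by rewrite (has_grad_derive _ Hg) dotv_delta -rowE !mxE.
Qed.

End C2.

(** * Second-order expansions and symmetry of the Hessian *)

Section Taylor.
Context {R : realType} {n : nat}.
Implicit Types (x y u v : 'rV[R]_n).

Lemma mvt01 (psi dpsi : R -> R) :
  (forall s : R, 0 <= s <= 1 -> is_derive s 1 psi (dpsi s)) ->
  exists2 c, 0 <= c <= 1 & psi 1 - psi 0 = dpsi c.
Proof.
move=> H.
have [|s||c c01 ->] := @MVT_segment R psi dpsi 0 1.
- exact: ler01.
- by rewrite in_itv /= => /andP[s0 s1]; apply: H; rewrite !ltW.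
- apply: derivable_within_continuous => s; rewrite in_itv /= => s01.
  by have [] := H s s01.
- by exists c; rewrite ?subr0 ?mulr1 //; move: c01; rewrite in_itv.
Qed.

Lemma near_ball_norm (P : set 'rV[R]_n) x : (\forall y \near x, P y) ->
  exists2 r : R, 0 < r & forall y, `|y - x| < r -> P y.
Proof.
move=> /nbhs_ballP[r r0 rP]; exists r => // y yx; apply: rP.
by rewrite -ball_normE /= distrC.
Qed.

Lemma ball_norm_near (P : set 'rV[R]_n) x r : 0 < r ->
  (forall y, `|y - x| < r -> P y) -> \forall y \near x, P y.
Proof.
move=> r0 H; apply/nbhs_ballP; exists r => // y.
by rewrite -ball_normE /= distrC => /H.
Qed.

Lemma is_derive_quad (a b s : R) :
  is_derive s 1 (fun t => t * a + 2^-1 * (t * t) * b : R^o) (a + s * b).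
Proof.
have Ha := is_deriveM (is_derive_id s 1) (is_derive_cst a s 1).
have Hs := is_deriveM (is_derive_id s 1) (is_derive_id s 1).
have Hb := is_deriveM (is_deriveM (is_derive_cst (2^-1 : R^o) s 1) Hs)
  (is_derive_cst b s 1).
apply: is_derive_eq (is_deriveD Ha Hb) _.
by rewrite /GRing.scale /=; field.
Qed.

(** The mean value theorem is applied on the segment to [phi] minus its quadratic model. The
    derivative of this difference at [c] is [v] paired with the linearisation error of [g] at
    [x + c v], which differentiability of [g] at [x] controls. *)
Lemma taylor2 (phi : 'rV[R]_n -> R) g x Q :
  (\forall y \near x, has_grad phi y (g y)) -> has_jac g x Q ->
  forall e, 0 < e -> \forall y \near x,
    `|phi y - phi x - dotv (y - x) (g x) - 2^-1 * dotv ((y - x) *m Q) (y - x)|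
      <= e * `|y - x| ^+ 2.
Proof.
move=> Hg /has_jacP HQ e e0.
(* Absorbs the factor [n] of [norm_dotv]; the successor keeps the division legal when [n = 0]. *)
have e'0 : 0 < e / n.+1%:R by rewrite divr_gt0.
have [r r0 Hr] := near_ball_norm (filterI Hg (HQ _ e'0)).
apply: (ball_norm_near r0) => y yr; set v := y - x in yr *.
have vE : v + x = y by rewrite /v subrK.
clearbody v.
pose psi s := phi (x + s *: v) - (s * dotv v (g x) + 2^-1 * (s * s) * dotv (v *m Q) v).
pose dpsi s := dotv v (g (x + s *: v)) - (dotv v (g x) + s * dotv (v *m Q) v).
have small s : 0 <= s <= 1 -> `|(x + s *: v) - x| < r.
  move=> /andP[s0 s1]; rewrite addrC addKr normrZ ger0_norm //.
  by apply: le_lt_trans yr; rewrite ler_piMl.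
have [s s01|c c01] := @mvt01 psi dpsi.
  have D := has_grad_line (Hr _ (small s s01)).1.
  exact: is_deriveB D (is_derive_quad _ _ s).
rewrite /psi /dpsi scale1r scale0r addr0.
rewrite !(mul0r, mulr0, addr0, mulr1, subr0, mul1r) [x + v]addrC vE => E.
have -> : phi y - phi x - dotv v (g x) - 2^-1 * dotv (v *m Q) v
   = dotv v (g (x + c *: v) - g x - (c *: v) *m Q).
  rewrite !dotv_lin -scalemxAl dotvZr (dotvC v (v *m Q)).
  move: E; lra.
have := (Hr _ (small c c01)).2; rewrite [x + _]addrC addrK => H.
rewrite (le_trans (norm_dotv _ _)) //.
have {}H : `|g (c *: v + x) - g x - c *: v *m Q| <= e / n.+1%:R * `|v|.
  apply: le_trans H _; rewrite ler_wpM2l ?(ltW e'0) ?(ltW s0) // normrZ.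
  case/andP: c01 => c0 c1.
  by rewrite ger0_norm // ler_piMl.
apply: (@le_trans _ _ (n%:R * `|v| * (e / n.+1%:R * `|v|))).
  by rewrite ler_wpM2l // mulr_ge0.
have -> : n%:R * `|v| * (e / n.+1%:R * `|v|) = e * `|v| ^+ 2 * (n%:R / n.+1%:R).
  by ring.
rewrite ler_piMr ?mulr_ge0 ?sqr_ge0 ?(ltW e0) //.
by rewrite ler_pdivrMr // mul1r ler_nat.
Qed.

(** The second difference is the increment over [0, 1] of [psi t = phi (x + t s u + s v) - phi (x +
    t s u)]. The mean value theorem turns it into a difference of two values of [g], each compared
    with the linearisation of [g] at [x]. *)
Lemma young_near (phi : 'rV[R]_n -> R) g x Q u v :
  (\forall y \near x, has_grad phi y (g y)) -> has_jac g x Q ->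
  forall e, 0 < e -> exists2 r, 0 < r & forall s, 0 < s < r ->
    `|phi (x + s *: u + s *: v) - phi (x + s *: u) - phi (x + s *: v) + phi x
       - s ^+ 2 * dotv (v *m Q) u| <= e * s ^+ 2.
Proof.
move=> Hg /has_jacP HQ e e0.
(* The points where [g] is evaluated lie within [s (|u| + |v|)] and [s |u|] of [x]; the sum of these
   distances gives the second factor, and [n |u|] comes from pairing with [u]. *)
pose C := n%:R * `|u| * (2 * `|u| + `|v|) + 1.
have C0 : 0 < C by rewrite ltr_pwDr // !mulr_ge0 // addr_ge0 // mulr_ge0.
have e'0 : 0 < e / C by rewrite divr_gt0.
have [r r0 Hr] := near_ball_norm (filterI Hg (HQ _ e'0)).
have N0 : 0 < `|u| + `|v| + 1 by rewrite ltr_pwDr // addr_ge0.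
exists (r / (`|u| + `|v| + 1)) => [|s /andP[s0 sr]]; first by rewrite divr_gt0.
have bnd (t b : R) : 0 <= t <= 1 -> 0 <= b <= 1 ->
    `|(t * s) *: u + (b * s) *: v| <= s * (t * `|u| + b * `|v|).
  move=> /andP[t0 t1] /andP[b0 b1].
  rewrite (le_trans (ler_normD _ _)) // !normrZ !ger0_norm ?mulr_ge0 ?(ltW s0) //.
  by rewrite le_eqVlt; apply/orP; left; apply/eqP; ring.
have small (t b : R) : 0 <= t <= 1 -> 0 <= b <= 1 ->
    `|(x + ((t * s) *: u + (b * s) *: v)) - x| < r.
  move=> t01 b01; rewrite addrC addKr; apply: le_lt_trans (bnd _ _ t01 b01) _.
  move: sr; rewrite ltr_pdivlMr //; apply: le_lt_trans.
  rewrite ler_wpM2l ?(ltW e'0) ?(ltW s0) // ler_wpDr // lerD //.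
    by case/andP: t01 => ? ?; rewrite ler_piMl.
  by case/andP: b01 => ? ?; rewrite ler_piMl.
(* The coefficients [1 * s] and [0 * s] are left unreduced so that [p] and [q] are both instances of
   [small] and [bnd]. *)
pose p t := x + ((t * s) *: u + (1 * s) *: v).
pose q t := x + ((t * s) *: u + (0 * s) *: v).
pose psi t := phi (p t) - phi (q t).
pose dpsi t := dotv (s *: u) (g (p t)) - dotv (s *: u) (g (q t)).
have i0 : 0 <= (0 : R) <= 1 by rewrite lexx ler01.
have i1 : 0 <= (1 : R) <= 1 by rewrite lexx ler01.
have [t t01|c c01] := @mvt01 psi dpsi.
  have pE t' : p t' = (x + s *: v) + t' *: (s *: u).
    by rewrite /p mul1r scalerA addrA addrAC.
  have qE t' : q t' = x + t' *: (s *: u).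
    by rewrite /q mul0r scale0r addr0 scalerA.
  have D1 := (Hr _ (small t 1 t01 i1)).1.
  have D2 := (Hr _ (small t 0 t01 i0)).1.
  rewrite -/(p t) pE in D1; rewrite -/(q t) qE in D2.
  have := is_deriveB (has_grad_line D1) (has_grad_line D2).
  rewrite -pE -qE.
  by congr (is_derive t 1 _ _); apply/funext => t'; rewrite /psi pE qE.
have H1 := (Hr _ (small c 1 c01 i1)).2.
have H2 := (Hr _ (small c 0 c01 i0)).2.
rewrite -/(p c) in H1; rewrite -/(q c) in H2.
have p1 : p 1 = x + s *: u + s *: v by rewrite /p !mul1r addrA.
have p0 : p 0 = x + s *: v by rewrite /p mul0r mul1r scale0r add0r.
have q1 : q 1 = x + s *: u by rewrite /q mul0r mul1r scale0r addr0.
have q0 : q 0 = x by rewrite /q !mul0r !scale0r !addr0.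
rewrite /psi /dpsi p1 p0 q1 q0 => E.
set a := g (p c) - g x - (p c - x) *m Q in H1.
set b := g (q c) - g x - (q c - x) *m Q in H2.
have -> : phi (x + s *: u + s *: v) - phi (x + s *: u) - phi (x + s *: v)
    + phi x - s ^+ 2 * dotv (v *m Q) u = s * dotv u (a - b).
  have -> : a - b = g (p c) - g (q c) - s *: (v *m Q).
    have E2 : s *: (v *m Q) = (p c - x) *m Q - (q c - x) *m Q.
      rewrite -mulmxBl scalemxAl; congr (_ *m Q).
      rewrite opprB addrA subrK /p /q mul1r mul0r scale0r addr0 addrA.
      by rewrite [RHS]addrC addKr.
    rewrite /a /b E2; move: (_ *m Q) (_ *m Q) => A B.
    by apply/rowP => i; rewrite !mxE; ring.
  rewrite !dotv_lin (dotvC u (v *m Q)).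
  move: E; rewrite !dotv_lin; lra.
have Hp : `|p c - x| <= s * (`|u| + `|v|).
  rewrite /p addrC addKr; apply: le_trans (bnd _ _ c01 i1) _.
  case/andP: c01 => c0 c1.
  by rewrite ler_wpM2l ?(ltW e'0) ?(ltW s0) // mul1r lerD // ler_piMl.
have Hq : `|q c - x| <= s * `|u|.
  rewrite /q addrC addKr; apply: le_trans (bnd _ _ c01 i0) _.
  case/andP: c01 => c0 c1.
  by rewrite ler_wpM2l ?(ltW e'0) ?(ltW s0) // mul0r addr0 ler_piMl.
rewrite normrM (gtr0_norm s0).
have Hab : `|a - b| <= e / C * (s * (2 * `|u| + `|v|)).
  rewrite (le_trans (ler_normB _ _)) //.
  have -> : s * (2 * `|u| + `|v|) = s * (`|u| + `|v|) + s * `|u| by ring.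
  rewrite mulrDr lerD //.
    by apply: le_trans H1 _; rewrite ler_wpM2l ?(ltW e'0).
  by apply: le_trans H2 _; rewrite ler_wpM2l ?(ltW e'0).
apply: (@le_trans _ _ (s * (n%:R * `|u| * (e / C * (s * (2 * `|u| + `|v|)))))).
  rewrite ler_wpM2l ?(ltW e'0) ?(ltW s0) // (le_trans (norm_dotv _ _)) //.
  by rewrite ler_wpM2l // mulr_ge0.
have -> : s * (n%:R * `|u| * (e / C * (s * (2 * `|u| + `|v|))))
   = e * s ^+ 2 * ((n%:R * `|u| * (2 * `|u| + `|v|)) / C) by ring.
apply: ler_piMr; first by rewrite mulr_ge0 ?sqr_ge0 ?(ltW e0).
rewrite ler_pdivrMr // mul1r.
by rewrite /C lerDl.
Qed.

(* Schwarz's theorem under Frechet differentiability of the gradient at the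
   single point x: the second difference along s u and s v is symmetric in u
   and v. *)
Lemma hessian_sym (phi : 'rV[R]_n -> R) g x Q :
  (\forall y \near x, has_grad phi y (g y)) -> has_jac g x Q -> Q^T = Q.
Proof.
move=> Hg HQ.
suff S u v : dotv (v *m Q) u = dotv (u *m Q) v.
  apply/matrixP => i j; have := S (delta_mx 0 i) (delta_mx 0 j).
  by rewrite dotvC dotv_delta dotvC dotv_delta -!rowE !mxE.
apply/eqP; rewrite -subr_eq0 -normr_le0; apply/ler_addgt0Pr => e e0.
rewrite add0r.
have e2 : 0 < e / 2 by rewrite divr_gt0.
have [r1 r10 H1] := young_near u v Hg HQ e2.
have [r2 r20 H2] := young_near v u Hg HQ e2.
pose s := Num.min r1 r2 / 2.
have m0 : 0 < Num.min r1 r2 by rewrite lt_min r10.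
have s0 : 0 < s by rewrite divr_gt0.
have sm : s < Num.min r1 r2 by rewrite ltr_pdivrMr // ltr_pMr // ltr1n.
have s1 : 0 < s < r1 by rewrite s0 (lt_le_trans sm) // ge_min lexx.
have s2 : 0 < s < r2 by rewrite s0 (lt_le_trans sm) // ge_min lexx orbT.
have {}H1 := H1 s s1; have {}H2 := H2 s s2.
rewrite [x + s *: v + s *: u]addrAC in H2.
have sq : 0 < s ^+ 2 by rewrite exprn_gt0.
rewrite -(ler_pM2l sq) -[X in X * `|_|](ger0_norm (ltW sq)) -normrM.
move: H1 H2; rewrite !ler_norml => /andP[a1 a2] /andP[b1 b2].
by apply/andP; split; move: a1 a2 b1 b2; rewrite mulrBr; lra.
Qed.

End Taylor.

(** * Metric regularity and curves in a level set *)

Section MetricRegularity.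
Context {R : realType} {n m : nat}.
Implicit Types (x y z u : 'rV[R]_n) (G : 'rV[R]_n -> 'rV[R]_m)
  (J : 'rV[R]_n -> 'M[R]_(n, m)) (M : set 'rV[R]_n).

Lemma compact_norm_ball x (r : R) : compact [set y | `|y - x| <= r].
Proof.
apply: bounded_closed_compact.
  exists (`|x| + r); split; first exact: num_real.
  move=> s rs y /= yr; apply: ltW; apply: le_lt_trans rs.
  by rewrite -[y](subrK x) addrC (le_trans (ler_normD _ _)) // lerD2l.
apply: (@closed_comp _ _ (fun y => `|y - x|) [set s | s <= r]).
  move=> y _; apply: (@cvg_norm _ _ _ (nbhs y)).
  by apply: (@cvgB _ _ _ (nbhs y)); [exact: cvg_id|exact: cvg_cst].
exact: closed_le.
Qed.

Lemma small_scale (a k : R) : 0 <= a -> 0 < k ->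
  exists2 t, 0 < t <= 1 & t * a < k.
Proof.
move=> a0 k0; have a1 : 0 < a + 1 by rewrite ltr_wpDl.
exists (Num.min 1 (k / (a + 1))).
  by rewrite lt_min ltr01 divr_gt0 //= ge_min lexx.
apply: (@le_lt_trans _ _ (k / (a + 1) * a)).
  by rewrite ler_wpM2r // ge_min lexx orbT.
by rewrite mulrAC ltr_pdivrMr // ltr_pM2l // ltrDl.
Qed.

(* Instead of a Newton iteration, minimise [|G y| + c |y - z|] over a compact
   ball: where G does not vanish, moving along the right inverse B of the
   Jacobian would decrease this function. *)
Lemma metric_regularity G J M x (B : 'M[R]_(m, n)) :
  C1_near G J x -> B *m J x = 1%:M -> M x ->
  (\forall z \near x, M z <-> G z = 0) ->
  exists2 C, 0 < C & \forall z \near x,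
    exists2 z', M z' & `|z' - z| <= C * `|G z|.
Proof.
move=> GJ BJ Mx MG.
pose b := m%:R * `|B| + 1; have b0 : 0 < b by rewrite ltr_wpDl // mulr_ge0.
have pB p : `|p *m B| <= b * `|p|.
  rewrite (le_trans (norm_mulmx _ _)) // mulrAC ler_wpM2r //.
  by rewrite lerDl.
(* A step [- t p B] from the minimiser, with [p] the value of [G] there, gains [t |p|] to first
   order. Variation of the Jacobian, linearisation error and the distance penalty each lose at most
   [t |p| / 4], so a net decrease of [t |p| / 4] remains. *)
pose c := (4 * b)^-1; have c0 : 0 < c by rewrite invr_gt0 mulr_gt0.
have cb : c * b = 4^-1 by rewrite /c; field; rewrite lt0r_neq0.
have BJc : \forall y \near x, `|1%:M - B *m J y| <= (4 * m.+1%:R)^-1.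
  have [_ Jc] := nbhs_singleton GJ.
  have : B *m J y @[y --> x] --> (1%:M : 'M[R]_m).
    rewrite -BJ; apply: (@cvg_mulmx _ _ (nbhs x) _ _ _ _ (cst B)) => //.
    exact: cvg_cst.
  by move/cvgrPdist_le; apply; rewrite invr_gt0 mulr_gt0.
have [r r0 Hr] := near_ball_norm (filterI (filterI GJ MG) BJc).
have Gx : G x = 0.
  by apply/(Hr x _).1.2; rewrite // subrr normr0.
exists c^-1; first by rewrite invr_gt0.
(* The minimiser [zs] satisfies [c |zs - z| <= |G z| < c r / 4]. With [|z - x| < r / 4] this puts it
   strictly inside the ball [K] of radius [r / 2], which leaves room for the decreasing step. *)
have r4 : 0 < r / 4 by rewrite divr_gt0.
have Gc : \forall z \near x, `|G z| < c * (r / 4).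
  have Gxc := has_jac_continuous (nbhs_singleton GJ).1.
  have /cvgrPdist_lt /(_ (c * (r / 4))) : G z @[z --> x] --> (0 : 'rV[R]_m).
    by rewrite -Gx.
  rewrite mulr_gt0 // => /(_ isT); apply: filterS => z.
  by rewrite sub0r normrN.
have [r' r'0 Hr'] := near_ball_norm Gc.
apply: (@ball_norm_near _ _ _ _ (Num.min r' (r / 4))); rewrite ?lt_min ?r'0 //.
move=> z; rewrite lt_min => /andP[/Hr' zr' zr]; pose K := [set y | `|y - x| <= r / 2].
have Kr y : K y -> `|y - x| < r.
  move=> /= /le_lt_trans; apply.
  by rewrite ltr_pdivrMr // ltr_pMr // ltr1n.
pose phi y := `|G y| + c * `|y - z|.
have Kz : K z.
  by rewrite /K /= (le_trans (ltW zr)) // ler_wpM2l ?(ltW r0) // lef_pV2 ?posrE // ler_nat.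
have [|||zs] := @EVT_min_rV R n phi K; first by exists z.
- exact: compact_norm_ball.
- apply: continuous_in_subspaceT => y /set_mem /Kr /Hr[[[Hj _] _] _].
  have Gy := has_jac_continuous Hj.
  apply: (@cvgD _ _ _ (nbhs y)); first exact: (@cvg_norm _ _ _ (nbhs y)).
  apply: (@cvgM _ _ (nbhs y)); first exact: cvg_cst.
  apply: (@cvg_norm _ _ _ (nbhs y)); apply: (@cvgB _ _ _ (nbhs y)).
    exact: cvg_id.
  exact: cvg_cst.
move=> /set_mem Kzs zmin.
have zsG : `|G zs| + c * `|zs - z| <= `|G z|.
  by have := zmin z (mem_set Kz); rewrite /phi subrr normr0 mulr0 addr0.
have zsz : c * `|zs - z| <= `|G z|.
  by apply: le_trans zsG; rewrite lerDr.
have zsx : `|zs - x| < r / 2.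
  have -> : r / 2 = r / 4 + r / 4 by field.
  rewrite -[zs](subrK z) -addrA (le_lt_trans (ler_normD _ _)) // ltrD //.
  by rewrite -(ltr_pM2l c0) (le_lt_trans zsz).
have [[[Hj _] MGz] Bz] := Hr _ (Kr _ Kzs).
have [Gzs|Gzs] := eqVneq (G zs) 0.
  by exists zs; [exact/MGz|rewrite ler_pdivlMl].
exfalso.
set p := G zs in Gzs zsG.
have p0 : 0 < `|p| by rewrite normr_gt0.
have := (has_jacP _ _ _).1 Hj c c0 => /near_ball_norm[d d0 Hd].
have k0 : 0 < Num.min d (r / 2 - `|zs - x|) by rewrite lt_min d0 subr_gt0.
have [|t /andP[t0 t1]] := @small_scale (b * `|p|) _ _ k0.
  by rewrite mulr_ge0 ?(ltW b0).
rewrite lt_min => /andP[td tr].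
pose y := zs - t *: (p *m B).
have yzs : `|y - zs| <= t * (b * `|p|).
  rewrite /y addrC addKr normrN normrZ gtr0_norm //.
  by rewrite ler_wpM2l ?(ltW t0) ?pB.
have Ky : K y.
  rewrite /K /= -[y](subrK zs) -addrA (le_trans (ler_normD _ _)) //.
  by rewrite -lerBrDr (le_trans yzs) // ltW.
have Gy : `|G y| <= (1 - t) * `|p| + t * (`|p| / 4) + c * (t * (b * `|p|)).
  have -> : G y = ((1 - t) *: p + t *: (p *m (1%:M - B *m J zs)))
      + (G y - p - (y - zs) *m J zs).
    have -> : (y - zs) *m J zs = - (t *: (p *m (B *m J zs))).
      by rewrite /y addrC addKr mulNmx -scalemxAl mulmxA.
    rewrite mulmxBr mulmx1; move: (p *m (B *m J zs)) => q.
    by apply/rowP => i; rewrite !mxE; ring.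
  rewrite (le_trans (ler_normD _ _)) // lerD //.
    rewrite (le_trans (ler_normD _ _)) // !normrZ ger0_norm ?subr_ge0 //.
    rewrite lerD2l gtr0_norm // ler_wpM2l ?(ltW t0) //.
    rewrite (le_trans (norm_mulmx _ _)) // mulrAC mulrC ler_wpM2l //.
    apply: (@le_trans _ _ (m%:R * (4 * m.+1%:R)^-1)); first by rewrite ler_wpM2l.
    by rewrite invfM mulrCA ler_piMr // ler_pdivrMr // mul1r ler_nat.
  apply: le_trans (Hd _ (le_lt_trans yzs td)) _.
  by rewrite ler_wpM2l ?(ltW c0).
have := zmin y (mem_set Ky); rewrite leNgt => /negP; apply.
have yz : `|y - z| <= t * (b * `|p|) + `|zs - z|.
  rewrite -[y](subrK zs) -addrA (le_trans (ler_normD _ _)) //.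
  by rewrite lerD2r.
have : phi y <= (1 - t) * `|p| + t * (`|p| / 4) + c * (t * (b * `|p|)) +
   c * (t * (b * `|p|) + `|zs - z|).
  by rewrite /phi lerD // ler_wpM2l ?(ltW c0).
have -> : c * (t * (b * `|p|)) = t * `|p| / 4.
  by rewrite -[in RHS]mulrA -[_ / 4]mulrC -cb; ring.
have tp : 0 < t * `|p| by rewrite mulr_gt0.
rewrite mulrDr; have -> : c * (t * (b * `|p|)) = t * `|p| / 4.
  by rewrite -[in RHS]mulrA -[_ / 4]mulrC -cb; ring.
by rewrite /phi -/p; lra.
Qed.

End MetricRegularity.

Section Curves.
Context {R : realType} {n m : nat}.
Implicit Types (x y z u w : 'rV[R]_n) (G : 'rV[R]_n -> 'rV[R]_m)
  (M : set 'rV[R]_n).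

(** When [u] is in the kernel, [G (x + t u)] is o(t); regularity then supplies a point of [M] at
    distance o(t), and dividing its offset from [x] by [t] gives [u']. *)
Lemma tangent_curve G M x A C u : 0 < C ->
  (\forall z \near x, exists2 z', M z' & `|z' - z| <= C * `|G z|) ->
  has_jac G x A -> G x = 0 -> u *m A = 0 ->
  forall e, 0 < e -> exists2 r, 0 < r & forall t, 0 < t < r ->
    exists2 u', M (x + t *: u') & `|u' - u| <= e.
Proof.
move=> C0 MR /has_jacP HJ Gx uA e e0.
pose N := C * (`|u| + 1).
have u1 : 0 < `|u| + 1 by rewrite ltr_wpDl.
have N0 : 0 < N by rewrite mulr_gt0.
have eN : 0 < e / N by rewrite divr_gt0.
have [r r0 Hr] := near_ball_norm (filterI MR (HJ _ eN)).
exists (r / (`|u| + 1)) => [|t /andP[t0 tr]]; first by rewrite divr_gt0.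
have tu : `|(x + t *: u) - x| = t * `|u|.
  by rewrite addrC addKr normrZ gtr0_norm.
have [|[z' Mz' zz'] Ht] := Hr (x + t *: u).
  rewrite tu; apply: le_lt_trans (_ : t * (`|u| + 1) < r).
    by rewrite ler_wpM2l ?(ltW t0) // lerDl.
  by rewrite -ltr_pdivlMr.
exists (t^-1 *: (z' - x)).
  by rewrite scalerA divff ?lt0r_neq0 // scale1r addrC subrK.
have -> : t^-1 *: (z' - x) - u = t^-1 *: (z' - (x + t *: u)).
  rewrite [in RHS]opprD addrA [RHS]scalerBr scalerA mulVf ?lt0r_neq0 //.
  by rewrite scale1r.
rewrite normrZ gtr0_norm ?invr_gt0 // ler_pdivrMl //.
apply: le_trans zz' _.
have xtu : x + t *: u - x = t *: u by rewrite addrC addKr.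
move: Ht; rewrite tu xtu Gx subr0 -scalemxAl uA scaler0 subr0 => Ht.
apply: (@le_trans _ _ (C * (e / N * (t * `|u|)))).
  by rewrite ler_wpM2l ?(ltW C0) // addrC.
have -> : C * (e / N * (t * `|u|)) = t * e * (`|u| / (`|u| + 1)).
  by rewrite /N; field; rewrite !lt0r_neq0.
rewrite ler_piMr ?mulr_ge0 ?(ltW t0) ?(ltW e0) //.
by rewrite ler_pdivrMr // mul1r lerDl.
Qed.

(** The argument of [tangent_curve] one order higher: a residual o(t^2) along the parabola is
    corrected by a displacement o(t^2), that is, by an o(1) change of [w]. *)
Lemma parabolic_curve G M x C u w : 0 < C ->
  (\forall z \near x, exists2 z', M z' & `|z' - z| <= C * `|G z|) ->
  (forall e, 0 < e -> exists2 r, 0 < r & forall t, 0 < t < r ->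
     `|G (x + t *: u + (2^-1 * t ^+ 2) *: w)| <= e * t ^+ 2) ->
  forall e, 0 < e -> exists2 r, 0 < r & forall t, 0 < t < r ->
    exists2 w', M (x + t *: u + (2^-1 * t ^+ 2) *: w') & `|w' - w| <= e.
Proof.
move=> C0 MR HG e e0.
have eC : 0 < e / (2 * C) by rewrite divr_gt0 // mulr_gt0.
have [r1 r10 Hr1] := HG _ eC.
have [r2 r20 Hr2] := near_ball_norm MR.
pose N := `|u| + `|w| + 1.
have N0 : 0 < N by rewrite ltr_wpDl // addr_ge0.
exists (Num.min (Num.min r1 1) (r2 / N)).
  by rewrite !lt_min r10 ltr01 divr_gt0.
move=> t /andP[t0]; rewrite !lt_min => /andP[/andP[tr1 t1] tr2].
set z := x + t *: u + (2^-1 * t ^+ 2) *: w.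
have t2 : 0 < 2^-1 * t ^+ 2 by rewrite mulr_gt0 // exprn_gt0.
have [|z' Mz' zz'] := Hr2 z.
  have -> : z - x = t *: u + (2^-1 * t ^+ 2) *: w.
    by rewrite /z addrC !addrA addNr add0r.
  rewrite (le_lt_trans (ler_normD _ _)) // (normrZ t) (normrZ (2^-1 * _)).
  rewrite (gtr0_norm t0) (gtr0_norm t2).
  apply: le_lt_trans (_ : t * N < r2); last by rewrite -ltr_pdivlMr.
  have H : 2^-1 * t ^+ 2 * `|w| <= t * `|w|.
    rewrite ler_wpM2r // expr2; nra.
  by rewrite /N; move: H t0; lra.
exists ((2^-1 * t ^+ 2)^-1 *: (z' - (x + t *: u))).
  by rewrite scalerA divff ?lt0r_neq0 // scale1r addrC subrK.
have -> : (2^-1 * t ^+ 2)^-1 *: (z' - (x + t *: u)) - w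
    = (2^-1 * t ^+ 2)^-1 *: (z' - z).
  rewrite /z [in RHS]opprD addrA [RHS]scalerBr scalerA mulVf ?lt0r_neq0 //.
  by rewrite scale1r.
rewrite normrZ gtr0_norm ?invr_gt0 // ler_pdivrMl //.
apply: le_trans zz' _.
have H : `|G z| <= e / (2 * C) * t ^+ 2 by apply: Hr1; rewrite t0.
apply: (@le_trans _ _ (C * (e / (2 * C) * t ^+ 2))).
  by rewrite ler_wpM2l ?(ltW C0).
rewrite le_eqVlt; apply/orP; left; apply/eqP.
by field; rewrite lt0r_neq0.
Qed.

End Curves.

(** * The proximal map and the Moreau envelope *)

Section Prox.
Context {R : realType} {d : nat}.
Implicit Types (f : 'rV[R]_d -> \bar R) (rho mu : R) (x y z v : 'rV[R]_d).

Lemma littleo_near (r : 'rV[R]_d -> R^o) x (g : 'rV[R]_d -> R^o) (e : R) :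
  r =o_x g -> 0 < e -> \forall y \near x, `|r y| <= e * `|g y|.
Proof. by move=> /eqoP; apply. Qed.

Lemma enorm_eq0 x : (enorm x == 0) = (x == 0).
Proof. by rewrite -dotvv_eq0 -enorm_sqr sqrf_eq0. Qed.

Lemma enorm0 : enorm (0 : 'rV[R]_d) = 0.
Proof. by rewrite /enorm dot0v sqrtr0. Qed.

Lemma enormZ (a : R) x : enorm (a *: x) = `|a| * enorm x.
Proof.
rewrite /enorm dotvZl dotvZr mulrA -expr2 sqrtrM ?sqr_ge0 //.
by rewrite sqrtr_sqr.
Qed.

(** The subgradient inequality is only local. It is tested at a point [z] of the segment from [x] to
    [y] close enough to [x], and convexity of the shifted function carries it to [y] after division
    by [t]. *)
Lemma weak_subgradient f rho x v y : 0 < rho -> (forall z, f z != -oo%E) ->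
  weakly_convex_with rho f -> subdiff f x v ->
  ((fine (f x) + dotv v (y - x) - rho / 2 * enorm (y - x) ^+ 2)%:E <= f y)%E.
Proof.
move=> rho0 fN fc [fx [r ro Hr]].
have [fy|] := boolP (f y \is a fin_num); last first.
  by move: (fN y); case: (f y) => // _ _; exact: leey.
rewrite -(fineK fy) lee_fin; move: Hr; rewrite -(fineK fx).
set a := fine (f x); set b := fine (f y) => Hr.
rewrite lerBlDr.
apply/ler_addgt0Pr => e e0.
have N0 : 0 < enorm (y - x) + 1 by rewrite ltr_wpDl // enorm_ge0.
have e'0 : 0 < e / (enorm (y - x) + 1) by rewrite divr_gt0.
have [s s0 Hs] := near_ball_norm (filterI Hr (littleo_near ro e'0)).
have [|t /andP[t0 t1] ts] := @small_scale R (`|y - x|) s _ s0; first by [].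
pose z := x + t *: (y - x).
have zx : z - x = t *: (y - x) by rewrite /z addrC addKr.
have [|Hz rz] := Hs z; first by rewrite zx normrZ gtr0_norm.
have t01 : 0 <= t <= 1 by rewrite ltW.
have := fc y x t t01.
have -> : t *: y + (1 - t) *: x = z.
  by rewrite /z scalerBr scalerBl scale1r addrCA addrA.
rewrite -(fineK fx) -(fineK fy) -/a -/b => Hc.
have {Hc} : (((a + (dotv v (z - x) + r z))%:E + (rho / 2 * enorm z ^+ 2)%:E)
   <= t%:E * (b%:E + (rho / 2 * enorm y ^+ 2)%:E)
      + (1 - t)%:E * (a%:E + (rho / 2 * enorm x ^+ 2)%:E))%E.
  by apply: le_trans Hc; rewrite leeD2r // EFinD.
rewrite -!EFinD lee_fin /= => Hc.
(* The exact convexity defect of the squared norm. Of the factor [t (1 - t)] only the part of order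
   [t] survives in the conclusion; the [t ^ 2] part has a favourable sign, recorded in [tD]. *)
have nz : enorm z ^+ 2 = t * enorm y ^+ 2 + (1 - t) * enorm x ^+ 2
    - t * (1 - t) * enorm (y - x) ^+ 2.
  by rewrite !enorm_sqr /z !dotv_lin (dotvC y x); ring.
rewrite nz zx dotvZr in Hc.
have rz' : - (t * e) <= r z.
  move: rz; rewrite zx [X in _ * X]ger0_norm ?enorm_ge0 // ler_norml => /andP[+ _].
  apply: le_trans; rewrite lerN2.
  rewrite enormZ gtr0_norm //.
  rewrite mulrCA ler_wpM2l ?(ltW t0) // mulrAC ler_pdivrMr //.
  by rewrite ler_wpM2l ?(ltW e0) // lerDl.
have tD : 0 <= t * (rho / 2 * (t * enorm (y - x) ^+ 2)).
  by rewrite !mulr_ge0 ?sqr_ge0 ?enorm_ge0 ?invr_ge0 ?(ltW t0) ?(ltW rho0).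
by rewrite -(ler_pM2l t0); move: Hc rz' tD; lra.
Qed.

Lemma prox_finite f mu x y z : (forall z, f z != -oo%E) ->
  prox_set mu f x y -> f z \is a fin_num -> f y \is a fin_num.
Proof.
move=> fN /(_ z); rewrite /prox_objective => H fz.
rewrite fin_numE fN /=; apply: contraTneq H => ->.
by rewrite -(fineK fz) -EFinD addye // leye_eq.
Qed.

Lemma prox_ineq f mu x y z : (forall z, f z != -oo%E) ->
  prox_set mu f x y -> f y \is a fin_num ->
  ((fine (f y) + (2 * mu)^-1 * enorm (y - x) ^+ 2
     - (2 * mu)^-1 * enorm (z - x) ^+ 2)%:E <= f z)%E.
Proof.
move=> fN /(_ z); rewrite /prox_objective => + fy.
have [fz|] := boolP (f z \is a fin_num); last first.
  by move: (fN z); case: (f z) => // _ _ _; exact: leey.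
rewrite -(fineK fz) -(fineK fy) -!EFinD !lee_fin /=; lra.
Qed.

Lemma littleo_enorm_sqr (c : R) x :
  (fun z => c * enorm (z - x) ^+ 2 : R^o) =o_x (fun z => enorm (z - x) : R^o).
Proof.
apply/eqoP => e e0.
have C0 : 0 < `|c| * d%:R + 1 by rewrite ltr_wpDl // mulr_ge0.
have N0 : 0 < e / (`|c| * d%:R + 1) by rewrite divr_gt0.
apply: (ball_norm_near N0) => z; rewrite ltr_pdivlMr // => zx.
suff : `|c * enorm (z - x) ^+ 2 : R| <= e * `|enorm (z - x) : R| by [].
rewrite normrM normrX !(ger0_norm (enorm_ge0 _)) expr2 mulrA.
rewrite ler_wpM2r ?enorm_ge0 //.
apply: (@le_trans _ _ (`|c| * (d%:R * `|z - x|))).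
  by rewrite ler_wpM2l // enorm_le_norm.
by apply: le_trans (ltW zx); rewrite mulrA mulrC ler_wpM2l // lerDl.
Qed.

(** Minimality of [y] puts [f] above a paraboloid touching it at [y]; expanding the squares shows
    that its slope there is [(x - y) / mu] and its remainder quadratic. *)
Lemma prox_subdiff f mu x y : 0 < mu -> (forall z, f z != -oo%E) ->
  prox_set mu f x y -> f y \is a fin_num ->
  subdiff f y (mu^-1 *: (x - y)).
Proof.
move=> mu0 fN Pxy fy; split=> //.
exists (fun z => - (2 * mu)^-1 * enorm (z - y) ^+ 2).
  exact: littleo_enorm_sqr.
apply: (@nearW _ (nbhs y) _ (nbhs_filter y)) => z.
rewrite -[X in (X + _)%E](fineK fy) -EFinD.
apply: le_trans (prox_ineq z fN Pxy fy); rewrite lee_fin.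
rewrite !enorm_sqr !dotv_lin.
rewrite (dotvC z x) (dotvC y x) (dotvC z y).
rewrite le_eqVlt; apply/orP; left; apply/eqP.
by field; rewrite lt0r_neq0.
Qed.

(** Adding the global subgradient inequalities at [y] and [y'] gives [(1 - rho mu) |y' - y|^2 <= <x'
    - x, y' - y>], and Cauchy-Schwarz concludes. For [x = x'] this is uniqueness of the proximal
    point. *)
Lemma prox_lipschitz f rho mu x x' y y' : 0 < rho -> 0 < mu ->
  (forall z, f z != -oo%E) -> weakly_convex_with rho f ->
  f y \is a fin_num -> f y' \is a fin_num ->
  prox_set mu f x y -> prox_set mu f x' y' ->
  (1 - rho * mu) * enorm (y' - y) <= enorm (x' - x).
Proof.
move=> rho0 mu0 fN fc fy fy' H H'.
have := weak_subgradient y' rho0 fN fc (prox_subdiff mu0 fN H fy).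
have := weak_subgradient y rho0 fN fc (prox_subdiff mu0 fN H' fy').
rewrite -(fineK fy) -(fineK fy') !lee_fin /= => H1 H2.
have [/eqP|y0] := eqVneq (enorm (y' - y)) 0.
  by rewrite enorm_eq0 => /eqP ->; rewrite /enorm dot0v sqrtr0 mulr0 enorm_ge0.
have y1 : 0 < enorm (y' - y) by rewrite lt_def y0 enorm_ge0.
have CS := le_trans (ler_norm _) (cauchy_schwarz (x' - x) (y' - y)).
rewrite -(ler_pM2r y1); apply: le_trans CS; rewrite -mulrA -expr2.
have EN : enorm (y - y') ^+ 2 = enorm (y' - y) ^+ 2.
  by rewrite !enorm_sqr -(opprB y' y) !dotv_lin; ring.
rewrite EN in H1.
have K : dotv (mu^-1 *: (x - y)) (y' - y) + dotv (mu^-1 *: (x' - y')) (y - y')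
    = mu^-1 * (enorm (y' - y) ^+ 2 - dotv (x' - x) (y' - y)).
  by rewrite !enorm_sqr !dotv_lin (dotvC y y'); ring.
have : mu^-1 * (enorm (y' - y) ^+ 2 - dotv (x' - x) (y' - y)) <=
    rho * enorm (y' - y) ^+ 2.
  by rewrite -K; move: H1 H2; lra.
by rewrite ler_pdivrMl //; lra.
Qed.

End Prox.

(** * Existence of proximal points and differentiability of the envelope *)

Section MoreauEnvelope.
Context {R : realType} {d : nat} (f : 'rV[R]_d -> \bar R) (rho mu : R)
  (x0 : 'rV[R]_d).
Context (f_gtNy : forall x, f x != -oo%E) (f_closed : closed_fun f)
  (rho_gt0 : 0 < rho) (f_wcvx : weakly_convex_with rho f)
  (x0_crit : critical f x0) (mu_gt0 : 0 < mu) (mu_lt : mu < rho^-1).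
Implicit Types (x y z : 'rV[R]_d).

Lemma critical_fin : f x0 \is a fin_num.
Proof. by case: x0_crit. Qed.

Lemma critical_lower y :
  ((fine (f x0) - rho / 2 * enorm (y - x0) ^+ 2)%:E <= f y)%E.
Proof.
have := weak_subgradient y rho_gt0 f_gtNy f_wcvx x0_crit.
by rewrite dotvC dotv0 addr0.
Qed.

Lemma rho_mu_lt1 : 0 < 1 - rho * mu.
Proof. by rewrite subr_gt0 mulrC -ltr_pdivlMr // div1r. Qed.

(** Coercivity: [f] lies above a paraboloid of curvature [- rho] with apex at [x0], while the
    penalty has curvature [1 / mu > rho]. Candidates at least as good as [x0] are therefore confined
    to an explicit ball. *)
Lemma prox_bounded x y :
  (prox_objective mu f x y <= prox_objective mu f x x0)%E ->
  (1 - rho * mu) * enorm (y - x0) <= 2 * enorm (x - x0).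
Proof.
rewrite /prox_objective -(fineK critical_fin) -EFinD => H.
have := le_trans (leeD2r _ (critical_lower y)) H.
rewrite -EFinD lee_fin /= => {}H.
have [/eqP|y0] := eqVneq (enorm (y - x0)) 0.
  by move=> /eqP ->; rewrite mulr0 mulr_ge0 // enorm_ge0.
have y1 : 0 < enorm (y - x0) by rewrite lt_def y0 enorm_ge0.
have CS := le_trans (ler_norm _) (cauchy_schwarz (x - x0) (y - x0)).
rewrite -(ler_pM2r y1) -mulrA -[leRHS]mulrA -expr2.
apply: (@le_trans _ _ (2 * dotv (x - x0) (y - x0))); last by rewrite ler_pM2l.
have E : enorm (y - x) ^+ 2 = enorm (x0 - x) ^+ 2 - 2 * dotv (x - x0) (y - x0)
    + enorm (y - x0) ^+ 2.
  rewrite !enorm_sqr !dotv_lin.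
  by rewrite (dotvC y x) (dotvC x0 x) (dotvC y x0); ring.
have {}H : (2 * mu)^-1 * (enorm (y - x0) ^+ 2 - 2 * dotv (x - x0) (y - x0))
    <= rho / 2 * enorm (y - x0) ^+ 2.
  by rewrite E in H; move: H; lra.
move: H; rewrite ler_pdivrMl ?mulr_gt0 //; lra.
Qed.

(** The objective is extended-valued and merely lower semicontinuous, so the continuous function
    [snd] is minimised instead, over a compact piece of the epigraph of the objective. That epigraph
    is closed as the preimage of the epigraph of [f] under the shear [h]. *)
Lemma prox_exists x : prox_set mu f x !=set0.
Proof.
pose r := 2 * enorm (x - x0) / (1 - rho * mu).
have r0 : 0 <= r.
  by rewrite divr_ge0 ?mulr_ge0 ?enorm_ge0 // ltW // rho_mu_lt1.
have inball y : (prox_objective mu f x y <= prox_objective mu f x x0)%E ->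
    enorm (y - x0) <= r.
  by move/prox_bounded; rewrite mulrC -ler_pdivlMr // rho_mu_lt1.
pose q y := (2 * mu)^-1 * enorm (y - x) ^+ 2.
have q0 y : 0 <= q y.
  by rewrite mulr_ge0 ?sqr_ge0 // invr_ge0 mulr_ge0 // ltW.
pose v0 := fine (f x0) + q x0.
have v0E : prox_objective mu f x x0 = v0%:E.
  by rewrite /prox_objective -(fineK critical_fin) -EFinD.
(* A lower bound of the objective on the ball, from [critical_lower] and [q0]; it bounds the piece
   of epigraph from below. *)
pose L := fine (f x0) - rho / 2 * r ^+ 2.
pose h (p : 'rV[R]_d * R) := (p.1, p.2 - q p.1).
have hc : continuous h.
  move=> p.
  have h1 : (fun p : 'rV[R]_d * R => p.1) @ nbhs p --> nbhs p.1 by exact: cvg_fst.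
  have h2 : (fun p : 'rV[R]_d * R => p.2) @ nbhs p --> nbhs p.2 by exact: cvg_snd.
  have hq : (fun p => p.2 - q p.1) @ nbhs p --> nbhs (p.2 - q p.1).
    apply: (@cvgB _ R^o _ (nbhs p)) => //.
    apply: (@cvgM _ _ (nbhs p)); first exact: cvg_cst.
    under eq_fun do rewrite enorm_sqr.
    rewrite enorm_sqr; apply: (@cvg_dotv _ _ (nbhs p));
      by apply: (@cvgB _ _ _ (nbhs p)) => //; exact: cvg_cst.
  exact: (@cvg_pair _ _ _ (nbhs p) (nbhs p.1) (nbhs (p.2 - q p.1)) _ _ _ _ _ h1 hq).
pose B := [set p : 'rV[R]_d * R | `|p.1 - x0| <= r /\ L <= p.2 <= v0].
pose K := B `&` h @^-1` [set p | (f p.1 <= p.2%:E)%E].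
have Kc : compact K.
  apply: compact_closedI.
    have -> : B = [set y | `|y - x0| <= r] `*` `[L, v0]%classic.
      by apply/seteqP; split=> p [/= p1 p2]; split=> //=; move: p2; rewrite in_itv.
    apply: compact_setX; [exact: compact_norm_ball|exact: segment_compact].
  by apply: closed_comp => // p _; exact: hc.
have KP z : (prox_objective mu f x z <= v0%:E)%E ->
    K (z, fine (prox_objective mu f x z)) /\ f z \is a fin_num.
  move=> zv; have fz : f z \is a fin_num.
    rewrite fin_numE f_gtNy /=; apply: contraTneq zv => zE.
    by rewrite /prox_objective zE addye // leye_eq.
  have oz : prox_objective mu f x z = (fine (f z) + q z)%:E.
    by rewrite /prox_objective -{1}(fineK fz) -EFinD.
  have zr : enorm (z - x0) <= r by apply: inball; rewrite v0E.
  split=> //; rewrite oz /=; split; [split=> /=|].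
  - by rewrite (le_trans (norm_le_enorm _)).
  - move: zv; rewrite oz lee_fin => ->; rewrite andbT.
    have := critical_lower z; rewrite -(fineK fz) lee_fin.
    have : enorm (z - x0) ^+ 2 <= r ^+ 2 by rewrite ler_sqr ?nnegrE ?enorm_ge0.
    have := q0 z; rewrite /L; move: rho_gt0; nra.
  - by rewrite /h /= addrK fineK.
have K0 : K !=set0.
  by have [] := KP x0 _; [rewrite v0E|exists (x0, fine (prox_objective mu f x x0))].
have [|[y c]] := @compact_EVT_min _ R snd K K0 Kc.
  apply: continuous_in_subspaceT => p _; exact: cvg_snd.
move=> /set_mem[/= [_ /andP[_ cv]] fyc] cmin.
have yc : (prox_objective mu f x y <= c%:E)%E.
  rewrite /prox_objective -(subrK (q y) c) EFinD leeD2r //.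
exists y => z.
have [zv|/ltW zv] := leP (prox_objective mu f x z) v0%:E.
  have [Kz fz] := KP z zv.
  apply: le_trans yc _.
  have := cmin _ (mem_set Kz); rewrite /= /prox_objective -(fineK fz) -EFinD /=.
  by rewrite lee_fin.
by apply: le_trans zv; apply: le_trans yc _; rewrite lee_fin.
Qed.

Lemma prox_setP x : prox_set mu f x (prox mu f x).
Proof. by have [y yP] := prox_exists x; rewrite /prox; apply: xgetPex; exists y. Qed.

Lemma prox_fin x : f (prox mu f x) \is a fin_num.
Proof. exact: prox_finite f_gtNy (prox_setP x) critical_fin. Qed.

Lemma prox_lip x x' :
  (1 - rho * mu) * enorm (prox mu f x' - prox mu f x) <= enorm (x' - x).
Proof.
apply: prox_lipschitz f_wcvx _ _ (prox_setP x) (prox_setP x') => //;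
exact: prox_fin.
Qed.

(** By [critical_lower] and [rho <= 1 / mu], [x0] minimises its own objective; [prox_lipschitz] with
    equal base points identifies it with the chosen minimiser. *)
Lemma prox_critical : prox mu f x0 = x0.
Proof.
have H : prox_set mu f x0 x0.
  move=> z; rewrite /prox_objective subrr enorm0 expr0n mulr0.
  rewrite adde0; have [fz|] := boolP (f z \is a fin_num); last first.
    by move: (f_gtNy z); case: (f z) => // _ _; rewrite addye // leey.
  have := critical_lower z; rewrite -(fineK fz) -(fineK critical_fin) -EFinD.
  rewrite !lee_fin /=.
  have : rho / 2 <= (2 * mu)^-1.
    rewrite invfM mulrC ler_pM2l // -[rho]invrK lef_pV2 ?ltW //.
    by rewrite posrE invr_gt0.
  have := sqr_ge0 (enorm (z - x0)); nra.
apply/eqP; rewrite -subr_eq0 -enorm_eq0 eq_le enorm_ge0 andbT.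
rewrite -(pmulr_rle0 _ rho_mu_lt1).
have := prox_lipschitz rho_gt0 mu_gt0 f_gtNy f_wcvx critical_fin (prox_fin x0) H
  (prox_setP x0).
by rewrite subrr enorm0.
Qed.

Lemma moreauE x : moreau mu f x =
  (fine (f (prox mu f x)) + (2 * mu)^-1 * enorm (prox mu f x - x) ^+ 2)%:E.
Proof.
rewrite EFinD fineK ?prox_fin //; apply/eqP; rewrite eq_le; apply/andP; split.
  by apply: ereal_inf_lbound; exists (prox mu f x).
by apply: le_ereal_inf_tmp => _ [z _ <-]; exact: (prox_setP x z).
Qed.

Lemma moreau_fin x : moreau mu f x \is a fin_num.
Proof. by rewrite moreauE. Qed.

Definition moreau_grad x : 'rV[R]_d := mu^-1 *: (x - prox mu f x).

Lemma moreau_le x y : (moreau mu f x <= prox_objective mu f x y)%E.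
Proof. by apply: ereal_inf_lbound; exists y. Qed.

(** The proximal point of [x] is used as a competitor at [x']; the rest is an exact expansion of
    squares. *)
Lemma moreau_upper x x' : fine (moreau mu f x') <= fine (moreau mu f x)
  + dotv (x' - x) (moreau_grad x) + (2 * mu)^-1 * enorm (x' - x) ^+ 2.
Proof.
have := moreau_le x' (prox mu f x); rewrite /prox_objective.
rewrite -(fineK (moreau_fin x')) -(fineK (prox_fin x)) -EFinD lee_fin /= (moreauE x) /=.
move=> H; apply: le_trans H _; rewrite /moreau_grad; set y := prox mu f x.
rewrite le_eqVlt; apply/orP; left; apply/eqP.
rewrite !enorm_sqr !dotv_lin (dotvC y x) (dotvC y x') (dotvC x x').
by field; rewrite lt0r_neq0.
Qed.

(** [moreau_upper] with [x] and [x'] exchanged; replacing the gradient at [x'] by the one at [x]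
    costs the Lipschitz constant of the proximal map, whence the second term of the constant. The
    bound yields differentiability, and later the weak convexity of the envelope. *)
Lemma moreau_lower x x' : fine (moreau mu f x)
  + dotv (x' - x) (moreau_grad x)
  - ((2 * mu)^-1 + (mu * (1 - rho * mu))^-1) * enorm (x' - x) ^+ 2
  <= fine (moreau mu f x').
Proof.
have := moreau_upper x' x; have := rho_mu_lt1; move=> k0.
set y := prox mu f x; set y' := prox mu f x'.
have CS := le_trans (ler_norm _) (cauchy_schwarz (x' - x) (y' - y)).
have L := prox_lip x x'; rewrite -/y -/y' in L.
have {}CS : dotv (x' - x) (y' - y) <= (1 - rho * mu)^-1 * enorm (x' - x) ^+ 2.
  apply: le_trans CS _; rewrite ler_pdivlMl // mulrCA expr2.
  by rewrite ler_wpM2l // enorm_ge0.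
have E : dotv (x - x') (moreau_grad x') = - dotv (x' - x) (moreau_grad x)
    - mu^-1 * (enorm (x' - x) ^+ 2 - dotv (x' - x) (y' - y)).
  rewrite /moreau_grad -/y -/y'; clearbody y y'.
  by rewrite enorm_sqr !dotv_lin (dotvC x' x); ring.
have EN : enorm (x - x') ^+ 2 = enorm (x' - x) ^+ 2.
  by rewrite !enorm_sqr -(opprB x' x) !dotv_lin; ring.
rewrite E EN (invfM mu).
have : mu^-1 * dotv (x' - x) (y' - y) <=
    mu^-1 * ((1 - rho * mu)^-1 * enorm (x' - x) ^+ 2).
  by rewrite ler_pM2l // invr_gt0.
have : 0 <= mu^-1 * enorm (x' - x) ^+ 2.
  by rewrite mulr_ge0 ?sqr_ge0 // invr_ge0 ltW.
clear; move: (dotv _ (moreau_grad _)) (fine _) (fine _) (dotv _ _) => a b c D.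
by move: (enorm _ ^+ 2) (1 - _)^-1 (2 * mu)^-1 mu^-1 => N k q m; lra.
Qed.

Lemma moreau_has_grad x :
  has_grad (fun y => fine (moreau mu f y)) x (moreau_grad x).
Proof.
pose C := (2 * mu)^-1 + (mu * (1 - rho * mu))^-1.
have C1 : 0 <= (2 * mu)^-1 by rewrite invr_ge0 mulr_ge0 // ltW.
have C2 : 0 <= (mu * (1 - rho * mu))^-1.
  by rewrite invr_ge0 mulr_ge0 ?ltW // rho_mu_lt1.
have C0 : 0 <= C by rewrite addr_ge0.
apply/has_gradP => e e0.
have N0 : 0 < e / (C * d%:R ^+ 2 + 1).
  by rewrite divr_gt0 // ltr_wpDl // mulr_ge0 // sqr_ge0.
apply: (ball_norm_near N0) => y; rewrite ltr_pdivlMr => [yx|]; last first.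
  by rewrite ltr_wpDl // mulr_ge0 // sqr_ge0.
have H : C * enorm (y - x) ^+ 2 <= e * `|y - x|.
  have : enorm (y - x) ^+ 2 <= (d%:R * `|y - x|) ^+ 2.
    by rewrite ler_sqr ?nnegrE ?enorm_ge0 ?mulr_ge0 // enorm_le_norm.
  rewrite exprMn => /(ler_wpM2l C0) /le_trans; apply.
  rewrite mulrA expr2 mulrA ler_wpM2r // mulrC.
  by apply: le_trans (ltW yx); rewrite ler_wpM2l // lerDl.
have up := moreau_upper x y; have lo := moreau_lower x y.
rewrite -/C in lo.
have : 0 <= (mu * (1 - rho * mu))^-1 * enorm (y - x) ^+ 2.
  by rewrite mulr_ge0 ?sqr_ge0.
rewrite /C in H lo *; rewrite ler_norml => D; apply/andP; split; lra.
Qed.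

End MoreauEnvelope.

(** * Second-order analysis on a smooth model of the manifold *)

Section C2Calculus.
Context {R : realType} {n : nat}.
Implicit Types (x y : 'rV[R]_n) (phi psi : 'rV[R]_n -> R).

Lemma has_jacD {p : nat} (f f' : 'rV[R]_n -> 'rV[R]_p) x A A' :
  has_jac f x A -> has_jac f' x A' ->
  has_jac (fun y => f y + f' y) x (A + A').
Proof.
move=> H1 H2; rewrite /has_jac; have := is_diffD H1 H2.
by congr (is_diff x _ _); apply/funext => v; rewrite mulmxDr.
Qed.

Lemma has_jacZ {p : nat} (f : 'rV[R]_n -> 'rV[R]_p) x A a :
  has_jac f x A -> has_jac (fun y => a *: f y) x (a *: A).
Proof.
move=> H; rewrite /has_jac; have := is_diffZ a H.
by congr (is_diff x _ _); apply/funext => v; rewrite -scalemxAr.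
Qed.

Lemma has_jac_cst {p : nat} (c : 'rV[R]_p) x : has_jac (fun=> c) x 0.
Proof.
rewrite /has_jac; have := is_diff_cst c x.
by congr (is_diff x _ _); apply/funext => v; rewrite mulmx0.
Qed.

Lemma C2_nearD phi g h psi g' h' x : C2_near phi g h x -> C2_near psi g' h' x ->
  C2_near (fun y => phi y + psi y) (fun y => g y + g' y) (fun y => h y + h' y) x.
Proof.
apply: filterS2 => y [p1 p2 p3] [q1 q2 q3]; split.
- exact: has_gradD.
- exact: has_jacD.
- exact: (@cvgD _ _ _ (nbhs y)).
Qed.

Lemma C2_nearZ a phi g h x : C2_near phi g h x ->
  C2_near (fun y => a * phi y) (fun y => a *: g y) (fun y => a *: h y) x.
Proof.
apply: filterS => y [p1 p2 p3]; split.
- exact: has_gradZ.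
- exact: has_jacZ.
- by apply: (@cvgZ _ _ _ (nbhs y)) => //; exact: cvg_cst.
Qed.

Lemma C2_near_cst c x : C2_near (fun=> c) (fun=> 0) (fun=> 0) x.
Proof.
near=> y; split; first exact: has_grad_cst.
- exact: has_jac_cst.
- exact: cst_continuous.
Unshelve. all: by end_near. Qed.

Lemma C2_near_sum (I : Type) (s : seq I) (phi : I -> 'rV[R]_n -> R) g h x :
  (forall i, C2_near (phi i) (g i) (h i) x) ->
  C2_near (fun y => \sum_(i <- s) phi i y) (fun y => \sum_(i <- s) g i y)
    (fun y => \sum_(i <- s) h i y) x.
Proof.
move=> H; elim: s => [|i s IH].
  by do 3 under [fun y => \sum_(i <- [::]) _]eq_fun do rewrite big_nil;
    exact: C2_near_cst.
by do 3 under [fun y => \sum_(i <- _ :: _) _]eq_fun do rewrite big_cons;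
  exact: C2_nearD.
Qed.

Lemma C2_near_grad phi g h x : C2_near phi g h x ->
  \forall y \near x, has_grad phi y (g y).
Proof. by apply: filterS => y []. Qed.

Lemma C2_near_jac phi g h x : C2_near phi g h x -> has_jac g x (h x).
Proof. by move=> /nbhs_singleton[]. Qed.

End C2Calculus.

Section RightLimits.
Context {R : realType} {d : nat}.
Implicit Types (x u w : 'rV[R]_d).

Lemma near_at_right (P : set R) : (\forall t \near 0^'+, P t) ->
  exists2 r, 0 < r & forall t, 0 < t < r -> P t.
Proof.
move=> [r /= r0 Hr]; exists r => // t /andP[t0 tr]; apply: Hr => //=.
by rewrite sub0r normrN gtr0_norm.
Qed.

Lemma cvg_at_right0 : (t : R^o) @[t --> (0 : R)^'+] --> (0 : R^o).
Proof. exact: cvg_at_right_filter cvg_id. Qed.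

Context {T : Type} {F : set_system T} {FF : Filter F}.
Implicit Types (tau : T -> R^o) (k : T -> 'rV[R]_d).

(** Stated over an arbitrary filter to serve both for [t] decreasing to 0 and for the product filter
    of the parabolic subderivative, where [tau] and [k] are the projections. *)
Lemma cvg_half_line tau k u w : tau @ F --> (0 : R^o) -> k @ F --> w ->
  u + (2^-1 * tau t) *: k t @[t --> F] --> u.
Proof.
move=> tau0 kw.
suff : u + (2^-1 * tau t) *: k t @[t --> F] --> u + (2^-1 * 0) *: w.
  by rewrite mulr0 scale0r addr0.
apply: cvgD; first exact: cvg_cst.
by apply: cvgZ => //; apply: cvgM => //; exact: cvg_cst.
Qed.

Lemma cvg_line x tau k u (P : set 'rV[R]_d) : tau @ F --> (0 : R^o) ->
  k @ F --> u -> (\forall z \near x, P z) ->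
  \forall t \near F, P (x + tau t *: k t).
Proof.
move=> tau0 ku xP.
have : x + tau t *: k t @[t --> F] --> x.
  suff : x + tau t *: k t @[t --> F] --> x + 0 *: u.
    by rewrite scale0r addr0.
  by apply: cvgD; [exact: cvg_cst|exact: cvgZ].
by apply.
Qed.

End RightLimits.

(** * Manifolds given by equations, and approximate curves in them *)

Section Model.
Context {R : realType} {d m : nat}.
Implicit Types (f : 'rV[R]_d -> \bar R) (M : set 'rV[R]_d) (x y z u w : 'rV[R]_d)
  (F : 'rV[R]_d -> R) (G : 'I_m -> 'rV[R]_d -> R)
  (dF : 'rV[R]_d -> 'rV[R]_d) (hF : 'rV[R]_d -> 'M[R]_d)
  (g : 'I_m -> 'rV[R]_d -> 'rV[R]_d) (h : 'I_m -> 'rV[R]_d -> 'M[R]_d)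
  (B : 'M[R]_(m, d)) (lam : 'rV[R]_m).

Definition jac g y : 'M[R]_(d, m) := \matrix_(i, j) g j y 0 i.

(* F is a C^2 extension of f from M near x, and the equations G_j = 0 define M
   near x; dF, hF and g_j, h_j are the gradients and Hessians of F and G_j, and
   the right inverse B of the Jacobian witnesses its full rank. *)
Record smooth_model f M x F dF hF G g h B : Prop := SmoothModel {
  model_F : C2_near F dF hF x;
  model_f : \forall y \near x, M y -> f y = (F y)%:E;
  model_G : forall j, C2_near (G j) (g j) (h j) x;
  model_M : \forall y \near x, M y <-> forall j, G j y = 0;
  model_x : M x;
  model_B : B *m jac g x = 1%:M
}.

Definition lagrangian F G lam y : R := F y + \sum_j lam 0 j * G j y.
Definition lagrangian_grad dF g lam y : 'rV[R]_d :=
  dF y + \sum_j lam 0 j *: g j y.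
Definition lagrangian_hess hF h lam y : 'M[R]_d :=
  hF y + \sum_j lam 0 j *: h j y.

Lemma jac_mul g y lam : lam *m (jac g y)^T = \sum_j lam 0 j *: g j y.
Proof.
apply/rowP => i; rewrite !mxE summxE; apply: eq_bigr => j _.
by rewrite !mxE.
Qed.

Lemma mul_jac g y u j : (u *m jac g y) 0 j = dotv u (g j y).
Proof. by rewrite mxE dotvE; apply: eq_bigr => i _; rewrite mxE. Qed.

Section ModelTheory.
Context f M x F dF hF G g h B (mod : smooth_model f M x F dF hF G g h B).

Lemma model_C1 : C1_near (fun y => \row_j G j y) (jac g) x.
Proof.
have : \forall y \near x, forall j,
    [/\ has_grad (G j) y (g j y), has_jac (g j) y (h j y) & {for y, continuous (h j)}].
  by apply: (@filter_forall _ _ _ (nbhs x) (nbhs_filter x)); exact: model_G mod.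
apply: filterS => y Hy; split.
  apply/has_jac_rowP => j; under eq_fun do rewrite mxE.
  have [H _ _] := Hy j; apply: has_grad_eq H _.
  by apply/rowP => i; rewrite !mxE.
apply: (continuous_mxP (jac g) y).2 => i j.
have [_ /has_jac_continuous H _] := Hy j.
have := (continuous_mxP (g j) y).1 H 0 i.
by apply: continuous_near_eq; near=> z; rewrite mxE.
Unshelve. all: by end_near. Qed.

Lemma model_M_row : \forall y \near x, M y <-> \row_j G j y = 0.
Proof.
apply: filterS (model_M mod) => y ->; split=> [H|/rowP H].
  by apply/rowP => j; rewrite !mxE.
by move=> j; have := H j; rewrite !mxE.
Qed.

Lemma model_regular : exists2 C, 0 < C & \forall z \near x,
  exists2 z', M z' & `|z' - z| <= C * `|\row_j G j z|.
Proof.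
exact: metric_regularity model_C1 (model_B mod) (model_x mod) model_M_row.
Qed.

(** Needed at all points of [M] near [x], since stationarity will be expressed at the moving point
    [P x]. *)
Lemma model_tangent : \forall y \near x, M y -> forall u, u *m jac g y = 0 ->
  forall e, 0 < e -> exists2 r, 0 < r & forall t, 0 < t < r ->
    exists2 u', M (y + t *: u') & `|u' - u| <= e.
Proof.
have [C C0 /near_join MR] := model_regular.
apply: filterS (filterI (filterI MR model_C1) model_M_row).
move=> y [[MRy [Hj _]] My] /My Gy u uJ.
exact: tangent_curve C0 MRy Hj Gy uJ.
Qed.

(** Provides the [w] at which the parabolic subderivative is finite. *)
Lemma model_parabolic u : u *m jac g x = 0 ->
  exists w, forall e, 0 < e -> exists2 r, 0 < r & forall t, 0 < t < r ->
    exists2 w', M (x + t *: u + (2^-1 * t ^+ 2) *: w') & `|w' - w| <= e.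
Proof.
move=> uJ; have [C C0 MR] := model_regular.
pose c : 'rV[R]_m := \row_j dotv (u *m h j x) u.
(* This [w] pairs with each gradient [g j x] to minus the quadratic form of [h j x] at [u], so the
   terms of order [t ^ 2] of every [G j] cancel along the parabola; [B] solves these [m] equations
   at once. *)
exists (- (c *m B)); apply: parabolic_curve C0 MR _ => e e0.
set w := - (c *m B).
have Gx j : G j x = 0 by apply: (nbhs_singleton (model_M mod)).1; exact: model_x mod.
have wg j : dotv w (g j x) = - dotv (u *m h j x) u.
  by rewrite -mul_jac /w mulNmx -mulmxA (model_B mod) mulmx1 !mxE.
have ug j : dotv u (g j x) = 0 by rewrite -mul_jac uJ mxE.
(* The parabola is rewritten as [x + t k(t)] with [k(t)] tending to [u], the shape to which
   [taylor2] applies. *)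
pose k t := u + (2^-1 * t) *: w.
have kE t : x + t *: u + (2^-1 * t ^+ 2) *: w = x + t *: k t.
  have -> : 2^-1 * t ^+ 2 = t * (2^-1 * t) by ring.
  by rewrite /k scalerDr scalerA addrA.
have kc : k t @[t --> 0^'+] --> u.
  by apply: cvg_half_line cvg_at_right0 _; exact: cvg_cst.
pose N := `|u| + 1; have N0 : 0 < N by rewrite ltr_wpDl.
have kN : \forall t \near 0^'+, `|k t| <= N.
  have /cvgrPdist_le /(_ 1 ltr01) := kc; apply: filterS => t H.
  rewrite -[k t](subrK u) (le_trans (ler_normD _ _)) // /N addrC lerD2l.
  by rewrite distrC.
have e'0 : 0 < e / (2 * N ^+ 2) by rewrite divr_gt0 // mulr_gt0 // exprn_gt0.
suff : \forall t \near 0^'+, forall j, `|G j (x + t *: k t)| <= e * t ^+ 2.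
  move=> /near_at_right[r r0 Hr]; exists r => // t /Hr Ht.
  rewrite kE; apply: norm_le_coord => [|i j].
    by rewrite mulr_ge0 ?sqr_ge0 // ltW.
  by rewrite mxE.
apply: filter_forall => j.
have T := taylor2 (C2_near_grad (model_G mod j)) (C2_near_jac (model_G mod j)) e'0.
have Q : \forall t \near 0^'+,
    `|dotv (u *m h j x) u - dotv (k t *m h j x) (k t)| <= e.
  have : (dotv (k t *m h j x) (k t) : R^o) @[t --> 0^'+]
      --> (dotv (u *m h j x) u : R^o).
    apply: cvg_dotv => //; apply: cvg_mulmx => //; exact: cvg_cst.
  by move=> /cvgrPdist_le; apply.
near=> t.
have t0 : 0 < t by near: t; exact: nbhs_right_gt.
have xk : x + t *: k t - x = t *: k t by rewrite addrC addKr.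
have : `|G j (x + t *: k t) - G j x - dotv (x + t *: k t - x) (g j x)
   - 2^-1 * dotv ((x + t *: k t - x) *m h j x) (x + t *: k t - x)|
      <= e / (2 * N ^+ 2) * `|x + t *: k t - x| ^+ 2.
  near: t; exact: (cvg_line cvg_at_right0 kc T).
rewrite xk Gx subr0 -scalemxAl !dotvZl !dotvZr.
have -> : dotv (k t) (g j x) = - (2^-1 * t) * dotv (u *m h j x) u.
  by rewrite /k dotvDl dotvZl ug add0r wg mulrN mulNr.
have : `|dotv (u *m h j x) u - dotv (k t *m h j x) (k t)| <= e by near: t.
have : `|k t| <= N by near: t.
rewrite normrZ gtr0_norm // exprMn.
move: (dotv _ _) (dotv _ _) (G j _) => a b c' kN' ab.
have kN2 : `|k t| ^+ 2 <= N ^+ 2 by rewrite ler_sqr ?nnegrE // ltW.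
have N2 : e / (2 * N ^+ 2) * (t ^+ 2 * `|k t| ^+ 2) <= e / 2 * t ^+ 2.
  have -> : e / 2 * t ^+ 2 = e / (2 * N ^+ 2) * (t ^+ 2 * N ^+ 2).
    by field; rewrite lt0r_neq0.
  by rewrite ler_wpM2l ?(ltW e'0) // ler_wpM2l ?sqr_ge0.
have {}ab : `|2^-1 * t ^+ 2 * (a - b)| <= e / 2 * t ^+ 2.
  rewrite normrM ger0_norm ?mulr_ge0 ?sqr_ge0 //.
  have -> : e / 2 * t ^+ 2 = 2^-1 * t ^+ 2 * e by ring.
  by rewrite ler_wpM2l 1?distrC // mulr_ge0 ?sqr_ge0.
move=> /le_trans /(_ N2).
move: ab; rewrite !ler_norml => /andP[a1 a2] /andP[b1 b2].
by apply/andP; split; move: a1 a2 b1 b2; rewrite expr2; lra.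
Unshelve. all: by end_near. Qed.

End ModelTheory.
End Model.

(** * Second-order necessary condition and the parabolic subderivative *)

Section SecondVariation.
Context {R : realType} {d : nat}.
Implicit Types (M : set 'rV[R]_d) (x u w : 'rV[R]_d).

(** Because the gradient of [psi] vanishes at [x], first-order approximation of [u] by points of [M]
    already determines the quadratic term. It is applied to the Lagrangian plus a quadratic and to
    the Lagrangian minus the envelope. *)
Lemma tangent_nonneg (psi : 'rV[R]_d -> R) g N M x u :
  (\forall y \near x, has_grad psi y (g y)) -> g x = 0 -> has_jac g x N ->
  psi x = 0 -> (\forall z \near x, M z -> 0 <= psi z) ->
  (forall e, 0 < e -> exists2 r, 0 < r & forall t, 0 < t < r ->
    exists2 u', M (x + t *: u') & `|u' - u| <= e) ->
  0 <= dotv (u *m N) u.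
Proof.
move=> Hg gx HN psix psi0 Hu; rewrite leNgt; apply/negP => k0.
set k := dotv (u *m N) u in k0.
have : \forall v \near u, dotv (v *m N) v < k / 2.
  have : (dotv (v *m N) v : R^o) @[v --> u] --> (k : R^o).
    apply: (@cvg_dotv _ _ (nbhs u)) => //.
    apply: (@cvg_mulmx _ _ (nbhs u)) => //; exact: cvg_cst.
  by move=> /cvgr_lt; apply; lra.
move=> /near_ball_norm[s s0 Hs].
pose e1 := Num.min (s / 2) 1.
have e10 : 0 < e1 by rewrite lt_min ltr01 andbT divr_gt0.
have [r r0 Hr] := Hu e1 e10.
pose C := `|u| + 1; have C0 : 0 < C by rewrite ltr_wpDl.
(* Near [u] the form is below [k / 2], so the quadratic term is below [t^2 k / 4]; a Taylor error of
   at most [- t^2 k / 8] leaves [psi] below [t^2 k / 8 < 0]. *)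
have e0 : 0 < - k / (8 * C ^+ 2).
  by rewrite divr_gt0 ?oppr_gt0 // mulr_gt0 // exprn_gt0.
have [q q0 Hq] := near_ball_norm (filterI psi0 (taylor2 Hg HN e0)).
pose t := Num.min (r / 2) (q / (2 * C)).
have t0 : 0 < t by rewrite lt_min !divr_gt0 // mulr_gt0.
have tr : t < r.
  by rewrite (@le_lt_trans _ _ (r / 2)) ?ge_min ?lexx // ltr_pdivrMr // ltr_pMr // ltr1n.
have tq : t * C < q.
  rewrite (@le_lt_trans _ _ (q / (2 * C) * C)) //.
    by rewrite ler_wpM2r ?(ltW C0) // ge_min lexx orbT.
  have -> : q / (2 * C) * C = q / 2 by field; rewrite lt0r_neq0.
  by rewrite ltr_pdivrMr // ltr_pMr // ltr1n.
have [|u' Mu' uu'] := Hr t; first by rewrite t0.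
have u's : `|u' - u| < s.
  apply: le_lt_trans uu' _.
  by rewrite (@le_lt_trans _ _ (s / 2)) ?ge_min ?lexx // ltr_pdivrMr // ltr_pMr // ltr1n.
have u'C : `|u'| <= C.
  rewrite -[u'](subrK u) (le_trans (ler_normD _ _)) // /C addrC lerD2l.
  by apply: le_trans uu' _; rewrite ge_min lexx orbT.
have xu : x + t *: u' - x = t *: u' by rewrite addrC addKr.
have [|/(_ Mu') p0 T] := Hq (x + t *: u').
  rewrite xu normrZ gtr0_norm //; apply: le_lt_trans tq.
  by rewrite ler_wpM2l ?(ltW t0).
have K := Hs _ u's.
move: T; rewrite xu gx dotv0 psix !subr0 -scalemxAl !dotvZl !dotvZr normrZ.
rewrite gtr0_norm // exprMn.
have H : - k / (8 * C ^+ 2) * (t ^+ 2 * `|u'| ^+ 2) <= t ^+ 2 * (- k / 8).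
  have -> : t ^+ 2 * (- k / 8) = - k / (8 * C ^+ 2) * (t ^+ 2 * C ^+ 2).
    by field; rewrite lt0r_neq0.
  rewrite ler_wpM2l ?(ltW e0) // ler_wpM2l ?sqr_ge0 //.
  by rewrite ler_sqr ?nnegrE // ltW.
move=> /le_trans /(_ H); rewrite ler_norml => /andP[_].
have t2 : 0 < t ^+ 2 by rewrite exprn_gt0.
have : t ^+ 2 * dotv (u' *m N) u' < t ^+ 2 * (k / 2) by rewrite ltr_pM2l.
have : t ^+ 2 * k < 0 by rewrite pmulr_rlt0.
move: p0; move: (dotv _ _) (psi _) => a b.
rewrite expr2; lra.
Qed.

(** At points of [M] the quotient tends to the quadratic form whatever [w] is, since [L] has zero
    gradient at [x]; off [M] it is [+oo]. The only finite value is thus the form itself, attained at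
    the given [w]. It is used for the Lagrangian on the manifold and for the envelope on the whole
    space. *)
Lemma second_variation_quad (f : 'rV[R]_d -> \bar R) (L : 'rV[R]_d -> R) g Q M x u :
  (forall z, f z != -oo%E) ->
  (\forall y \near x, has_grad L y (g y)) -> g x = 0 -> has_jac g x Q ->
  M x -> (\forall z \near x, M z -> f z = (L z)%:E) ->
  (exists w, forall e, 0 < e -> exists2 r, 0 < r & forall t, 0 < t < r ->
    exists2 w', M (x + t *: u + (2^-1 * t ^+ 2) *: w') & `|w' - w| <= e) ->
  second_variation f M x u = (dotv (u *m Q) u)%:E.
Proof.
move=> fN Hg gx HQ Mx fL [w0 Hw0].
set q := dotv (u *m Q) u.
pose pt (p : R * 'rV[R]_d) := x + p.1 *: u + (2^-1 * p.1 ^+ 2) *: p.2.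
pose phi p := ((restrict_to f M (pt p) - restrict_to f M x)
  * ((2^-1 * p.1 ^+ 2)^-1)%:E)%E.
have rx : restrict_to f M x = (L x)%:E.
  by rewrite /restrict_to asboolT // adde0 (nbhs_singleton fL).
have V w (e : R) : 0 < e -> \forall p \near filter_prod (0 : R)^'+ (nbhs w),
    (M (pt p) -> exists2 r : R, phi p = r%:E & `|r - q| <= e) /\
    (~ M (pt p) -> phi p = +oo%E).
  move=> e0.
  pose k (p : R * 'rV[R]_d) := u + (2^-1 * p.1) *: p.2.
  have ptE p : pt p = x + p.1 *: k p.
    rewrite /pt /k; have -> : 2^-1 * p.1 ^+ 2 = p.1 * (2^-1 * p.1) by ring.
    by rewrite scalerDr scalerA addrA.
  have p1 : (p.1 : R^o) @[p --> filter_prod (0 : R)^'+ (nbhs w)] --> (0 : R^o).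
    exact: cvg_trans cvg_fst cvg_at_right0.
  have p2 : p.2 @[p --> filter_prod (0 : R)^'+ (nbhs w)] --> w.
    exact: cvg_snd.
  have kc : k p @[p --> filter_prod (0 : R)^'+ (nbhs w)] --> u.
    exact: cvg_half_line p1 p2.
  pose N := `|u| + 1; have N0 : 0 < N by rewrite ltr_wpDl.
  have kN : \forall p \near filter_prod (0 : R)^'+ (nbhs w), `|k p| <= N.
    have /cvgrPdist_le /(_ 1 ltr01) := kc; apply: filterS => p H.
    rewrite -[k p](subrK u) (le_trans (ler_normD _ _)) // /N addrC lerD2l.
    by rewrite distrC.
  have e'0 : 0 < e / (4 * N ^+ 2) by rewrite divr_gt0 // mulr_gt0 // exprn_gt0.
  have T := taylor2 Hg HQ e'0.
  have Hq : \forall p \near filter_prod (0 : R)^'+ (nbhs w),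
      `|q - dotv (k p *m Q) (k p)| <= e / 2.
    have : (dotv (k p *m Q) (k p) : R^o) @[p --> filter_prod (0 : R)^'+ (nbhs w)]
        --> (q : R^o).
      apply: cvg_dotv => //; apply: cvg_mulmx => //; exact: cvg_cst.
    by move=> /cvgrPdist_le; apply; rewrite divr_gt0.
  have P0 : \forall p \near filter_prod (0 : R)^'+ (nbhs w), 0 < p.1.
    exact: (@cvg_fst _ _ (0 : R)^'+ (nbhs w) _ [set t | 0 < t] (nbhs_right_gt _)).
  near=> p.
  have kpN : `|k p| <= N by near: p.
  have qp : `|q - dotv (k p *m Q) (k p)| <= e / 2 by near: p.
  have p0 : 0 < p.1 by near: p.
  have fp : M (pt p) -> f (pt p) = (L (pt p))%:E.
    by rewrite ptE; near: p; exact: (cvg_line p1 kc fL).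
  have Tp : `|L (pt p) - L x - dotv (pt p - x) (g x) -
      2^-1 * dotv ((pt p - x) *m Q) (pt p - x)|
      <= e / (4 * N ^+ 2) * `|pt p - x| ^+ 2.
    by rewrite ptE; near: p; exact: (cvg_line p1 kc T).
  have t2 : 0 < 2^-1 * p.1 ^+ 2 by rewrite mulr_gt0 // exprn_gt0.
  rewrite /phi rx; split=> Mp; last first.
    rewrite /restrict_to asboolF // addey // addye // gt0_mulye // lte_fin.
    by rewrite invr_gt0.
  rewrite /restrict_to asboolT // adde0 (fp Mp).
  exists ((L (pt p) - L x) * (2^-1 * p.1 ^+ 2)^-1) => //.
  move: Tp; rewrite gx dotv0 subr0.
  have -> : pt p - x = p.1 *: k p by rewrite ptE addrC addKr.
  rewrite -scalemxAl !dotvZl !dotvZr normrZ gtr0_norm // exprMn.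
  have kN2 : e / (4 * N ^+ 2) * (p.1 ^+ 2 * `|k p| ^+ 2)
      <= 2^-1 * p.1 ^+ 2 * (e / 2).
    have -> : 2^-1 * p.1 ^+ 2 * (e / 2)
        = e / (4 * N ^+ 2) * (p.1 ^+ 2 * N ^+ 2).
      by field; rewrite lt0r_neq0.
    rewrite ler_wpM2l ?(ltW e'0) // ler_wpM2l ?sqr_ge0 //.
    by rewrite ler_sqr ?nnegrE // ltW.
  move=> /le_trans /(_ kN2) TT.
  rewrite -(ler_pM2l t2) -[X in X * `|_|](gtr0_norm t2) -normrM.
  have -> : 2^-1 * p.1 ^+ 2 * ((L (pt p) - L x) / (2^-1 * p.1 ^+ 2) - q)
      = L (pt p) - L x - 2^-1 * p.1 ^+ 2 * q.
    by field; rewrite lt0r_neq0.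
  have {}qp : `|2^-1 * p.1 ^+ 2 * (q - dotv (k p *m Q) (k p))|
      <= 2^-1 * p.1 ^+ 2 * (e / 2).
    by rewrite normrM (gtr0_norm t2) ler_pM2l.
  move: TT qp; move: (dotv _ _) (L _) (L _) => a b c.
  rewrite !ler_norml => /andP[a1 a2] /andP[b1 b2].
  by apply/andP; split; move: a1 a2 b1 b2; rewrite expr2; lra.
have low w : (q%:E <= parabolic_subderivative (restrict_to f M) x u w)%E.
  rewrite /parabolic_subderivative limf_einfE.
  apply/lee_addgt0Pr => e e0; rewrite -leeBlDr //.
  apply: (@le_trans _ _ (ereal_inf (phi @` [set p |
    (M (pt p) -> exists2 r : R, phi p = r%:E & `|r - q| <= e) /\
    (~ M (pt p) -> phi p = +oo%E)]))).
    apply: le_ereal_inf_tmp => _ [p [p1 p2] <-].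
    have [/p1[r -> ]|/p2 ->] := pselect (M (pt p)); last exact: leey.
    by rewrite -EFinB lee_fin ler_norml => /andP[? _]; lra.
  by apply: ereal_sup_ubound; eexists; [exact: (V w e e0)|].
have high w : (forall A, filter_prod (0 : R)^'+ (nbhs w) A ->
      exists2 p, A p & M (pt p)) ->
    (parabolic_subderivative (restrict_to f M) x u w <= q%:E)%E.
  move=> H; rewrite /parabolic_subderivative limf_einfE.
  apply: ge_ereal_sup => _ [A FA <-].
  apply/lee_addgt0Pr => e e0.
  have [p [Ap [p1 _]] Mp] := H _ (filterI FA (V w e e0)).
  have [r rE rq] := p1 Mp.
  apply: (@le_trans _ _ (phi p)); first by apply: ereal_inf_lbound; exists p.
  by rewrite rE -EFinD lee_fin; move: rq; rewrite ler_norml => /andP[_]; lra.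
(* Either parabolas of coefficient near [w] meet [M] for arbitrarily small [t], and the lower limit
   is [q], or a whole neighbourhood misses [M] and the quotient is [+oo] there. *)
have dich w : parabolic_subderivative (restrict_to f M) x u w = q%:E \/
    parabolic_subderivative (restrict_to f M) x u w = +oo%E.
  have [H|/existsNP[A /not_implyP[FA HA]]] :=
    pselect (forall A, filter_prod (0 : R)^'+ (nbhs w) A ->
      exists2 p, A p & M (pt p)).
    by left; apply/eqP; rewrite eq_le low high.
  right; rewrite /parabolic_subderivative limf_einfE.
  apply/eqP; rewrite -leye_eq.
  have FV := filterI FA (V w 1 ltr01).
  apply: (@le_trans _ _ (ereal_inf (phi @` (A `&` [set p |
    (M (pt p) -> exists2 r : R, phi p = r%:E & `|r - q| <= 1) /\
    (~ M (pt p) -> phi p = +oo%E)])))).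
    apply: le_ereal_inf_tmp => _ [p [Ap [_ p2]] <-].
    by rewrite p2 // => Mp; apply: HA; exists p.
  by apply: ereal_sup_ubound; eexists; [exact: FV|].
have acc A : filter_prod (0 : R)^'+ (nbhs w0) A -> exists2 p, A p & M (pt p).
  move=> [[A1 A2] /= [A1r A2w] sub].
  have [r1 r10 Hr1] := near_at_right A1r.
  have [r2 r20 Hr2] := near_ball_norm A2w.
  have [r r0 Hr] := Hw0 (r2 / 2) (divr_gt0 r20 (ltr0n _ 2)).
  pose t := Num.min r1 r / 2.
  have m0 : 0 < Num.min r1 r by rewrite lt_min r10.
  have t0 : 0 < t by rewrite divr_gt0.
  have tm : t < Num.min r1 r by rewrite ltr_pdivrMr // ltr_pMr // ltr1n.
  move: tm; rewrite lt_min => /andP[tr1 tr].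
  have [|w' Mw' w'w] := Hr t; first by rewrite t0.
  exists (t, w') => //; apply: sub; split=> /=; first by apply: Hr1; rewrite t0.
  by apply: Hr2; apply: le_lt_trans w'w _; rewrite ltr_pdivrMr // ltr_pMr // ltr1n.
have Sq : [set c | c \is a fin_num /\ exists w,
    parabolic_subderivative (restrict_to f M) x u w = c] q%:E.
  by split=> //; exists w0; apply/eqP; rewrite eq_le low high.
rewrite /second_variation.
have [+ [w wE]] := xgetPex +oo%E (ex_intro _ _ Sq).
by have [] := dich w; rewrite wE => ->.
Unshelve. all: by end_near. Qed.

End SecondVariation.

(** * The stationarity system *)

Section JacobianCalculus.
Context {R : realType}.

Lemma has_jac_eq {n p : nat} (f : 'rV[R]_n -> 'rV[R]_p) x A A' :
  has_jac f x A -> A = A' -> has_jac f x A'.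
Proof. by move=> + <-. Qed.

Lemma has_jac_comp {n p q : nat} (f : 'rV[R]_n -> 'rV[R]_p)
    (f' : 'rV[R]_p -> 'rV[R]_q) x A A' :
  has_jac f x A -> has_jac f' (f x) A' -> has_jac (fun y => f' (f y)) x (A *m A').
Proof.
move=> H1 H2; rewrite /has_jac; have := @is_diff_comp _ _ _ _ _ _ _ _ _ H1 H2.
by congr (is_diff x _ _); apply/funext => v /=; rewrite mulmxA.
Qed.

Lemma has_jac_scale {n p : nat} (a : 'rV[R]_n -> R) (f : 'rV[R]_n -> 'rV[R]_p)
    x c A :
  has_grad a x c -> has_jac f x A ->
  has_jac (fun y => a y *: f y) x (a x *: A + c^T *m f x).
Proof.
move=> Ha /has_jac_rowP Hf; apply/has_jac_rowP => j.
under eq_fun do rewrite mxE.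
apply: has_grad_eq (has_gradM Ha (Hf j)) _.
by apply/rowP => i; rewrite !mxE big_ord1 !mxE [X in _ + X]mulrC.
Qed.

Lemma has_jac_sum {n p : nat} (I : Type) (s : seq I)
    (f : I -> 'rV[R]_n -> 'rV[R]_p) x (A : I -> 'M[R]_(n, p)) :
  (forall i, has_jac (f i) x (A i)) ->
  has_jac (fun y => \sum_(i <- s) f i y) x (\sum_(i <- s) A i).
Proof.
move=> H; elim: s => [|i s IH].
  by rewrite big_nil; under eq_fun do rewrite big_nil; exact: has_jac_cst.
rewrite big_cons; under eq_fun do rewrite big_cons.
exact: has_jacD.
Qed.

Lemma has_jac_row_mx {n p q : nat} (f : 'rV[R]_n -> 'rV[R]_p)
    (f' : 'rV[R]_n -> 'rV[R]_q) x A A' :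
  has_jac f x A -> has_jac f' x A' ->
  has_jac (fun y => row_mx (f y) (f' y)) x (row_mx A A').
Proof.
move=> /has_jac_rowP H /has_jac_rowP H'; apply/has_jac_rowP => k.
case: (split_ordP k) => j ->.
  under eq_fun do rewrite row_mxEl.
  by apply: has_grad_eq (H j) _; apply/rowP => i; rewrite 2![RHS]mxE row_mxEl !mxE.
under eq_fun do rewrite row_mxEr.
by apply: has_grad_eq (H' j) _; apply/rowP => i; rewrite 2![RHS]mxE row_mxEr !mxE.
Qed.

Lemma mul_col_mx1 {p q : nat} (z : 'rV[R]_(p + q)) :
  z *m col_mx 1%:M 0 = lsubmx z.
Proof. by rewrite -{1}[z]hsubmxK mul_row_col mulmx1 mulmx0 addr0. Qed.

Lemma has_jac_lsubmx {p q : nat} (z : 'rV[R]_(p + q)) :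
  has_jac lsubmx z (col_mx 1%:M 0).
Proof.
have := has_jac_mulmxr (col_mx 1%:M 0 : 'M[R]_(p + q, p)) z.
by under eq_fun do rewrite mul_col_mx1.
Qed.

Lemma has_grad_sqr_norm {n : nat} (x : 'rV[R]_n) :
  has_grad (fun z => dotv (z - x) (z - x)) x 0.
Proof.
apply/has_gradP => e e0.
have N0 : 0 < e / n.+1%:R by rewrite divr_gt0.
apply: (ball_norm_near N0) => z; rewrite ltr_pdivlMr // => zx.
rewrite subrr dot0v dotv0 !subr0 (le_trans (norm_dotv _ _)) //.
rewrite ler_wpM2r //; apply: le_trans (ltW zx).
by rewrite mulrC ler_wpM2l // ler_nat.
Qed.

Lemma continuous_row_mx {T : topologicalType} {p q : nat} (f : T -> 'rV[R]_p)
    (f' : T -> 'rV[R]_q) (t : T) :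
  {for t, continuous f} -> {for t, continuous f'} ->
  {for t, continuous (fun s => row_mx (f s) (f' s))}.
Proof.
move=> fc fc'; apply: (@cvg_mxP R T (nbhs t) _ _ _ _ (row_mx (f t) (f' t))).2.
move=> i j; case: (split_ordP j) => k ->.
  under eq_fun do rewrite row_mxEl.
  by rewrite row_mxEl; apply: ((cvg_mxP _ _).1 fc).
under eq_fun do rewrite row_mxEr.
by rewrite row_mxEr; apply: ((cvg_mxP _ _).1 fc').
Qed.

(* Stands in for the implicit function theorem: the solution Y is already known
   to exist and to be continuous, only its differentiability is at stake. *)
Lemma has_jac_implicit {n p : nat} (Phi : 'rV[R]_n -> 'rV[R]_n)
    (Y T : 'rV[R]_p -> 'rV[R]_n) x D K :
  has_jac T x D -> has_jac Phi (Y x) K -> K \in unitmx ->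
  {for x, continuous Y} -> (\forall z \near x, Phi (Y z) = T z) ->
  has_jac Y x (D *m invmx K).
Proof.
move=> /has_jacP HT /has_jacP HPhi Ku Yc HYT; apply/has_jacP => e e0.
pose k := n%:R * `|invmx K| + 1; have k0 : 0 < k by rewrite ltr_wpDl // mulr_ge0.
have kP (w : 'rV[R]_n) : `|w *m invmx K| <= k * `|w|.
  rewrite (le_trans (norm_mulmx _ _)) // mulrAC ler_wpM2r //.
  by rewrite lerDl.
pose t := p%:R * `|D| + 1; have t0 : 0 < t by rewrite ltr_wpDl // mulr_ge0.
have tP (w : 'rV[R]_p) : `|w *m D| <= (t - 1) * `|w|.
  by rewrite (le_trans (norm_mulmx _ _)) // mulrAC /t addrK.
(* The first bound allows the term in [|dY|] to be absorbed on the left, giving [|dY| <= 2 k t |b|];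
   the second makes its final contribution [e / 2]. The other half comes from [e2], whose bound by 1
   accounts for the [+ 1] in [t]. *)
pose e1 := Num.min (2 * k)^-1 (e / (4 * k ^+ 2 * t)).
have e10 : 0 < e1.
  by rewrite lt_min invr_gt0 divr_gt0 // !mulr_gt0 // exprn_gt0.
pose e2 := Num.min 1 (e / (2 * k)).
have e20 : 0 < e2 by rewrite lt_min ltr01 divr_gt0 // mulr_gt0.
have Tn := HT _ e20.
have Pn : \forall z \near x, `|Phi (Y z) - Phi (Y x) - (Y z - Y x) *m K|
   <= e1 * `|Y z - Y x| by exact: Yc (HPhi _ e10).
have HYx := nbhs_singleton HYT.
apply: filterS (filterI (filterI Tn Pn) HYT) => z [[]].
move=> + + HYz; rewrite HYz HYx.
set b := z - x; set dT := T z - T x; set dY := Y z - Y x => H1 H2.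
clearbody b dT dY.
have E : dY - b *m (D *m invmx K)
    = ((dT - b *m D) - (dT - dY *m K)) *m invmx K.
  have aux (a u v : 'rV[R]_n) : (a - u) - (a - v) = v - u.
    by apply/rowP => i; rewrite !mxE; ring.
  by rewrite aux mulmxBl mulmxK // mulmxA.
have dTn : `|dT| <= t * `|b|.
  rewrite -[dT](subrK (b *m D)) (le_trans (ler_normD _ _)) //.
  have : e2 * `|b| <= 1 * `|b| by rewrite ler_wpM2r // ge_min lexx.
  by have := tP b; move: H1; lra.
have dYn : `|dY| <= 2 * k * t * `|b|.
  have dYE : dY = (dT - (dT - dY *m K)) *m invmx K.
    by rewrite opprB addrC subrK mulmxK.
  have : `|dY| <= k * (`|dT| + e1 * `|dY|).
    rewrite {1}dYE (le_trans (kP _)) // ler_wpM2l ?(ltW k0) //.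
    by rewrite (le_trans (ler_normB _ _)) // lerD2l.
  have : k * (e1 * `|dY|) <= 2^-1 * `|dY|.
    rewrite mulrA ler_wpM2r // -ler_pdivlMl //.
    by rewrite (@le_trans _ _ (2 * k)^-1) ?ge_min ?lexx // invfM mulrC.
  have : k * `|dT| <= k * (t * `|b|) by rewrite ler_wpM2l ?(ltW k0).
  lra.
rewrite E (le_trans (kP _)) //.
have B1 : e2 * `|b| <= e / (2 * k) * `|b|.
  by rewrite ler_wpM2r // ge_min lexx orbT.
have B2 : e1 * `|dY| <= e / (4 * k ^+ 2 * t) * (2 * k * t * `|b|).
  by rewrite ler_pM ?(ltW e10) // ge_min lexx orbT.
apply: (@le_trans _ _ (k * (e / (2 * k) * `|b| +
    e / (4 * k ^+ 2 * t) * (2 * k * t * `|b|)))).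
  rewrite ler_wpM2l ?(ltW k0) // (le_trans (ler_normB _ _)) // lerD //.
    exact: le_trans H1 B1.
  exact: le_trans H2 B2.
rewrite le_eqVlt; apply/orP; left; apply/eqP.
by field; rewrite !lt0r_neq0.
Qed.

End JacobianCalculus.

(** * The Karush-Kuhn-Tucker system and its bordered Hessian *)

Section KKT.
Context {R : realType} {d m : nat} (dF : 'rV[R]_d -> 'rV[R]_d)
  (hF : 'rV[R]_d -> 'M[R]_d) (G : 'I_m -> 'rV[R]_d -> R)
  (g : 'I_m -> 'rV[R]_d -> 'rV[R]_d) (h : 'I_m -> 'rV[R]_d -> 'M[R]_d) (c : R).

Definition kkt (z : 'rV[R]_(d + m)) : 'rV[R]_(d + m) :=
  row_mx (lagrangian_grad dF g (rsubmx z) (lsubmx z) + c *: lsubmx z)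
    (\row_j G j (lsubmx z)).

(** Rows are indexed by the unknowns (point, multiplier) and columns by the equations, as Jacobians
    act on the right. *)
Definition kkt_jac (z : 'rV[R]_(d + m)) : 'M[R]_(d + m) :=
  block_mx (lagrangian_hess hF h (rsubmx z) (lsubmx z) + c%:M)
    (jac g (lsubmx z)) (jac g (lsubmx z))^T 0.

Lemma kkt_has_jac z :
  has_jac dF (lsubmx z) (hF (lsubmx z)) ->
  (forall j, has_grad (G j) (lsubmx z) (g j (lsubmx z))) ->
  (forall j, has_jac (g j) (lsubmx z) (h j (lsubmx z))) ->
  has_jac kkt z (kkt_jac z).
Proof.
move=> H1 H2 H3; set y := lsubmx z in H1 H2 H3 *; set l := rsubmx z.
pose P : 'M[R]_(d + m, d) := col_mx 1%:M 0.
have HP : has_jac lsubmx z P by exact: has_jac_lsubmx.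
have Hl j : has_grad (fun z : 'rV[R]_(d + m) => (rsubmx z) 0 j) z
    (delta_mx 0 (rshift d j)).
  have := has_grad_coord (rshift d j) z.
  by under [X in _ -> has_grad X _ _]eq_fun do rewrite mxE.
have HG : has_jac (fun z : 'rV[R]_(d + m) => \row_j G j (lsubmx z)) z (P *m jac g y).
  apply/has_jac_rowP => j; under eq_fun do rewrite mxE.
  apply: has_grad_eq (has_grad_comp HP (H2 j)) _.
  by rewrite trmx_mul row_mul; congr (_ *m _); apply/rowP => i; rewrite !mxE.
have HL := has_jacD (has_jacD (has_jac_comp HP H1)
  (has_jac_sum (index_enum 'I_m) (fun j => has_jac_scale (Hl j) (has_jac_comp HP (H3 j)))))
  (has_jacZ c HP).
apply: has_jac_eq (has_jac_row_mx HL HG) _.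
apply: mulmx_inj => v; rewrite -[in RHS](hsubmxK v).
rewrite /kkt_jac mul_row_block mulmx0 addr0 mul_mx_row; congr row_mx; last first.
  by rewrite mulmxA mul_col_mx1.
have vP : v *m P = lsubmx v by exact: mul_col_mx1.
have S : v *m (\sum_i (rsubmx z 0 i *: (P *m h i y)
      + (delta_mx 0 (rshift d i))^T *m g i (lsubmx z)))
    = lsubmx v *m (\sum_i l 0 i *: h i y) + \sum_i rsubmx v 0 i *: g i y.
  rewrite !mulmx_sumr -big_split; apply: eq_bigr => j _ /=.
  rewrite mulmxDr -!scalemxAr (mulmxA v P) vP; congr (_ + _).
  rewrite mulmxA [v *m _]mx11_scalar mul_scalar_mx; congr (_ *: _).
  by rewrite -/(dotv v _) dotvC dotv_delta mxE.
rewrite !mulmxDr S (mulmxA v P) -scalemxAr vP mul_mx_scalar.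
rewrite jac_mul -/y -/l.
by apply/rowP => i; rewrite !mxE; ring.
Qed.

(** If [(u, w)] is in the kernel then [u] is tangent, and pairing the first equation with [u] kills
    the multiplier term; positivity forces [u = 0], then [B] forces [w = 0]. *)
Lemma kkt_jac_unit z (B : 'M[R]_(m, d)) : B *m jac g (lsubmx z) = 1%:M ->
  (forall u, u *m jac g (lsubmx z) = 0 -> u != 0 ->
    0 < dotv (u *m (lagrangian_hess hF h (rsubmx z) (lsubmx z) + c%:M)) u) ->
  kkt_jac z \in unitmx.
Proof.
move=> BJ pos; rewrite -row_free_unit -kermx_eq0; apply/eqP/row_matrixP => i.
rewrite row0; set v := row i _.
have : v *m kkt_jac z = 0 by rewrite -row_mul mulmx_ker row0.
clearbody v; rewrite -[v]hsubmxK /kkt_jac mul_row_block mulmx0 addr0.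
rewrite -[RHS]hsubmxK !linear0 => /eq_row_mx[].
set u := lsubmx v; set w := rsubmx v => E uJ.
have u0 : u = 0.
  apply/eqP; apply: contraT => un0; have := pos u uJ un0.
  have -> : u *m (lagrangian_hess hF h (rsubmx z) (lsubmx z) + c%:M)
      = - (w *m (jac g (lsubmx z))^T) by apply/eqP; rewrite -addr_eq0 E.
  have : dotv (w *m (jac g (lsubmx z))^T) u = 0.
    by rewrite /dotv -mulmxA -trmx_mul uJ trmx0 mulmx0 mxE.
  by rewrite dotvNl => ->; rewrite oppr0 ltxx.
have w0 : w = 0.
  rewrite -[w]mulmx1 -trmx1 -BJ trmx_mul mulmxA.
  by move: E; rewrite u0 mul0mx add0r => ->; rewrite mul0mx.
by rewrite u0 w0 row_mx0.
Qed.

Lemma continuous_kkt_jac {T : topologicalType} (Y : T -> 'rV[R]_(d + m)) t :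
  {for t, continuous Y} -> {for lsubmx (Y t), continuous hF} ->
  (forall j, {for lsubmx (Y t), continuous (g j)}) ->
  (forall j, {for lsubmx (Y t), continuous (h j)}) ->
  {for t, continuous (fun s => kkt_jac (Y s))}.
Proof.
move=> Yc hFc gc hc.
have lc : (fun s => lsubmx (Y s)) @ nbhs t --> lsubmx (Y t).
  apply/cvg_mxP => i j; rewrite mxE; under eq_fun do rewrite mxE.
  exact: ((cvg_mxP _ _).1 Yc i (lshift m j)).
have rc : (fun s => rsubmx (Y s)) @ nbhs t --> rsubmx (Y t).
  apply/cvg_mxP => i j; rewrite mxE; under eq_fun do rewrite mxE.
  exact: ((cvg_mxP _ _).1 Yc i (rshift d j)).
have jc : (fun s => jac g (lsubmx (Y s))) @ nbhs t --> jac g (lsubmx (Y t)).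
  apply/cvg_mxP => i j; rewrite mxE; under eq_fun do rewrite mxE.
  exact: ((cvg_mxP _ _).1 (cvg_comp _ _ lc (gc j)) 0 i).
apply: (@cvg_mxP R T (nbhs t) _ _ _ (fun s => kkt_jac (Y s)) (kkt_jac (Y t))).2.
move=> i j; rewrite /kkt_jac.
case: (split_ordP i) => i' ->; case: (split_ordP j) => j' ->.
- under eq_fun do rewrite block_mxEul.
  rewrite block_mxEul; apply: ((cvg_mxP _ _).1 _ i' j').
  apply: cvgD; last exact: cvg_cst.
  apply: cvgD; first exact: cvg_comp _ _ lc hFc.
  apply/cvg_mxP => k l; rewrite summxE; under eq_fun do rewrite summxE.
  apply: cvg_sumr => q; rewrite mxE; under eq_fun do rewrite mxE.
  apply: cvgM; first exact: ((cvg_mxP _ _).1 rc 0 q).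
  exact: ((cvg_mxP _ _).1 (cvg_comp _ _ lc (hc q)) k l).
- under eq_fun do rewrite block_mxEur.
  by rewrite block_mxEur; apply: ((cvg_mxP _ _).1 jc).
- under eq_fun do rewrite block_mxEdl mxE.
  by rewrite block_mxEdl mxE; apply: ((cvg_mxP _ _).1 jc).
- under eq_fun do rewrite block_mxEdr.
  by rewrite block_mxEdr; exact: cvg_cst.
Qed.

End KKT.

(** * Active manifolds *)

Section ActiveManifold.
Context {R : realType} {d : nat}.
Implicit Types (f : 'rV[R]_d -> \bar R) (M : set 'rV[R]_d) (x y z u v : 'rV[R]_d).

(** First-order counterpart of [tangent_nonneg]: a minimum over [M] has nonnegative slope in every
    direction approximable in [M]. *)
Lemma tangent_first_order (phi : 'rV[R]_d -> R) c M x u :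
  has_grad phi x c -> (\forall z \near x, M z -> phi x <= phi z) ->
  (forall e, 0 < e -> exists2 r, 0 < r & forall t, 0 < t < r ->
    exists2 u', M (x + t *: u') & `|u' - u| <= e) ->
  0 <= dotv u c.
Proof.
move=> /has_gradP Hg phix Hu.
apply/ler_addgt0Pr => e e0.
pose C := `|u| + 1; have C0 : 0 < C by rewrite ltr_wpDl.
pose D := d%:R * `|c| + 1; have D0 : 0 < D by rewrite ltr_wpDl // mulr_ge0.
have e1 : 0 < e / (2 * C) by rewrite divr_gt0 // mulr_gt0.
have [q q0 Hq] := near_ball_norm (filterI phix (Hg _ e1)).
pose e2 := Num.min 1 (e / (2 * D)).
have e20 : 0 < e2 by rewrite lt_min ltr01 divr_gt0 // mulr_gt0.
have [r r0 Hr] := Hu e2 e20.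
pose t := Num.min r (q / C) / 2.
have m0 : 0 < Num.min r (q / C) by rewrite lt_min r0 divr_gt0.
have t0 : 0 < t by rewrite divr_gt0.
have tm : t < Num.min r (q / C) by rewrite ltr_pdivrMr // ltr_pMr // ltr1n.
move: tm; rewrite lt_min => /andP[tr tq].
have [|u' Mu' uu'] := Hr t; first by rewrite t0.
have u'C : `|u'| <= C.
  rewrite -[u'](subrK u) (le_trans (ler_normD _ _)) // /C addrC lerD2l.
  by apply: le_trans uu' _; rewrite ge_min lexx.
have xu : x + t *: u' - x = t *: u' by rewrite addrC addKr.
have [|/(_ Mu') p0] := Hq (x + t *: u').
  rewrite xu normrZ gtr0_norm //; apply: le_lt_trans (_ : t * C < q).
    by rewrite ler_wpM2l ?(ltW t0).
  by rewrite -ltr_pdivlMr.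
rewrite xu dotvZl normrZ gtr0_norm // => T.
have {}T : - dotv u' c <= e / 2.
  rewrite -(ler_pM2l t0); move: T; rewrite ler_norml => /andP[_].
  have : e / (2 * C) * (t * `|u'|) <= t * (e / 2).
    have -> : t * (e / 2) = e / (2 * C) * (t * C) by field; rewrite lt0r_neq0.
    by rewrite ler_wpM2l ?(ltW e1) // ler_wpM2l ?(ltW t0).
  by move: p0; lra.
have : dotv (u' - u) c <= e / 2.
  rewrite (le_trans (ler_norm _)) // (le_trans (norm_dotv _ _)) //.
  rewrite mulrAC; apply: (@le_trans _ _ (D * (e / (2 * D)))).
    rewrite ler_pM ?mulr_ge0 //; first by rewrite lerDl.
    by apply: le_trans uu' _; rewrite ge_min lexx orbT.
  by rewrite le_eqVlt; apply/orP; left; apply/eqP; field; rewrite lt0r_neq0.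
by rewrite dotvDl dotvNl; lra.
Qed.

Lemma tangent_annihilates (phi : 'rV[R]_d -> R) c M x u :
  has_grad phi x c -> (\forall z \near x, M z -> phi z = phi x) ->
  (forall e, 0 < e -> exists2 r, 0 < r & forall t, 0 < t < r ->
    exists2 u', M (x + t *: u') & `|u' - u| <= e) ->
  dotv u c = 0.
Proof.
move=> Hg phix Hu; apply/eqP; rewrite eq_le.
rewrite (tangent_first_order Hg _ Hu) ?andbT; last first.
  by apply: filterS phix => z H /H ->.
have Hg' := has_gradZ (-1) Hg.
rewrite -oppr_ge0 -dotvNr -scaleN1r.
apply: (tangent_first_order Hg' _ Hu).
by apply: filterS phix => z H /H ->.
Qed.

Lemma full_rank_right_inverse {m : nat} (A : 'M[R]_(d, m)) : \rank A = m ->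
  exists B, B *m A = 1%:M.
Proof. by move=> rA; apply/row_fullP; rewrite /row_full rA. Qed.

Lemma defining_map_regular r M x U (G : 'rV[R]_d -> 'rV[R]_(d - r)) : M x ->
  defining_map 1 M x U G ->
  exists2 C, 0 < C & \forall z \near x,
    exists2 z', M z' & `|z' - z| <= C * `|G z|.
Proof.
move=> Mx [Ux GC rG MU].
have [B BJ] := full_rank_right_inverse rG.
have GJ := Ck_on1_C1_near (conj openT I : open_nbhs x setT) GC.
apply: metric_regularity GJ BJ Mx _.
apply: filterS (open_nbhs_nbhs Ux) => z Uz; split=> [Mz|Gz].
  by have : (M `&` U) z by []; rewrite MU => -[].
by have [] : (M `&` U) z by rewrite MU.
Qed.

Lemma defining_map_kernel r M x U (G : 'rV[R]_d -> 'rV[R]_(d - r)) u : M x ->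
  defining_map 1 M x U G -> u *m 'J G x = 0 ->
  forall e, 0 < e -> exists2 t0, 0 < t0 & forall t, 0 < t < t0 ->
    exists2 u', M (x + t *: u') & `|u' - u| <= e.
Proof.
move=> Mx HG uJ; have [C C0 MR] := defining_map_regular Mx HG.
case: HG => Ux [GD _] _ MU.
have Gx : G x = 0.
  have : (M `&` U) x by split=> //; exact: (nbhs_singleton (open_nbhs_nbhs Ux)).
  by rewrite MU => -[].
exact: tangent_curve C0 MR (differentiable_has_jac (GD x I)) Gx uJ.
Qed.

Section Model.
Context {m : nat} f M x F dF hF (G : 'I_m -> 'rV[R]_d -> R) g h B
  (mod : smooth_model f M x F dF hF G g h B).

(** Approximability in [M] does not mention equations. Together with [defining_map_kernel] this
    shows that every C^1 defining map has its kernel inside that of the model. *)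
Lemma model_ker_of_tangent u :
  (forall e, 0 < e -> exists2 r, 0 < r & forall t, 0 < t < r ->
    exists2 u', M (x + t *: u') & `|u' - u| <= e) ->
  u *m jac g x = 0.
Proof.
move=> Hu; apply/rowP => j; rewrite mul_jac mxE.
have [Hg _ _] := nbhs_singleton (model_G mod j).
have Gx : G j x = 0 by apply: (nbhs_singleton (model_M mod)).1; exact: model_x mod.
apply: tangent_annihilates Hg _ Hu.
by rewrite Gx; apply: filterS (model_M mod) => z H /H.
Qed.

End Model.

Lemma active_manifold_model f M x : active_manifold 2 f M x ->
  exists m F dF hF (G : 'I_m -> 'rV[R]_d -> R) g h B,
    smooth_model f M x F dF hF G g h B /\
    (forall u, tangent_space M x u <-> u *m jac g x = 0).
Proof.
move=> [Mx [U [Ux [r Hr] smooth _]]].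
have MUx : (M `&` U) x by split=> //; exact: (nbhs_singleton (open_nbhs_nbhs Ux)).
have [rd _ [U' [G HG]]] := Hr x MUx.
have [V [F [Vx FC fF]]] := smooth x MUx.
have [U'x GC rG MU'] := HG.
have [B BJ] := full_rank_right_inverse rG.
pose Gj j y := G y 0 j.
have GjC j : Ck_on 2 setT (Gj j : _ -> R^o) by exact: Ck_on_coord.
have GD y : differentiable G y by exact: GC.1.
have GJ y : jac (fun j => gradient (Gj j)) y = 'J G y.
  apply/matrixP => i j; rewrite mxE.
  have /has_jac_rowP /(_ j) H := differentiable_has_jac (GD y).
  have := has_grad_unique (differentiable_has_grad ((GjC j).1 y I)) H.
  by move=> ->; rewrite !mxE.
have mod : smooth_model f M x F (gradient F) (hessian_fun F) Gj
    (fun j => gradient (Gj j)) (fun j => hessian_fun (Gj j)) B.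
  split=> //.
  - exact: Ck_on2_C2_near Vx FC.
  - apply: filterS (filterI (open_nbhs_nbhs Ux) (open_nbhs_nbhs Vx)) => z [Uz Vz] Mz.
    exact: fF.
  - by move=> j; exact: Ck_on2_C2_near (conj openT I) (GjC j).
  - apply: filterS (filterI (open_nbhs_nbhs Ux) (open_nbhs_nbhs U'x)) => z [Uz U'z].
    split=> [Mz j|Gz].
      have : ((M `&` U) `&` U') z by [].
      by rewrite MU' /Gj => -[_ ->]; rewrite mxE.
    have : ((M `&` U) `&` U') z.
      by rewrite MU'; split=> //; apply/rowP => j; rewrite mxE; exact: Gz.
    by case=> -[].
  - by rewrite GJ.
exists (d - r)%N, F, (gradient F), (hessian_fun F), Gj.
exists (fun j => gradient (Gj j)), (fun j => hessian_fun (Gj j)), B.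
split=> // u; split.
  move=> [r' [U2 [G' [_ _ HG' uJ]]]].
  exact: (model_ker_of_tangent mod (defining_map_kernel Mx HG' uJ)).
(* [G] defines [M] intersected with [U], whereas the tangent space is taken for [M]; shrinking the
   neighbourhood reconciles the two. *)
rewrite GJ => uJ; exists r, (U `&` U'), G; split=> //; split=> //.
- by have [] := Ux; have [] := U'x; split; [exact: openI|split].
- exact: Ck_on_le.
- rewrite setIA MU'; apply/seteqP; split=> z /= [].
    move=> U'z Gz; split=> //; split=> //.
    have : ((M `&` U) `&` U') z by rewrite MU'.
    by case=> -[].
  by case.
Qed.

Lemma active_manifold_sharp k f M x : active_manifold k f M x ->
  exists2 c, 0 < c & \forall y \near x, ~ M y ->
    forall v, subdiff f y v -> c <= enorm v.
Proof.
move=> [_ [U [Ux _ _]]]; set S := [set e | _] => S0.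
(* The infimum is [+oo] when there is no subgradient off [M]; any positive constant then works, here
   1. *)
have [c c0 cS] : exists2 c : R, 0 < c & (c%:E <= ereal_inf S)%E.
  move: S0; case: (ereal_inf S) => [s|_|//]; last by exists 1 => //; exact: leey.
  by rewrite lte_fin => s0; exists s.
exists c => //; apply: filterS (open_nbhs_nbhs Ux) => y Uy My v fv.
rewrite -lee_fin; apply: le_trans cS _; apply: ereal_inf_lbound.
by exists y, v.
Qed.

End ActiveManifold.

(** * Smoothness of the proximal map *)

Section MultiplierFormula.
Context {R : realType} {d m : nat}.

(** [p] below is the projection of [w] onto the row space of [B] along the kernel of [J], and [a]
    does not see the difference. The formula is continuous in [a] and [J] while [B *m J] stays
    invertible, so one fixed [B] serves a whole neighbourhood. *)
Lemma multiplier_formula (J : 'M[R]_(d, m)) (B : 'M[R]_(m, d)) (a : 'rV[R]_d) :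
  B *m J \in unitmx -> (forall u, u *m J = 0 -> dotv u a = 0) ->
  a = a *m B^T *m invmx (B *m J)^T *m J^T.
Proof.
move=> BJu H; set b := RHS.
suff E w : dotv w a = dotv w b.
  by apply/rowP => i; rewrite -!dotv_delta E.
pose p := w *m J *m invmx (B *m J) *m B.
have pa : dotv w a = dotv p a.
  apply/eqP; rewrite -subr_eq0 -dotvNl -dotvDl; apply/eqP/H.
  by rewrite mulmxBl /p -!mulmxA mulVmx // mulmx1 subrr.
have bT : b^T = J *m invmx (B *m J) *m B *m a^T.
  by rewrite /b trmx_mul trmxK trmx_mul trmx_inv trmxK trmx_mul trmxK !mulmxA.
by rewrite pa /dotv bT /p !mulmxA.
Qed.

Lemma has_grad_sqr_dist (x y : 'rV[R]_d) :
  has_grad (fun z => dotv (z - x) (z - x)) y (2 *: (y - x)).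
Proof.
have H1 := has_grad_sqr_norm y.
have H2 := has_grad_dotv (2 *: (y - x)) y.
have := has_gradD (has_gradD H1 H2)
  (has_grad_cst (dotv (y - x) (y - x) - dotv y (2 *: (y - x))) y).
rewrite add0r addr0; congr has_grad; apply/funext => z.
have -> : z - x = (z - y) + (y - x) by rewrite addrA subrK.
rewrite -[in dotv z _](subrK y z); move: (z - y) (y - x) => a b.
by rewrite !dotv_lin (dotvC b a); ring.
Qed.

Lemma has_jac_sub (x y : 'rV[R]_d) : has_jac (fun z => z - x) y 1%:M.
Proof.
apply/has_jacP => e e0; near=> z.
by rewrite mulmx1 opprB addrA subrK subrr normr0 mulr_ge0 // ltW.
Unshelve. all: by end_near. Qed.

Lemma C2_near_sqr_dist c (x : 'rV[R]_d) :
  C2_near (fun z => c / 2 * dotv (z - x) (z - x)) (fun z => c *: (z - x))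
    (fun=> c%:M) x.
Proof.
near=> y; split; last exact: cst_continuous.
  apply: has_grad_eq (has_gradZ (c / 2) (has_grad_sqr_dist x y)) _.
  by rewrite scalerA divfK.
by rewrite -scalemx1; apply: has_jacZ; exact: has_jac_sub.
Unshelve. all: by end_near. Qed.

End MultiplierFormula.

Section ProxSmooth.
Context {R : realType} {d m : nat} (f : 'rV[R]_d -> \bar R) (rho mu : R)
  (x0 : 'rV[R]_d) (M : set 'rV[R]_d).
Context (f_gtNy : forall x, f x != -oo%E) (f_closed : closed_fun f)
  (rho_gt0 : 0 < rho) (f_wcvx : weakly_convex_with rho f)
  (x0_crit : critical f x0) (mu_gt0 : 0 < mu) (mu_lt : mu < rho^-1).
Context {F : 'rV[R]_d -> R} {dF hF} {G : 'I_m -> 'rV[R]_d -> R} {g h B}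
  (mod : smooth_model f M x0 F dF hF G g h B).
Context (sharp : exists2 c, 0 < c & \forall y \near x0, ~ M y ->
    forall v, subdiff f y v -> c <= enorm v).
Implicit Types (x y z u v : 'rV[R]_d).

Local Notation P := (prox mu f).
Local Notation v := (moreau_grad f mu).

Let P_fin x : f (P x) \is a fin_num.
Proof. exact: prox_fin rho_gt0 f_wcvx x0_crit mu_gt0 mu_lt x. Qed.

Let P_sub x : subdiff f (P x) (v x).
Proof.
apply: prox_subdiff => //.
exact: prox_setP rho_gt0 f_wcvx x0_crit mu_gt0 mu_lt x.
Qed.

Let P_x0 : P x0 = x0.
Proof. exact: prox_critical f_gtNy f_closed rho_gt0 f_wcvx x0_crit mu_gt0 mu_lt. Qed.

Lemma prox_continuous x : {for x, continuous P}.
Proof.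
have k0 := rho_mu_lt1 rho_gt0 mu_lt.
apply: (@cvgrPdist_lt _ _ _ (nbhs x) _ P (P x)).2 => e e0.
have N0 : 0 < (1 - rho * mu) * e / d.+1%:R by rewrite divr_gt0 // mulr_gt0.
apply: (ball_norm_near N0) => y; rewrite ltr_pdivlMr // => yx.
rewrite distrC -(ltr_pM2l k0); apply: le_lt_trans yx.
apply: (@le_trans _ _ ((1 - rho * mu) * enorm (P y - P x))).
  by rewrite ler_wpM2l ?(ltW k0) // norm_le_enorm.
apply: le_trans (prox_lip f_gtNy f_closed rho_gt0 f_wcvx x0_crit mu_gt0 mu_lt x y) _.
rewrite (le_trans (enorm_le_norm _)) // mulrC ler_wpM2l // ler_nat //.
Qed.

Let P_near (A : set 'rV[R]_d) : (\forall y \near x0, A y) ->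
  \forall x \near x0, A (P x).
Proof. by move=> H; have := @prox_continuous x0; apply; rewrite P_x0. Qed.

Lemma moreau_grad_continuous x : {for x, continuous v}.
Proof.
apply: (@cvgZ _ _ _ (nbhs x)); first exact: cvg_cst.
by apply: (@cvgB _ _ _ (nbhs x)); [exact: cvg_id|exact: prox_continuous].
Qed.

Lemma moreau_grad_critical : v x0 = 0.
Proof. by rewrite /moreau_grad P_x0 subrr scaler0. Qed.

Lemma prox_in_manifold : \forall x \near x0, M (P x).
Proof.
have [c c0 Hc] := sharp.
have small : \forall x \near x0, enorm (v x) < c.
  have N0 : 0 < c / d.+1%:R by rewrite divr_gt0.
  have := @moreau_grad_continuous x0; rewrite /prop_for /continuous_at.
  rewrite moreau_grad_critical => /cvgrPdist_lt /(_ _ N0); apply: filterS => x.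
  rewrite sub0r normrN ltr_pdivlMr // => xc; apply: le_lt_trans xc.
  by rewrite (le_trans (enorm_le_norm _)) // mulrC ler_wpM2l // ler_nat.
apply: filterS (filterI (P_near Hc) small) => x [Hx xc].
apply: contrapT => /Hx /(_ _ (P_sub x)); rewrite leNgt => /negP; exact.
Qed.

(** As [v x] is a subgradient at [y = P x], the function [F - <v x, .> + rho/2 |. - y|^2] is minimal
    at [y] among nearby points of [M]; the quadratic has zero gradient at [y], and [u] and [- u] are
    both tangent. *)
Lemma prox_stationary : \forall x \near x0, forall u,
  u *m jac g (P x) = 0 -> dotv u (v x - dF (P x)) = 0.
Proof.
have Hf := P_near (near_join (model_f mod)).
have Ht := P_near (model_tangent mod).
have Hg := P_near (C2_near_grad (model_F mod)).
have HM := prox_in_manifold.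
apply: filterS (filterI (filterI Hf Ht) (filterI Hg HM)) => x [[fx tx] [gx Mx]].
set y := P x in fx tx gx Mx *.
have fy : f y = (F y)%:E := nbhs_singleton fx Mx.
have ge0 u : u *m jac g y = 0 -> 0 <= dotv u (dF y - v x).
  move=> uJ.
  have H1 := has_gradZ (-1) (has_grad_dotv (v x) y).
  have H2 := has_gradZ (rho / 2) (has_grad_sqr_norm y).
  have := has_gradD (has_gradD gx H1) H2; rewrite scaler0 addr0 scaleN1r => H.
  apply: (tangent_first_order H _ (tx Mx u uJ)).
  apply: filterS fx => z fz Mz.
  have := weak_subgradient z rho_gt0 f_gtNy f_wcvx (P_sub x).
  rewrite -/y fz // lee_fin enorm_sqr.
  rewrite fy.
  rewrite /= dotvDl dotvNl subrr dot0v; move: (v x) => w.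
  by rewrite (dotvC w) dotvDl dotvNl; lra.
move=> u uJ; have := ge0 _ uJ; have := ge0 (- u).
rewrite mulNmx uJ oppr0 => /(_ erefl); rewrite dotvNl -[v x - _]opprB dotvNr.
by move: (dotv _ _) => r r1 r2; lra.
Qed.

(** The multiplier given by [multiplier_formula]; being explicit, it inherits continuity from
    [P]. *)
Definition prox_multiplier x : 'rV[R]_m :=
  (v x - dF (P x)) *m B^T *m invmx (B *m jac g (P x))^T.

Definition prox_kkt x : 'rV[R]_(d + m) := row_mx (P x) (prox_multiplier x).

Let near_unit : \forall y \near x0, B *m jac g y \in unitmx.
Proof.
have [_ Jc] := nbhs_singleton (model_C1 mod).
apply: (@cvg_unitmx _ _ (nbhs x0) _ _ (fun y => B *m jac g y) (B *m jac g x0)).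
  by apply: (@cvg_mulmx _ _ (nbhs x0) _ _ _ _ (cst B)) => //; exact: cvg_cst.
by rewrite (model_B mod) unitmx1.
Qed.

Let near_G : \forall y \near x0, forall j,
  [/\ has_grad (G j) y (g j y), has_jac (g j) y (h j y) & {for y, continuous (h j)}].
Proof.
by apply: (@filter_forall _ _ _ (nbhs x0) (nbhs_filter x0)); exact: model_G mod.
Qed.

Lemma prox_multiplierE : \forall x \near x0,
  prox_multiplier x *m (jac g (P x))^T = v x - dF (P x).
Proof.
apply: filterS (filterI prox_stationary (P_near near_unit)) => x [Hx ux].
exact/esym/multiplier_formula.
Qed.

Lemma prox_kktE : \forall x \near x0,
  kkt dF G g mu^-1 (prox_kkt x) = row_mx (mu^-1 *: x) 0.
Proof.
apply: filterS (filterI (filterI prox_multiplierE prox_in_manifold)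
  (P_near (model_M mod))) => x [[Hx Mx] Gx].
rewrite /kkt /prox_kkt row_mxKl row_mxKr; congr row_mx.
  rewrite /lagrangian_grad -jac_mul Hx /moreau_grad scalerBr.
  by rewrite [dF _ + _]addrC subrK subrK.
by apply/rowP => j; rewrite !mxE; exact: Gx.1.
Qed.

Lemma prox_kkt_continuous : \forall x \near x0, {for x, continuous prox_kkt}.
Proof.
apply: filterS (filterI (filterI (P_near near_unit) (P_near (model_C1 mod)))
  (P_near (model_F mod))) => x [[ux [_ Jc]] [_ /has_jac_continuous dFc _]].
have Pc := @prox_continuous x.
have vc := @moreau_grad_continuous x.
have JPc : jac g (P y) @[y --> x] --> jac g (P x).
  exact: (@cvg_comp _ _ _ P (jac g) (nbhs x) (nbhs (P x)) _ Pc Jc).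
have dPc : dF (P y) @[y --> x] --> dF (P x).
  exact: (@cvg_comp _ _ _ P dF (nbhs x) (nbhs (P x)) _ Pc dFc).
have lc : prox_multiplier y @[y --> x] --> prox_multiplier x.
  apply: (@cvg_mulmx _ _ (nbhs x)); last first.
    apply: (@cvg_invmx _ _ (nbhs x)); last by rewrite unitmx_tr.
    apply: (@cvg_trmx _ _ (nbhs x)).
    by apply: (@cvg_mulmx _ _ (nbhs x) _ _ _ _ (cst B)) => //; exact: cvg_cst.
  apply: (@cvg_mulmx _ _ (nbhs x) _ _ _ _ _ (cst B^T)); last exact: cvg_cst.
  exact: (@cvgB _ _ _ (nbhs x)).
exact: continuous_row_mx.
Qed.

Let lam0 := prox_multiplier x0.
Let Q := lagrangian_hess hF h lam0 x0.

Lemma lagrangian_grad_critical : lagrangian_grad dF g lam0 x0 = 0.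
Proof.
have := nbhs_singleton prox_multiplierE.
rewrite P_x0 moreau_grad_critical sub0r jac_mul => E.
by rewrite /lagrangian_grad E subrr.
Qed.

Lemma lagrangian_C2 : C2_near (lagrangian F G lam0) (lagrangian_grad dF g lam0)
  (lagrangian_hess hF h lam0) x0.
Proof.
apply: C2_nearD (model_F mod) _; apply: C2_near_sum => j.
exact: C2_nearZ (model_G mod j).
Qed.

Lemma lagrangian_manifold : \forall z \near x0, M z -> f z = (lagrangian F G lam0 z)%:E.
Proof.
apply: filterS (filterI (model_f mod) (model_M mod)) => z [fz Mz] /[dup] /fz -> /Mz Gz.
by rewrite /lagrangian big1 ?addr0 // => j _; rewrite Gz mulr0.
Qed.

Let dirs u : u *m jac g x0 = 0 -> forall e, 0 < e ->
  exists2 r, 0 < r & forall t, 0 < t < r ->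
    exists2 u', M (x0 + t *: u') & `|u' - u| <= e.
Proof. exact: nbhs_singleton (model_tangent mod) (model_x mod) u. Qed.

Let L_x0 : f x0 = (lagrangian F G lam0 x0)%:E.
Proof. exact: nbhs_singleton lagrangian_manifold (model_x mod). Qed.

(** On [M] the Lagrangian equals [f], and [f + rho/2 |. - x0|^2] is minimal at [x0] by
    [critical_lower]. The constant [L0] is subtracted so that the tested function vanishes at
    [x0]. *)
Lemma hessian_lower u : u *m jac g x0 = 0 ->
  0 <= dotv (u *m (Q + rho%:M)) u.
Proof.
move=> uJ.
pose L0 := lagrangian F G lam0 x0.
have C := C2_nearD (C2_nearD lagrangian_C2 (C2_near_sqr_dist rho x0))
  (C2_near_cst (- L0) x0).
rewrite -[_ + rho%:M]addr0.
apply: (tangent_nonneg (C2_near_grad C) _ (C2_near_jac C) _ _ (dirs uJ)).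
- by rewrite lagrangian_grad_critical subrr scaler0 !addr0.
- by rewrite subrr dot0v mulr0 addr0 subrr.
apply: filterS lagrangian_manifold => z fz /fz {}fz.
have := critical_lower f_gtNy rho_gt0 f_wcvx x0_crit z.
by rewrite L_x0 fz lee_fin /= enorm_sqr -/L0; lra.
Qed.

Lemma prox_kkt_unit : kkt_jac hF g h mu^-1 (prox_kkt x0) \in unitmx.
Proof.
apply: (@kkt_jac_unit _ _ _ _ _ _ _ _ B); rewrite /prox_kkt row_mxKl ?row_mxKr P_x0.
  exact: model_B mod.
move=> u uJ u0.
have uu : 0 < dotv u u by rewrite lt_def dotvv_eq0 u0 dotvv_ge0.
have := hessian_lower uJ; rewrite /Q /lam0 !mulmxDr !mul_mx_scalar !dotvDl !dotvZl.
have : rho < mu^-1 by rewrite -[rho]invrK ltf_pV2 // posrE invr_gt0.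
move: (dotv _ u) (dotv _ _) uu => a b a0 rm; nra.
Qed.

(** Derivative of the right-hand side [(x / mu, 0)], times the inverse bordered Hessian, times the
    projection onto the point component. *)
Definition prox_jacobian x : 'M[R]_d :=
  row_mx (mu^-1)%:M 0 *m invmx (kkt_jac hF g h mu^-1 (prox_kkt x))
    *m col_mx 1%:M 0.

Lemma prox_C1 : C1_near P prox_jacobian x0.
Proof.
have Kc : \forall x \near x0,
    {for x, continuous (fun y => kkt_jac hF g h mu^-1 (prox_kkt y))}.
  apply: filterS (filterI (filterI prox_kkt_continuous (P_near near_G))
    (P_near (model_F mod))) => x [[Yc Gx] [_ _ hFc]].
  apply: continuous_kkt_jac => //; rewrite /prox_kkt row_mxKl //.
  - by move=> j; have [_ /has_jac_continuous] := Gx j.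
  - by move=> j; have [] := Gx j.
have Ku : \forall x \near x0, kkt_jac hF g h mu^-1 (prox_kkt x) \in unitmx.
  apply: (@cvg_unitmx _ _ (nbhs x0) _ _ (fun x => kkt_jac hF g h mu^-1 (prox_kkt x))
    (kkt_jac hF g h mu^-1 (prox_kkt x0))); last exact: prox_kkt_unit.
  exact: nbhs_singleton Kc.
(* Differentiating at [x] requires the system on a neighbourhood of [x], hence the [near_join]. *)
apply: filterS (filterI (filterI (filterI Kc Ku)
  (filterI prox_kkt_continuous (near_join prox_kktE)))
  (filterI (P_near near_G) (P_near (model_F mod)))).
move=> x [[[Kx ux] [Yc Ex]] [Gx [_ Fj _]]]; split; last first.
  apply: (@cvg_mulmx _ _ (nbhs x) _ _ _ _ _ (cst (col_mx 1%:M 0))); last exact: cvg_cst.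
  apply: (@cvg_mulmx _ _ (nbhs x) _ _ _ _ (cst (row_mx (mu^-1)%:M 0))).
    exact: cvg_cst.
  exact: (@cvg_invmx _ _ (nbhs x)).
have HT : has_jac (fun y => row_mx (mu^-1 *: y) 0 : 'rV[R]_(d + m)) x
    (row_mx (mu^-1)%:M 0).
  apply: has_jac_row_mx; last exact: has_jac_cst.
  have := has_jacZ mu^-1 (has_jac_sub 0 x); rewrite scalemx1.
  by under eq_fun do rewrite subr0.
have HK : has_jac (kkt dF G g mu^-1) (prox_kkt x) (kkt_jac hF g h mu^-1 (prox_kkt x)).
  apply: kkt_has_jac; rewrite /prox_kkt row_mxKl //.
  - by move=> j; have [] := Gx j.
  - by move=> j; have [] := Gx j.
have := has_jac_comp (has_jac_implicit HT HK ux Yc Ex) (has_jac_lsubmx (prox_kkt x)).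
by under eq_fun do rewrite /prox_kkt row_mxKl.
Qed.

Definition moreau_hess x : 'M[R]_d := mu^-1 *: (1%:M - prox_jacobian x).

Lemma moreau_C2 : C2_near (fun y => fine (moreau mu f y)) v moreau_hess x0.
Proof.
apply: filterS prox_C1 => x [Pj Pc]; split.
- exact: moreau_has_grad f_gtNy f_closed rho_gt0 f_wcvx x0_crit mu_gt0 mu_lt x.
- apply: has_jacZ; rewrite -[- _]scaleN1r.
  have := has_jacD (has_jac_sub 0 x) (has_jacZ (-1) Pj).
  by under eq_fun do rewrite subr0 scaleN1r.
- apply: (@cvgZ _ _ _ (nbhs x)); first exact: cvg_cst.
  by apply: (@cvgB _ _ _ (nbhs x)) => //; exact: cvg_cst.
Qed.

Lemma moreau_critical_value : moreau mu f x0 = f x0.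
Proof.
rewrite (moreauE f_gtNy f_closed rho_gt0 f_wcvx x0_crit mu_gt0 mu_lt) P_x0.
by rewrite subrr enorm0 expr0n mulr0 addr0 fineK // critical_fin.
Qed.

(** The Lagrangian minus the envelope is nonnegative on [M] near [x0], and its value and gradient
    vanish at [x0], so [tangent_nonneg] applies. *)
Lemma moreau_hess_le u : u *m jac g x0 = 0 ->
  dotv (u *m moreau_hess x0) u <= dotv (u *m Q) u.
Proof.
move=> uJ.
have C := C2_nearD lagrangian_C2 (C2_nearZ (-1) moreau_C2).
rewrite -subr_ge0 -dotvNl -dotvDl -mulmxN -mulmxDr -scaleN1r.
apply: (tangent_nonneg (C2_near_grad C) _ (C2_near_jac C) _ _ (dirs uJ)).
- by rewrite lagrangian_grad_critical moreau_grad_critical scaler0 addr0.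
- by rewrite moreau_critical_value L_x0 /= mulN1r subrr.
apply: filterS lagrangian_manifold => z fz /fz {}fz.
have := moreau_le f mu z z; rewrite /prox_objective subrr enorm0 expr0n mulr0 adde0.
rewrite fz -(fineK (moreau_fin f_gtNy f_closed rho_gt0 f_wcvx x0_crit mu_gt0 mu_lt z)).
by rewrite lee_fin /= mulN1r subr_ge0.
Qed.

Lemma second_variation_active u : u *m jac g x0 = 0 ->
  second_variation f M x0 u = (dotv (u *m Q) u)%:E.
Proof.
move=> uJ; apply: (second_variation_quad f_gtNy (C2_near_grad lagrangian_C2)
  lagrangian_grad_critical (C2_near_jac lagrangian_C2) (model_x mod)
  lagrangian_manifold).
exact: (model_parabolic mod uJ).
Qed.

End ProxSmooth.

(** * Quadratic forms and strict saddles *)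

Section QuadraticForms.
Context {R : realType} {d : nat}.
Implicit Types (Q H : 'M[R]_d) (u v w : 'rV[R]_d).

Lemma compact_esphere_ker {m : nat} (J : 'M[R]_(d, m)) :
  compact (esphere `&` [set u | u *m J = 0]).
Proof.
apply: bounded_closed_compact.
  exists 1; split; first exact: num_real.
  move=> s s1 y [/= y1 _]; apply: le_trans (norm_le_enorm _) _.
  by rewrite y1 ltW.
apply: closedI.
  have -> : @esphere R d = [set u | (dotv u u : R^o) = 1].
    apply/seteqP; split=> u; rewrite /esphere /= -enorm_sqr.
      by move=> ->; rewrite expr1n.
    by move=> /eqP; rewrite sqrp_eq1 ?enorm_ge0 // => /eqP.
  apply: (@closed_comp _ _ (fun u => dotv u u : R^o) [set s | s = 1]).
    by move=> u _; apply: (@cvg_dotv _ _ (nbhs u) _ _ id id); exact: cvg_id.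
  exact: closed_eq.
have -> : [set u : 'rV[R]_d | u *m J = 0] = [set u : 'rV[R]_d | `|u *m J| <= 0].
  by apply/seteqP; split=> u /=; [move=> ->; rewrite normr0|rewrite normr_le0 => /eqP].
apply: (@closed_comp _ _ (fun u => `|u *m J|) [set s | s <= 0]).
  move=> u _; apply: (@cvg_norm _ _ _ (nbhs u)).
  exact: continuous_mulmxr.
exact: closed_le.
Qed.

Lemma quad_form_min Q (S : set 'rV[R]_d) : compact S -> S !=set0 ->
  exists2 h, S h & forall u, S u -> dotv (h *m Q) h <= dotv (u *m Q) u.
Proof.
move=> Sc S0.
have [|h /set_mem Sh hmin] := @EVT_min_rV R d (fun u => dotv (u *m Q) u) S S0 Sc.
  apply: continuous_in_subspaceT => u _.
  apply: (@cvg_dotv _ _ (nbhs u) _ _ (fun v => v *m Q) id) => //.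
  exact: continuous_mulmxr.
by exists h => // u Su; apply: hmin; exact: mem_set.
Qed.

Lemma is_min_quad_form Q (S : set 'rV[R]_d) (q : 'rV[R]_d -> \bar R) h :
  (forall u, S u -> q u = (dotv (u *m Q) u)%:E) -> S h ->
  (forall u, S u -> dotv (h *m Q) h <= dotv (u *m Q) u) ->
  is_min [set q u | u in S] (dotv (h *m Q) h)%:E.
Proof.
move=> qE Sh hmin; right; split; first by exists h; rewrite ?qE.
by move=> _ [u Su <-]; rewrite qE // lee_fin; exact: hmin.
Qed.

(* A minimiser of the Rayleigh quotient over the sphere is an eigenvector. *)
Lemma sym_negative_eigenvalue H u : H^T = H -> dotv (u *m H) u < 0 ->
  exists2 a, a < 0 & eigenvalue H a.
Proof.
move=> Hs uH.
have normalize w : w != 0 -> esphere ((enorm w)^-1 *: w).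
  move=> w0; rewrite /esphere /= enormZ ger0_norm ?invr_ge0 ?enorm_ge0 //.
  by rewrite mulVf // enorm_eq0.
have u0 : u != 0 by apply: contraTneq uH => ->; rewrite mul0mx dot0v ltxx.
have Sc : compact (@esphere R d).
  (* With a matrix of zero columns the kernel is the whole space, so this is compactness of the
     sphere itself. *)
  have := @compact_esphere_ker 0 0; congr compact.
  by apply/seteqP; split=> v; [case|move=> Sv; split=> //=; rewrite mulmx0].
have [|h Sh hmin] := @quad_form_min H esphere Sc.
  by exists ((enorm u)^-1 *: u); exact: normalize.
set a := dotv (h *m H) h in hmin.
have hh : dotv h h = 1 by rewrite -enorm_sqr Sh expr1n.
have A0 w : 0 <= dotv (w *m (H - a%:M)) w.
  have [->|w0] := eqVneq w 0; first by rewrite mul0mx dot0v.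
  have := hmin _ (normalize _ w0).
  rewrite -scalemxAl dotvZl dotvZr mulrA -expr2 exprVn enorm_sqr.
  have ww : 0 < dotv w w by rewrite lt_def dotvv_eq0 w0 dotvv_ge0.
  rewrite mulrC ler_pdivlMr // mulmxBr mul_mx_scalar dotvDl dotvNl dotvZl.
  by rewrite subr_ge0.
have a0 : a < 0.
  have := A0 u; rewrite mulmxBr mul_mx_scalar dotvDl dotvNl dotvZl subr_ge0.
  move=> /le_lt_trans /(_ uH); apply: contraTT; rewrite -!leNgt => a0.
  by rewrite mulr_ge0 // dotvv_ge0.
exists a => //; apply/eigenvalueP; exists h; last first.
  by apply: contra_eq_neq hh => ->; rewrite dot0v eq_sym oner_neq0.
pose p := h *m (H - a%:M).
suff : p = 0 by rewrite /p mulmxBr mul_mx_scalar => /eqP; rewrite subr_eq0 => /eqP.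
have hp : dotv p h = 0.
  by rewrite /p mulmxBr mul_mx_scalar dotvDl dotvNl dotvZl hh mulr1 subrr.
have ph : dotv (p *m (H - a%:M)) h = dotv p p.
  have pT : p^T = (H - a%:M) *m h^T.
    by rewrite /p trmx_mul linearB /= Hs tr_scalar_mx.
  by rewrite /dotv pT mulmxA.
apply/eqP; rewrite -dotvv_eq0 eq_le dotvv_ge0 andbT leNgt; apply/negP => pp.
pose D := dotv (p *m (H - a%:M)) p.
(* Moving from [h] to [h - s p] changes the form of [H - a] by [- 2 s |p|^2 + s^2 D]; this [s] makes
   the last term at most [s |p|^2], contradicting nonnegativity unless [p = 0]. *)
pose s := dotv p p / (`|D| + 1).
have D1 : 0 < `|D| + 1 by rewrite ltr_wpDl.
have s0 : 0 < s by rewrite divr_gt0.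
have := A0 (h - s *: p).
rewrite mulmxBl -scalemxAl !dotv_lin -/p hp -/D => H0.
have sD : s * D <= dotv p p.
  rewrite (@le_trans _ _ (s * `|D|)) ?ler_wpM2l ?(ltW s0) ?ler_norm //.
  by rewrite mulrAC ler_pdivrMr // ler_pM2l // lerDl.
have {}H0 : 0 <= - s * dotv p p - s * dotv p p + s * (s * D).
  by move: H0; rewrite ph; lra.
have : s * (s * D) <= s * dotv p p by rewrite ler_pM2l.
have : 0 < s * dotv p p by rewrite mulr_gt0.
by move: H0; lra.
Qed.

End QuadraticForms.

(** * The whole space as an active manifold *)

Section FullSpace.
Context {R : realType} {d : nat}.
Implicit Types (f : 'rV[R]_d -> \bar R) (x u : 'rV[R]_d).

Lemma Ck_on_cst {W : normedModType R} k (U : set 'rV[R]_d) (c : W) :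
  Ck_on k U (fun=> c).
Proof.
elim: k c => [|k IH] c; first by move=> x _; exact: cst_continuous.
split=> [x _|v]; first exact: differentiable_cst.
by under eq_fun do rewrite derive_cst; exact: IH.
Qed.

Lemma rV_thin n (v : 'rV[R]_n) : n = 0%N -> v = 0.
Proof. by move=> n0; move: v; rewrite n0 => v; exact: thinmx0. Qed.

(** Codimension 0: the equations take values in the trivial space of dimension [d - d], so the zero
    map has full rank. *)
Lemma defining_map_full k x (U : set 'rV[R]_d) : open_nbhs x U ->
  @defining_map R d k d U x U (fun=> 0).
Proof.
move=> Ux; split=> //.
- exact: Ck_on_cst.
- by apply/eqP; rewrite eqn_leq rank_leq_col subnn.
- by rewrite setIid; apply/seteqP; split=> z // [].
Qed.

Lemma tangent_space_full x u : tangent_space setT x u.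
Proof.
exists d, setT, (fun=> 0); split=> //; last by apply: rV_thin; rewrite subnn.
by apply: defining_map_full; split=> //; exact: openT.
Qed.

Lemma active_manifold_full f x : esmooth_around 2 f x ->
  active_manifold 2 f setT x.
Proof.
move=> [/near_open_nbhs[V [Vo Vx] Vf] [U [Uo Ux] UC]]; split=> //.
exists (V `&` U); split.
- by split; [exact: openI|].
- exists d => y; rewrite setTI => VUy; split=> //.
  exists (V `&` U), (fun=> 0); apply: defining_map_full.
  by split=> //; exact: openI.
- move=> y [_ [_ Uy]]; exists U, (fun y => fine (f y) : R^o); split=> //.
  by move=> z [_ [Vz _]] _; rewrite fineK //; exact: Vf.
- rewrite (_ : [set _ | _] = set0) ?ereal_inf0 //.
  by apply/seteqP; split=> // e [y [v [[_ /(_ I)]]]].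
Qed.

End FullSpace.

(** * Strict saddles of the envelope *)

Section MoreauSaddle.
Context {R : realType} {d : nat} (f : 'rV[R]_d -> \bar R) (rho mu : R)
  (x0 : 'rV[R]_d).
Context (f_gtNy : forall x, f x != -oo%E) (f_closed : closed_fun f)
  (rho_gt0 : 0 < rho) (f_wcvx : weakly_convex_with rho f)
  (x0_crit : critical f x0) (mu_gt0 : 0 < mu) (mu_lt : mu < rho^-1).
Implicit Types (x y z u : 'rV[R]_d).

Let C := (2 * mu)^-1 + (mu * (1 - rho * mu))^-1.

Let C_gt0 : 0 < C.
Proof.
have k0 := rho_mu_lt1 rho_gt0 mu_lt.
by rewrite addr_gt0 // invr_gt0 mulr_gt0.
Qed.

Let m_fin x : moreau mu f x \is a fin_num.
Proof. exact: moreau_fin f_gtNy f_closed rho_gt0 f_wcvx x0_crit mu_gt0 mu_lt x. Qed.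

Let m_lower x x' := moreau_lower f_gtNy f_closed rho_gt0 f_wcvx x0_crit
  mu_gt0 mu_lt x x'.

Lemma moreau_closed : closed_fun (moreau mu f).
Proof.
rewrite /closed_fun; have -> : [set p : 'rV[R]_d * R | (moreau mu f p.1 <= p.2%:E)%E] =
    [set p | 0 <= p.2 - fine (moreau mu f p.1)].
  by apply/seteqP; split=> p /=; rewrite -(fineK (m_fin p.1)) lee_fin /= subr_ge0.
apply: (@closed_comp _ _ (fun p : 'rV[R]_d * R => p.2 - fine (moreau mu f p.1) : R^o)
  [set s | 0 <= s]); last exact: closed_ge.
move=> p _; have p1 : (fun q : 'rV[R]_d * R => q.1) @ nbhs p --> nbhs p.1.
  exact: cvg_fst.
have p2 : (fun q : 'rV[R]_d * R => q.2) @ nbhs p --> nbhs p.2 by exact: cvg_snd.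
apply: (@cvgB _ R^o _ (nbhs p)) => //.
have := has_grad_continuous (moreau_has_grad f_gtNy f_closed rho_gt0 f_wcvx
  x0_crit mu_gt0 mu_lt p.1).
exact: cvg_comp p1.
Qed.

(** [moreau_lower] based at [z] is averaged over [x] and [y]; the gradient terms cancel and the
    quadratic ones are exactly the convexity defect of [C |.|^2]. *)
Lemma moreau_weakly_convex : weakly_convex (moreau mu f).
Proof.
exists (2 * C); first by rewrite mulr_gt0.
move=> x y t /andP[t0 t1]; set z := t *: x + (1 - t) *: y.
rewrite -(fineK (m_fin x)) -(fineK (m_fin y)) -(fineK (m_fin z)).
rewrite -!EFinD lee_fin /=.
have t1' : 0 <= 1 - t by rewrite subr_ge0.
have Hx := ler_wpM2l t0 (m_lower z x); have Hy := ler_wpM2l t1' (m_lower z y).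
rewrite -/C in Hx Hy.
have E : t * dotv (x - z) (moreau_grad f mu z)
    + (1 - t) * dotv (y - z) (moreau_grad f mu z) = 0.
  rewrite -!dotvZl -dotvDl (_ : _ + _ = 0) ?dot0v //.
  by rewrite /z; apply/rowP => i; rewrite !mxE; ring.
have N : enorm z ^+ 2 = t * enorm x ^+ 2 + (1 - t) * enorm y ^+ 2
    - (t * enorm (x - z) ^+ 2 + (1 - t) * enorm (y - z) ^+ 2).
  by rewrite !enorm_sqr /z !dotv_lin (dotvC y x); ring.
rewrite N; move: E Hx Hy; clear.
move: (dotv _ _) (dotv _ _) (fine _) (fine _) (fine _) => a b mx my mz.
move: C (enorm x ^+ 2) (enorm y ^+ 2) (enorm (x - z) ^+ 2) (enorm (y - z) ^+ 2).
move=> c nx ny nxz nyz E Hx Hy.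
have -> : 2 * c / 2 = c by field.
lra.
Qed.

Lemma moreau_critical : critical (moreau mu f) x0.
Proof.
split; first exact: m_fin.
exists (fun z => - C * enorm (z - x0) ^+ 2); first exact: littleo_enorm_sqr.
apply: (@nearW _ (nbhs x0) _ (nbhs_filter x0)) => z.
rewrite -(fineK (m_fin x0)) -(fineK (m_fin z)) -EFinD lee_fin /= dot0v add0r.
have := m_lower x0 z.
by rewrite (moreau_grad_critical f_gtNy f_closed rho_gt0 f_wcvx x0_crit mu_gt0 mu_lt)
  dotv0 addr0 -/C mulNr.
Qed.

(** Since the envelope is C^2 near [x0], the whole space is active and every direction is tangent;
    the second variation is then the Hessian form. *)
Lemma moreau_strict_saddle g (h : 'rV[R]_d -> 'M[R]_d) u :
  C2_near (fun y => fine (moreau mu f y)) g h x0 -> g x0 = 0 ->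
  dotv (u *m h x0) u < 0 -> strict_saddle (moreau mu f) x0.
Proof.
move=> mC2 gx0 uh.
have m_gtNy x : moreau mu f x != -oo%E by move: (m_fin x); rewrite fin_numE => /andP[].
split=> //.
- exact: moreau_closed.
- exact: moreau_weakly_convex.
- exact: moreau_critical.
exists setT, u; split.
- apply: active_manifold_full; split; last exact: C2_near_smooth mC2.
  by apply: (@nearW _ (nbhs x0) _ (nbhs_filter x0)) => z; exact: m_fin.
- exact: tangent_space_full.
rewrite (second_variation_quad m_gtNy (C2_near_grad mC2) gx0 (C2_near_jac mC2) I).
- by rewrite lte_fin.
- by apply: (@nearW _ (nbhs x0) _ (nbhs_filter x0)) => z _; rewrite fineK // m_fin.
by exists 0 => e e0; exists 1 => // t _; exists 0 => //; rewrite subrr normr0 ltW.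
Qed.

(** Stated for any active manifold at [x0], because a strict saddle brings its own manifold; the
    existentials hide the model and keep a kernel, two Hessians and the derivative of the proximal
    map. *)
Lemma active_second_order M : active_manifold 2 f M x0 ->
  exists m (J : 'M[R]_(d, m)) Q A (h : 'rV[R]_d -> 'M[R]_d),
    [/\ forall u, tangent_space M x0 u <-> u *m J = 0,
        forall u, u *m J = 0 -> second_variation f M x0 u = (dotv (u *m Q) u)%:E,
        forall u, u *m J = 0 -> dotv (u *m h x0) u <= dotv (u *m Q) u,
        C2_near (fun y => fine (moreau mu f y)) (moreau_grad f mu) h x0
      & C1_near (prox mu f) A x0 /\ h x0 = mu^-1 *: (1%:M - A x0)].
Proof.
move=> aM; have sharp := active_manifold_sharp aM.
have [m [F [dF [hF [G [g [h [B [mod tanE]]]]]]]]] := active_manifold_model aM.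
exists m, (jac g x0), (lagrangian_hess hF h
  (prox_multiplier f mu (dF := dF) (g := g) (B := B) x0) x0).
exists (prox_jacobian f mu (dF := dF) (hF := hF) (g := g) (h := h) (B := B)).
exists (moreau_hess f mu (dF := dF) (hF := hF) (g := g) (h := h) (B := B)).
split=> //.
- by move=> u; exact: (second_variation_active f_gtNy f_closed rho_gt0 f_wcvx
    x0_crit mu_gt0 mu_lt mod sharp).
- by move=> u; exact: (moreau_hess_le f_gtNy f_closed rho_gt0 f_wcvx
    x0_crit mu_gt0 mu_lt mod sharp).
- exact: (moreau_C2 f_gtNy f_closed rho_gt0 f_wcvx x0_crit mu_gt0 mu_lt mod sharp).
split=> //.
exact: (prox_C1 f_gtNy f_closed rho_gt0 f_wcvx x0_crit mu_gt0 mu_lt mod sharp).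
Qed.

End MoreauSaddle.

Unset Implicit Arguments.
Set Strict Implicit.

Theorem theorem3p1 (R : realType) (d : nat) (f : 'rV[R]_d -> \bar R)
    (rho : R) (xbar : 'rV[R]_d) (M : set 'rV[R]_d)
    (f_gtNy : forall x, f x != -oo%E)
    (f_closed : closed_fun f)
    (rho_gt0 : 0 < rho)
    (f_wcvx : weakly_convex_with rho f)
    (xbar_crit : critical f xbar)
    (M_active : active_manifold 2 f M xbar)
    (mu : R) (mu_gt0 : 0 < mu) (mu_lt : mu < rho^-1) :
  [/\ esmooth_around 2 (moreau mu f) xbar,
      (let H := hessian (fun y => fine (moreau mu f y)) xbar in
       let S := esphere `&` tangent_space M xbar in
       exists m1 m2 : \bar R,
         [/\ is_min [set (dotv (h *m H) h)%:E | h in S] m1,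
             is_min [set second_variation f M xbar h | h in S] m2
           & (m1 <= m2)%E])
    & strict_saddle f xbar ->
      [/\ strict_saddle (moreau mu f) xbar,
          unstable_fixed_point (prox mu f) xbar
        & exists2 a : R, eigenvalue ('J (prox mu f) xbar) a & 1 < a]].
Proof.
have [m [J [Q [A [h [tanE svE hQ mC2 _]]]]]] := active_second_order f_gtNy
  f_closed rho_gt0 f_wcvx xbar_crit mu_gt0 mu_lt M_active.
split.
- split; last exact: C2_near_smooth mC2.
  apply: (@nearW _ (nbhs xbar) _ (nbhs_filter xbar)) => z.
  exact: moreau_fin f_gtNy f_closed rho_gt0 f_wcvx xbar_crit mu_gt0 mu_lt z.
- move=> H S; have HE : H = h xbar := C2_near_hessian mC2.
  (* When the tangent space contains no unit vector, both minima are [+oo] by convention. *)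
  have [S0|/set0P S0] := eqVneq S set0.
    by exists +oo%E, +oo%E; split=> //; left; rewrite S0 image_set0.
  have SE : S = esphere `&` [set u | u *m J = 0].
    by rewrite /S; congr (_ `&` _); apply/seteqP; split=> u /tanE.
  have SJ u : S u -> u *m J = 0 by rewrite SE => -[].
  have Sc : compact S by rewrite SE; exact: compact_esphere_ker.
  have [h1 Sh1 min1] := quad_form_min H Sc S0.
  have [h2 Sh2 min2] := quad_form_min Q Sc S0.
  exists (dotv (h1 *m H) h1)%:E, (dotv (h2 *m Q) h2)%:E; split.
  + exact: is_min_quad_form.
  + by apply: is_min_quad_form => // u /SJ; exact: svE.
  + by rewrite lee_fin (le_trans (min1 _ Sh2)) // HE hQ // SJ.
move=> [_ _ _ _ [M' [u [M'_active tan_u sv_u]]]].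
(* The manifold [M'] of the saddle may differ from [M], so the second-order data are recomputed for
   it. *)
have {m J Q A h tanE svE hQ mC2} [m [J [Q [A [h [tanE svE hQ mC2 [pC1 hE]]]]]]] :=
  active_second_order f_gtNy f_closed rho_gt0 f_wcvx xbar_crit mu_gt0 mu_lt M'_active.
have uJ := (tanE u).1 tan_u.
have uh : dotv (u *m h xbar) u < 0.
  by apply: le_lt_trans (hQ u uJ) _; rewrite -lte_fin -svE.
have [a a0 /eigenvalueP[v vh v0]] :=
  sym_negative_eigenvalue (hessian_sym (C2_near_grad mC2) (C2_near_jac mC2)) uh.
have JA : 'J (prox mu f) xbar = A xbar := has_jac_jacobian (nbhs_singleton pC1).1.
have eig : eigenvalue ('J (prox mu f) xbar) (1 - mu * a).
  apply/eigenvalueP; exists v => //; rewrite JA.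
  have -> : A xbar = 1%:M - mu *: h xbar.
    by rewrite hE scalerA divff ?lt0r_neq0 // scale1r opprB addrC subrK.
  by rewrite mulmxBr mulmx1 -scalemxAr vh scalerA scalerBl scale1r.
have gt1 : 1 < 1 - mu * a by rewrite ltrBrDr gtrDl pmulr_rlt0.
split; last by exists (1 - mu * a).
  apply: (moreau_strict_saddle f_gtNy f_closed rho_gt0 f_wcvx xbar_crit mu_gt0
    mu_lt mC2 _ uh).
  exact: moreau_grad_critical f_gtNy f_closed rho_gt0 f_wcvx xbar_crit mu_gt0 mu_lt.
split.
- exact: prox_critical f_gtNy f_closed rho_gt0 f_wcvx xbar_crit mu_gt0 mu_lt.
- exact: C1_near_smooth pC1.
exists (real_complex R (1 - mu * a)); first by rewrite eigenvalue_map.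
apply: lt_le_trans (normc_ge_Re _).
rewrite gtr0_norm /=; first by move: gt1; rewrite -ltcR.
exact: lt_trans ltr01 gt1.
Qed.
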